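(* The continuous spectrum of any selfadjoint extension $L_{W_1}$ (where $W_1$ is a unitary operator in $H$) of the minimal operator $L_0(1,0,1)$ in the Hilbert space $L^2(1,0,1)$ is $\sigma_c(L_{W_1})=\mathbb{R}$.
   Context: Let $H$ be a separable Hilbert space with $\dim H>0$, let $-\infty<a_1<a_3<+\infty$, and put $I_1=(-\infty,a_1)$, $I_3=(a_3,+\infty)$. For $k=1,3$ let $A_k:D(A_k)\subset H\to H$ be a linear selfadjoint operator. $L^2(H,I)$ denotes the Hilbert space of square-integrable $H$-valued functions on the interval $I$, and $L^2(1,0,1)=L^2(H,I_1)\oplus 0\oplus L^2(H,I_3)$, whose elements are written $u=(u_1,0,u_3)$. $H_{k,+}$ is $D(A_k)$ with inner product $(f,g)_{k,+}=(A_kf,A_kg)_H+(f,g)_H$; $H_{k,-}$ is the corresponding negative space, i.e. the completion of $H$ in the norm $\|f\|_{k,-}=\sup\{|(f,g)_H|/\|g\|_{k,+}: 0\ne g\in H_{k,+}\}$. $\tilde A_k:H\to H_{k,-}$ is the adjoint of the continuous operator $A_k:H_{k,+}\to H$; it is a continuous extension of $A_k$. Operators: the maximal operator $L_k$ acts by $L_ku=iu'+\tilde A_ku$ on the domain of all $u\in L^2(H,I_k)$ for which $iu'+\tilde A_ku$ (derivative in the sense of $H_{k,-}$-valued distributions) belongs to $L^2(H,I_k)$. Each such $u$ has a representative which is continuous into $H$ up to the finite endpoint of $I_k$, so its boundary value there is an element of $H$. The minimal operator $L_{k0}$ is the closure in $L^2(H,I_k)$ of the restriction of $L_k$ to finite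 sums $\sum_j\varphi_jh_j$ with $\varphi_j\in C_0^\infty(I_k)$, $h_j\in D(A_k)$. Put $L_0(1,0,1)=L_{10}\oplus0\oplus L_{30}$. For a unitary operator $W_1:H\to H$, $L_{W_1}$ is the selfadjoint extension of $L_0(1,0,1)$ in $L^2(1,0,1)$ obtained by restricting $L_1\oplus0\oplus L_3$ to those $u=(u_1,0,u_3)$ in its domain with $u_3(a_3)=W_1u_1(a_1)$. The continuous spectrum $\sigma_c(T)$ of a closed operator $T$ is the set of $\lambda\in\mathbb{C}$ such that $T-\lambda$ is injective with dense range that is not the whole space. *)

(* Defs.v *)
From HB Require Import structures.
From mathcomp Require Import all_boot all_order all_algebra.
From mathcomp Require Import sesquilinear complex.
From mathcomp Require Import all_classical all_reals all_analysis.

Set Implicit Arguments.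
Unset Strict Implicit.
Unset Printing Implicit Defensive.

Import Order.TTheory GRing.Theory Num.Theory.
Import numFieldNormedType.Exports.

Local Open Scope classical_set_scope.
Local Open Scope ring_scope.
Local Open Scope complex_scope.

(* Norms over R[i] take their values in R[i]; [rnorm] is the same number in R. *)
Definition rnorm (R : realType) (V : normedModType R[i]) (x : V) : R :=
  complex.Re `|x|.

Definition separable (T : topologicalType) : Prop :=
  exists S : set T, countable S /\ dense S.

(* A Hilbert space given by representatives: [hmem] is the set of               *)
(* representatives, and u, v represent the same vector iff hnorm (u - v) = 0.  *)
(* This covers an L^2 space without choosing almost-everywhere classes.         *)
Record hspace (R : realType) := HSpace {
  hcar :> lmodType R[i] ;
  hmem : set hcar ;
  hdot : hcar -> hcar -> R[i] }.

Section Operators.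
Context (R : realType) (E : hspace R).

Definition hnorm (x : E) : R := Num.sqrt (complex.Re (hdot x x)).

(* Linear operators in E are identified with their graphs, consisting of all    *)
(* the pairs of representatives.                                                *)
Implicit Types T : set (E * E).

Definition hdense (S : set E) : Prop :=
  forall f, hmem f -> forall e : R, 0 < e ->
    exists s, [/\ hmem s, S s & hnorm (f - s) < e].

Definition dom T : set E := [set u | exists v, T (u, v)].

Definition adjoint T : set (E * E) :=
  [set p | [/\ hmem p.1, hmem p.2 &
     forall q, T q -> hdot q.2 p.1 = hdot q.1 p.2]].

(* The adjoint of a densely defined graph is a linear subspace and the graph of *)
(* a function modulo representatives, so these properties of T are implied.     *)
Definition selfadjoint T : Prop := hdense (dom T) /\ T = adjoint T.

Definition op_closure T : set (E * E) :=
  [set p | [/\ hmem p.1, hmem p.2 &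
     forall e : R, 0 < e ->
       exists q, [/\ T q, hnorm (p.1 - q.1) < e & hnorm (p.2 - q.2) < e]]].

Definition shifted_range T (l : R[i]) : set E :=
  [set w | exists p, T p /\ w = p.2 - l *: p.1].

Definition continuous_spectrum T : set R[i] :=
  [set l | [/\ forall p, T p -> hnorm (p.2 - l *: p.1) = 0 -> hnorm p.1 = 0,
     hdense (shifted_range T l) &
     exists f, hmem f /\ forall w, shifted_range T l w -> hnorm (f - w) != 0]].

End Operators.

(* The Hilbert sum E1 (+) 0 (+) E3: (u1, 0, u3) is written as (u1, u3). *)
Definition hsum (R : realType) (E1 E3 : hspace R) : hspace R :=
  @HSpace R (E1 * E3)%type
    [set u | hmem u.1 /\ hmem u.2]
    (fun u v => hdot u.1 v.1 + hdot u.2 v.2).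

Definition op_sum (R : realType) (E1 E3 : hspace R)
    (T1 : set (E1 * E1)) (T3 : set (E3 * E3)) :
    set (hsum E1 E3 * hsum E1 E3) :=
  [set p | T1 (p.1.1, p.2.1) /\ T3 (p.1.2, p.2.2)].

Section Bochner.
Context (R : realType) (V : normedModType R[i]).
Notation mu := (@lebesgue_measure R).
Implicit Types (D : set R) (f s : R -> V).

Definition simple_fun s : Prop :=
  finite_set (range s) /\ forall v, measurable (s @^-1` [set v]).

Definition strongly_measurable D f : Prop :=
  exists s : nat -> R -> V, (forall n, simple_fun (s n)) /\
    {ae mu, forall t, D t -> s n t @[n --> \oo] --> f t}.

Definition simple_integral D s : V :=
  \sum_(v \in range s) (fine (mu (D `&` s @^-1` [set v])))%:C *: v.

Definition is_bochner_integral D f (x : V) : Prop :=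
  strongly_measurable D f /\
  exists s : nat -> R -> V,
    [/\ forall n, simple_fun (s n),
        forall n v, v != 0 -> (mu (D `&` s n @^-1` [set v]) < +oo)%E,
        (\int[mu]_(t in D) (rnorm (f t - s n t))%:E)%E @[n --> \oo] --> 0%E &
        simple_integral D (s n) @[n --> \oo] --> x].

Definition bochner D f : V := xget 0 (is_bochner_integral D f).

(* Real-valued test functions suffice: by linearity a vector distribution is    *)
(* determined by its values on them, and they span C_0^oo(D) over R[i].         *)
Definition test_fun D (phi : R -> R) : Prop :=
  (forall n t, derivable (derive1n n phi) t 1) /\
  exists K : set R, [/\ compact K, K `<=` D & forall t, ~ K t -> phi t = 0].

Definition dist_of D f (phi : R -> R) : V :=
  bochner D (fun t => (phi t)%:C *: f t).

Definition dist_deriv (T : (R -> R) -> V) (phi : R -> R) : V :=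
  - T (derive1 phi).

End Bochner.

Section Hilbert.
Context (R : realType) (H : completeNormedModType R[i])
  (ip : {dot H for @Num.conj R[i]}).
Notation mu := (@lebesgue_measure R).

Definition hspace_of : hspace R := @HSpace R H setT (fun x y => ip x y).

Definition L2mem (I : set R) (u : R -> H) : Prop :=
  strongly_measurable I u /\
  (\int[mu]_(t in I) (rnorm (u t) ^+ 2)%:E < +oo)%E.

Definition L2dot (I : set R) (u v : R -> H) : R[i] :=
  Rintegral mu I (fun t => complex.Re (ip (u t) (v t))) +i*
  Rintegral mu I (fun t => complex.Im (ip (u t) (v t))).

Definition L2 (I : set R) : hspace R :=
  @HSpace R (R -> H) (L2mem I) (L2dot I).

Definition unitary (W : H -> H) : Prop :=
  (forall x y, ip (W x) (W y) = ip x y) /\ forall y, exists x, W x = y.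

Section NegativeSpace.
(* The operator with domain D and values A g for g in D; the values of A        *)
(* outside D play no role.                                                      *)
Variables (D : set H) (A : H -> H).

Definition graph_of : set (hspace_of * hspace_of) :=
  [set p | D p.1 /\ p.2 = A p.1].

Definition pos_dot (f g : H) : R[i] := ip (A f) (A g) + ip f g.

Definition pos_norm (g : H) : R := Num.sqrt (complex.Re (pos_dot g g)).

Definition neg_norm (f : H) : R :=
  sup [set r | exists g, [/\ D g, g != 0 &
                 r = complex.Re `|ip f g| / pos_norm g]].

(* A realisation of the completion of H in the negative norm. *)
Record neg_space := NegSpace {
  neg_car :> completeNormedModType R[i] ;
  neg_emb : {linear H -> neg_car} ;
  neg_embE : forall f, rnorm (neg_emb f) = neg_norm f ;
  neg_emb_dense : dense (range neg_emb) }.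

Variable N : neg_space.

(* The extension by continuity of f |-> (f, g)_H from H to the negative space,  *)
(* for g in D.                                                                  *)
Definition is_pairing (a : N) (g : H) (z : R[i]) : Prop :=
  forall e : R[i], 0 < e ->
    \forall b \near a, forall f, neg_emb N f = b -> `|ip f g - z| < e.

Definition pairing (a : N) (g : H) : R[i] := xget 0 (is_pairing a g).

(* The adjoint of A, from the positive space to H, as a map from H to the       *)
(* negative space.                                                              *)
Definition ext_op (f : H) : N :=
  xget 0 [set a | forall g, D g -> pairing a g = ip f (A g)].

Definition max_op (I : set R) : set (L2 I * L2 I) :=
  [set p | [/\ L2mem I p.1, L2mem I p.2 &
     forall phi, test_fun I phi ->
       'i%C *: dist_deriv (dist_of I (neg_emb N \o p.1)) phi
         + dist_of I (ext_op \o p.1) phi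
       = dist_of I (neg_emb N \o p.2) phi]].

Arguments max_op : clear implicits.

Definition test_sums (I : set R) : set (R -> H) :=
  [set u | exists (n : nat) (phi : 'I_n -> R -> R) (h : 'I_n -> H),
     [/\ forall j, test_fun I (phi j), forall j, D (h j) &
         u = fun t => \sum_(j < n) (phi j t)%:C *: h j]].

Definition min_op (I : set R) : set (L2 I * L2 I) :=
  op_closure (E := L2 I) (max_op I `&` [set p | test_sums I p.1]).

End NegativeSpace.
Arguments max_op {D A} N I.
Arguments min_op {D A} N I.

(* x is the value at a of a representative of u which is continuous on I and up *)
(* to its endpoint a.                                                           *)
Definition boundary_value (I : set R) (a : R) (u : R -> H) (x : H) : Prop :=
  exists w : R -> H,
    [/\ {ae mu, forall t, I t -> u t = w t},
        {within I `|` [set a], continuous w} & w a = x].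

Section Coupled.
Variables (a1 a3 : R) (D1 D3 : set H) (A1 A3 : H -> H)
  (N1 : neg_space D1 A1) (N3 : neg_space D3 A3).
Let I1 : set R := `]-oo, a1[.
Let I3 : set R := `]a3, +oo[.

Definition L2_101 : hspace R := hsum (L2 I1) (L2 I3).

Definition L0_101 : set (L2_101 * L2_101) :=
  op_sum (min_op N1 I1) (min_op N3 I3).

Definition L_ext (W : H -> H) : set (L2_101 * L2_101) :=
  op_sum (max_op N1 I1) (max_op N3 I3) `&`
  [set p | exists x, boundary_value I1 a1 p.1.1 x /\
                     boundary_value I3 a3 p.1.2 (W x)].

End Coupled.
End Hilbert.
Arguments graph_of {R H} ip D A.
Arguments L0_101 {R H ip} a1 a3 {D1 D3 A1 A3} N1 N3.
Arguments L_ext {R H ip} a1 a3 {D1 D3 A1 A3} N1 N3 W.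

(* Main.v *)
Require Import Defs.
From HB Require Import structures.
From mathcomp Require Import all_boot all_order all_algebra.
From mathcomp Require Import sesquilinear complex.
From mathcomp Require Import all_classical all_reals all_analysis.
From mathcomp Require Import ring lra.
From mathcomp Require Import measurable_realfun.

Set Implicit Arguments.
Unset Strict Implicit.
Unset Printing Implicit Defensive.

Import Order.TTheory GRing.Theory Num.Theory.
Import numFieldNormedType.Exports.

Local Open Scope classical_set_scope.
Local Open Scope ring_scope.
Local Open Scope complex_scope.

(** With [B = i A], the equation [v = L u] says [u' = B u - i v] weakly, where [B] is
    skew-adjoint for the real inner product [Re (x, y)].  Testing against [D(A)] and
    using Lebesgue points turns this into an integral identity along a set of full
    measure; regularising with the resolvents of [B] gives Green's formula, the
    uniform continuity of [u], and hence traces at the finite endpoint.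

    On [u' = B u + c u + k] Green's formula is an a priori estimate when [Re c <> 0],
    and the Riesz theorem then solves the equation, the trace being arbitrary on the
    half line where solutions with that sign of [Re c] decay.  As [W] is unitary the
    boundary terms of the two half lines cancel, so coupling the two equations
    through [W] gives a symmetric operator whose shifts by nonreal numbers are onto,
    hence a selfadjoint operator without nonreal spectrum.

    For real [l] a solution of [L u = l u] has constant norm and therefore vanishes,
    so [L - l] is injective with dense range.  It is not onto: decaying solutions
    with a fixed trace and decay rates [16 ^- n] have an explicit Gram matrix, and a
    series of them is a right-hand side which contradicts Green's formula. *)

(** * Hilbert spaces of representatives *)

(** Real scalar products are used throughout: the energy identities are real, and a complex identity
    is recovered as two real ones, tested with [y] and with [i y]. Vectors are representatives, so
    every function space is only semidefinite, and equality is replaced by the vanishing of the norm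
    of a difference. The obstacle is that a weak solution takes values outside the domain: it can be
    paired with fixed vectors of [D(A)], but not with another solution. The resolvents
    [(1 - e B)^-1] are contractions that commute with [B] and map into the domain; after them the
    terms in [B] cancel by skewness, and [e] may tend to 0. Separability gives one countable
    graph-dense family, hence one set of full measure on which all test vectors can be used at once.
    At infinity no limit is taken: the product of two solutions is integrable, so it is small at
    suitable far points. To defeat surjectivity at a real point it is enough to spoil one half line,
    since with source 0 on the other one the trace there must vanish. *)

Section RealPreHilbert.
Context (R : realType) (X : lmodType R[i]).

(* Completeness up to vectors of norm 0; complex scalars only act on [mem]. *)
Record real_hilbert (mem : set X) (dot : X -> X -> R) : Prop := RHilb {
  rh0 : mem 0;
  rhD : forall x y, mem x -> mem y -> mem (x + y);
  rhZ : forall (z : R[i]) x, mem x -> mem (z *: x);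
  rh_sym : forall x y, mem x -> mem y -> dot x y = dot y x;
  rh_Dl : forall x y z, mem x -> mem y -> mem z -> dot (x + y) z = dot x z + dot y z;
  rh_Zl : forall (r : R) x y, mem x -> mem y -> dot (r%:C *: x) y = r * dot x y;
  rh_ge0 : forall x, mem x -> 0 <= dot x x;
  rh_complete : forall u : nat -> X, (forall n, mem (u n)) ->
    (forall e : R, 0 < e -> exists N, forall m n, (N <= m)%N -> (N <= n)%N ->
       dot (u m - u n) (u m - u n) < e) ->
    exists2 l, mem l & forall e : R, 0 < e -> exists N, forall n, (N <= n)%N ->
       dot (u n - l) (u n - l) < e }.

Context (mem : set X) (dot : X -> X -> R) (hX : real_hilbert mem dot).
Local Notation nsq x := (dot x x).

Lemma rhN x : mem x -> mem (- x).
Proof. by rewrite -scaleN1r; exact: (rhZ hX). Qed.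

Lemma rhB x y : mem x -> mem y -> mem (x - y).
Proof. by move=> mx my; apply: (rhD hX) => //; exact: rhN. Qed.

Lemma rh_Nl x y : mem x -> mem y -> dot (- x) y = - dot x y.
Proof.
move=> mx my; have -> : - x = (-1)%:C *: x by rewrite raddfN /= scaleN1r.
by rewrite (rh_Zl hX) // mulN1r.
Qed.

Lemma rh_Bl x y z : mem x -> mem y -> mem z -> dot (x - y) z = dot x z - dot y z.
Proof. by move=> mx my mz; rewrite (rh_Dl hX) ?rh_Nl//; exact: rhN. Qed.

Lemma rh_Dr x y z : mem x -> mem y -> mem z -> dot x (y + z) = dot x y + dot x z.
Proof.
move=> mx my mz; rewrite (rh_sym hX mx (rhD hX my mz)) (rh_Dl hX) //.
by rewrite (rh_sym hX my mx) (rh_sym hX mz mx).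
Qed.

Lemma rh_Nr x y : mem x -> mem y -> dot x (- y) = - dot x y.
Proof. by move=> mx my; rewrite (rh_sym hX mx (rhN my)) rh_Nl // (rh_sym hX my mx). Qed.

Lemma rh_Br x y z : mem x -> mem y -> mem z -> dot x (y - z) = dot x y - dot x z.
Proof. by move=> mx my mz; rewrite rh_Dr ?rh_Nr//; exact: rhN. Qed.

Lemma rh_Zr (r : R) x y : mem x -> mem y -> dot x (r%:C *: y) = r * dot x y.
Proof.
by move=> mx my; rewrite (rh_sym hX mx (rhZ hX _ my)) (rh_Zl hX) // (rh_sym hX my mx).
Qed.

Lemma rh_nsqD x y : mem x -> mem y -> nsq (x + y) = nsq x + 2 * dot x y + nsq y.
Proof.
move=> mx my; have mxy := rhD hX mx my.
rewrite (rh_Dl hX) // !rh_Dr // (rh_sym hX my mx); ring.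
Qed.

Lemma rh_nsqB x y : mem x -> mem y -> nsq (x - y) = nsq x - 2 * dot x y + nsq y.
Proof.
move=> mx my; have mN := rhN my; have mxy := rhB mx my.
rewrite rh_Bl // !rh_Br // (rh_sym hX my mx); ring.
Qed.

Lemma rh_nsqZ (r : R) x : mem x -> nsq (r%:C *: x) = r ^+ 2 * nsq x.
Proof.
by move=> mx; rewrite (rh_Zl hX) ?rh_Zr //; [rewrite mulrA|exact: (rhZ hX)].
Qed.

Lemma rh_nsqC x y : mem x -> mem y -> nsq (x - y) = nsq (y - x).
Proof. by move=> mx my; rewrite !rh_nsqB // (rh_sym hX mx my); ring. Qed.

Lemma rh_nsqD_le x y : mem x -> mem y -> nsq (x + y) <= 2 * (nsq x + nsq y).
Proof.
move=> mx my; have := rh_ge0 hX (rhB mx my).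
rewrite rh_nsqB // rh_nsqD //; lra.
Qed.

(** The form is only semidefinite, so dividing by [nsq x] settles just one case; a null [x] has to
    be shown orthogonal to everything. *)
Lemma rh_CS x y : mem x -> mem y -> dot x y ^+ 2 <= nsq x * nsq y.
Proof.
move=> mx my; have nx := rh_ge0 hX mx; have ny := rh_ge0 hX my.
have key (s t : R) : 0 <= s ^+ 2 * nsq x + 2 * (s * t * dot x y) + t ^+ 2 * nsq y.
  have mz := rhD hX (rhZ hX s%:C mx) (rhZ hX t%:C my).
  have := rh_ge0 hX mz; rewrite rh_nsqD; [|exact: (rhZ hX)..].
  rewrite !rh_nsqZ // (rh_Zl hX) ?rh_Zr //; last exact: (rhZ hX).
  by rewrite -(mulrA s t).
have [nx0|nx0] := eqVneq (nsq x) 0; last first.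
  have nxp : 0 < nsq x by rewrite lt_def nx0.
  have := key (- dot x y) (nsq x).
  have -> : (- dot x y) ^+ 2 * nsq x + 2 * (- dot x y * nsq x * dot x y) +
     nsq x ^+ 2 * nsq y = nsq x * (nsq x * nsq y - dot x y ^+ 2) by ring.
  by rewrite pmulr_rge0 // subr_ge0.
rewrite nx0 mul0r.
have [d0|d0] := eqVneq (dot x y) 0; first by rewrite d0 expr0n.
(* With [nsq x = 0] the form is affine in [s], and this [s] gives it the value [- nsq y - 2]. *)
have := key (- (nsq y + 1) / dot x y) 1; rewrite nx0 mulr0 add0r mulr1 expr1n mul1r.
by rewrite mulfVK //; lra.
Qed.

Lemma rh_dot_le x y : mem x -> mem y -> `|dot x y| <= (nsq x + nsq y) / 2.
Proof.
move=> mx my; have := rh_ge0 hX (rhB mx my); have := rh_ge0 hX (rhD hX mx my).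
rewrite rh_nsqB // rh_nsqD // => h1 h2; rewrite ler_norml; apply/andP; split; lra.
Qed.

Lemma dot_lim (u : nat -> X) l z : (forall n, mem (u n)) -> mem l -> mem z ->
  (forall e : R, 0 < e -> exists N, forall n, (N <= n)%N -> nsq (u n - l) < e) ->
  forall e : R, 0 < e -> exists N, forall n, (N <= n)%N -> `|dot (u n) z - dot l z| < e.
Proof.
move=> mu ml mz ul e e0.
have nz := rh_ge0 hX mz.
have d0 : 0 < e ^+ 2 / (nsq z + 1) by rewrite divr_gt0 ?exprn_gt0 //; lra.
have [N hN] := ul _ d0; exists N => n /hN h.
rewrite -rh_Bl // -(@ltr_pXn2r _ 2) ?nnegrE // ?ltW // real_normK ?num_real //.
apply: le_lt_trans (rh_CS (rhB (mu n) ml) mz) _.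
have nb := rh_ge0 hX (rhB (mu n) ml).
apply: (@le_lt_trans _ _ (nsq (u n - l) * (nsq z + 1))); first by rewrite ler_wpM2l //; lra.
by rewrite -ltr_pdivlMr //; lra.
Qed.

Section Riesz.
(** A linear relation stands for a bounded functional, because its value is usually given through
    other data than the vector itself; [M_bound] makes it single-valued up to null vectors. The
    representing vector is found as a limit of first components. *)
Variable (M : set (X * R)) (K : R).
Hypothesis (M_mem : forall p, M p -> mem p.1).
Hypothesis (M0 : M (0, 0)).
Hypothesis (MD : forall p q, M p -> M q -> M (p.1 + q.1, p.2 + q.2)).
Hypothesis (MZ : forall (r : R) p, M p -> M (r%:C *: p.1, r * p.2)).
Hypothesis (M_bound : forall p, M p -> p.2 ^+ 2 <= K * nsq p.1).

(** If the value is [dot x u], this is [nsq (x - u) - nsq u], so that minimising it finds [u]. *)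
Let J (p : X * R) : R := nsq p.1 - 2 * p.2.

Let J_ge p : M p -> - (K ^+ 2 + 1) <= J p.
Proof.
move=> Mp; have := M_bound Mp; have := rh_ge0 hX (M_mem Mp); rewrite /J.
(* [K] may have either sign; [K ^+ 2 + 1] is positive and dominates it. *)
move: (nsq p.1) p.2 => q c q0 h; have h2 : c ^+ 2 <= (K^+2 + 1) * q.
  apply: le_trans h _; apply: ler_wpM2r => //.
  have := sqr_ge0 (K - 1/2); rewrite sqrrB; nra.
set k := K^+2 + 1 in h2 *; have k0 : 0 < k by rewrite /k; have := sqr_ge0 K; lra.
have : (2 * c) ^+ 2 <= (q + k) ^+ 2 by have := sqr_ge0 (q - k); nra.
move=> h3; rewrite lerBrDr leNgt; apply/negP => h4.
by move: h3; rewrite leNgt; case/negP; rewrite ltr_pXn2r // ?nnegrE; lra.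
Qed.

(* The minimising sequence of [nsq w - 2 c] over [M] is Cauchy by the           *)
(* parallelogram identity, and stationarity at its limit is the representation. *)
Lemma riesz_relation : exists u, [/\ mem u, forall p, M p -> p.2 = dot p.1 u &
  forall e : R, 0 < e -> exists2 p, M p & nsq (p.1 - u) < e].
Proof.
pose S := [set J p | p in M].
have hS : has_inf S.
  split; first by exists (J (0, 0)), (0, 0).
  by exists (- (K ^+ 2 + 1)) => _ [p Mp <-]; exact: J_ge.
set m := inf S; have mle p : M p -> m <= J p.
  by move=> Mp; apply: ge_inf; [exact: hS.2|exists p].
have /choice[p hp] : forall n, exists q, M q /\ J q < m + n.+1%:R^-1.
  move=> n; have n0 : 0 < n.+1%:R^-1 :> R by rewrite invr_gt0.
  have [_ [q Mq <-] h] := inf_adherent n0 hS.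
  by exists q.
have Mp n := (hp n).1; have mp n := M_mem (Mp n).
have par (a b : X * R) : M a -> M b ->
    nsq (a.1 - b.1) <= 2 * (J a - m) + 2 * (J b - m).
  move=> Ma Mb; have Mc := MZ (1/2) (MD Ma Mb); have := mle _ Mc.
  have ma := M_mem Ma; have mb := M_mem Mb.
  rewrite [X in _ -> X <= _](rh_nsqB ma mb) /J /= rh_nsqZ ?rh_nsqD //; last exact: (rhD hX).
  rewrite !expr2; lra.
have [u mu hu] : exists2 u, mem u &
    forall e : R, 0 < e -> exists N, forall n, (N <= n)%N -> nsq ((p n).1 - u) < e.
  apply: (rh_complete hX) => // e e0.
  have e40 : 0 < e / 4 by lra.
  have [N hN] : exists N, forall n, (N <= n)%N -> (n.+1%:R^-1 : R) < e / 4.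
    have [N _ hN] := near_infty_natSinv_lt (PosNum e40); exists N => n Nn.
    exact: hN.
  exists N => a b /hN ha /hN hb; apply: le_lt_trans (par _ _ (Mp a) (Mp b)) _.
  have := (hp a).2; have := (hp b).2.
  move: (a.+1%:R^-1) (b.+1%:R^-1) ha hb => *; lra.
exists u; split => //; last first.
  by move=> e /hu [N hN]; exists (p N); [|exact: hN].
move=> z Mz; have mz := M_mem Mz.
have stat (s : R) : 0 <= 2 * s * (dot u z.1 - z.2) + s ^+ 2 * nsq z.1.
  rewrite leNgt; apply/negP; set V := (_ + _) => V0.
  have nd : 0 < - V / 4 by lra.
  have [N1 h1] : exists N, forall n, (N <= n)%N -> (n.+1%:R^-1 : R) < - V / 4.
    by have [N _ hN] := near_infty_natSinv_lt (PosNum nd); exists N => n Nn; exact: hN.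
  have ss : 0 < (- V / 4) / (`|s| + 1) by rewrite divr_gt0 //; have := normr_ge0 s; lra.
  have [N2 h2] := dot_lim mp mu mz hu ss.
  pose n := maxn N1 N2; have := h1 n (leq_maxl _ _); have := h2 n (leq_maxr _ _).
  rewrite ltr_pdivlMr; last by have := normr_ge0 s; lra.
  move=> h3 h4; have := mle _ (MD (Mp n) (MZ s Mz)); have := (hp n).2.
  rewrite /J /= rh_nsqD ?rh_nsqZ ?rh_Zr //; last exact: (rhZ hX).
  have : s * (dot (p n).1 z.1 - dot u z.1) <= - V / 4.
    apply: le_trans (ler_norm _) _; rewrite normrM mulrC; apply: ltW.
    apply: le_lt_trans h3; rewrite ler_wpM2l //; lra.
  move=> h5 h6 h7;
  have h9 : nsq (p n).1 - 2 * (p n).2 < m + - V / 4.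
    by apply: lt_trans h6 _; rewrite ltrD2l.
  clear -h5 h7 h9 V0; subst V; move: (nsq (p n).1) (p n).2 (dot (p n).1 _) (dot u _) (nsq _) h5 h7 h9 V0 => x1 x2 x3 x4 x5.
  move=> *; lra.
rewrite (rh_sym hX) //; apply/eqP; rewrite eq_sym -subr_eq0; apply/eqP.
set d := _ - _; have nz := rh_ge0 hX mz.
have k0 : 0 < nsq z.1 + 1 by lra.
(* At this [s] the quadratic is [- d ^+ 2 * (nsq z.1 + 2) / (nsq z.1 + 1) ^+ 2]; the added 1 avoids
   dividing by the norm of a null vector. *)
have := stat (- d / (nsq z.1 + 1)); rewrite -/d => h.
have : 0 <= - d ^+ 2 * (nsq z.1 + 2).
  have := mulr_ge0 h (ltW (exprn_gt0 2 k0)); congr (0 <= _); field; lra.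
rewrite mulNr oppr_ge0 pmulr_lle0; last lra.
by move=> h2; apply/eqP; rewrite -sqrf_eq0 eq_le h2 sqr_ge0.
Qed.

End Riesz.

(** The vector representing [w |-> dot w f] on [M] is the projection [u] of [f] on the closure of
    [M], and [z = f - u]. It is not null, since [M] comes arbitrarily close to [u] but stays away
    from [f]. *)
Lemma orthogonal_of_not_dense (M : set X) (f : X) (e : R) : mem f -> 0 < e ->
  (forall w, M w -> mem w) -> M 0 -> (forall x y, M x -> M y -> M (x + y)) ->
  (forall (r : R) x, M x -> M (r%:C *: x)) ->
  (forall w, M w -> e <= nsq (f - w)) ->
  exists z, [/\ mem z, 0 < nsq z & forall w, M w -> dot w z = 0].
Proof.
move=> mf e0 Mmem M0 MD MZ hf.
have [|||||u [mu hu hc]] := @riesz_relation [set p | M p.1 /\ p.2 = dot p.1 f] (nsq f).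
- by move=> p [/Mmem].
- by split => //=; have := rh_Zl hX 0 (rh0 hX) mf; rewrite scale0r mul0r.
- move=> p q [Mp ->] [Mq ->]; split => /=; first exact: MD.
  by rewrite (rh_Dl hX) //; exact: Mmem.
- move=> r p [Mp ->]; split => /=; first exact: MZ.
  by rewrite (rh_Zl hX) //; exact: Mmem.
- by move=> p [/Mmem mp ->]; rewrite mulrC; exact: rh_CS.
exists (f - u); split; first exact: rhB.
- rewrite ltNge; apply/negP => le0.
  have [p [Mp _] hp] := hc (e / 4) ltac:(lra).
  have mp := Mmem _ Mp; have := hf _ Mp.
  have -> : f - p.1 = (f - u) - (p.1 - u) by rewrite opprB addrA subrK.
  have mB1 := rhB mf mu; have mB2 := rhB mp mu.
  have := rh_nsqD_le mB1 (rhN mB2); rewrite rh_Nl ?rh_Nr // ?opprK; last exact: rhN.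
  lra.
- by move=> w Mw; rewrite rh_Br //; [rewrite -(hu (w, dot w f)) ?subrr|exact: Mmem].
Qed.

End RealPreHilbert.

(** * Norms, real inner products and skew-adjoint operators *)

Section ComplexNorm.
Context (R : realType).

Lemma gt0_realc (e : R[i]) : 0 < e -> exists2 r : R, 0 < r & e = r%:C.
Proof. by case: e => a b; rewrite ltcE /= => /andP[/eqP -> a0]; exists a. Qed.

Section Norm.
Context (V : normedModType R[i]).
Implicit Types x y : V.

Lemma normE x : `|x| = (rnorm x)%:C.
Proof. by rewrite /rnorm RRe_real // normr_real. Qed.

Lemma rnorm_ge0 x : 0 <= rnorm x.
Proof. by have := normr_ge0 x; rewrite normE lecR. Qed.

Lemma rnormN x : rnorm (- x) = rnorm x.
Proof. by rewrite /rnorm normrN. Qed.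

Lemma rnorm0 : rnorm (0 : V) = 0.
Proof. by rewrite /rnorm normr0. Qed.

Lemma rnormD x y : rnorm (x + y) <= rnorm x + rnorm y.
Proof. by rewrite -lecR rmorphD /= -!normE ler_normD. Qed.

Lemma rnormB x y : rnorm (x - y) <= rnorm x + rnorm y.
Proof. by rewrite -(rnormN y) rnormD. Qed.

Lemma rnormC x y : rnorm (x - y) = rnorm (y - x).
Proof. by rewrite -rnormN opprB. Qed.

Lemma rnormZ (r : R) x : rnorm (r%:C *: x) = `|r| * rnorm x.
Proof.
apply: complexI; rewrite -normE normrZ (normE x) rmorphM /=; congr (_ * _).
by rewrite normc_def /= expr0n addr0 sqrtr_sqr.
Qed.

Lemma rnorm_eq0 x : rnorm x = 0 -> x = 0.
Proof. by move=> h; apply/eqP; rewrite -normr_eq0 normE h. Qed.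

Lemma rnorm_distD x y z : rnorm (x - z) <= rnorm (x - y) + rnorm (y - z).
Proof. by have := rnormD (x - y) (y - z); rewrite addrA subrK. Qed.

Lemma rnorm_dist x y : `|rnorm x - rnorm y| <= rnorm (x - y).
Proof.
have := rnormD (x - y) y; have := rnormD (y - x) x.
rewrite !subrK (rnormC y x) => h1 h2; rewrite ler_norml; apply/andP; split; lra.
Qed.

Lemma cvg_rnormP (u : nat -> V) (l : V) : (u n @[n --> \oo] --> l) <->
  (forall e : R, 0 < e -> exists N, forall n, (N <= n)%N -> rnorm (u n - l) < e).
Proof.
split => [/cvgrPdist_lt h e e0|h].
  have e0' : 0 < e%:C by rewrite ltcR.
  have [N _ hN] := h _ e0'; exists N => n /hN /=.
  by rewrite normE ltcR rnormC.
apply/cvgrPdist_lt => e /gt0_realc[r r0 ->].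
have [N hN] := h _ r0; exists N => //= n /hN.
by rewrite normE ltcR rnormC.
Qed.

Lemma near_rnormP (a : V) (P : V -> Prop) : (\forall b \near a, P b) <->
  exists2 e : R, 0 < e & forall b, rnorm (a - b) < e -> P b.
Proof.
split => [/nbhs_ballP[e /= /gt0_realc[r r0 ->] h]|[r r0 h]].
  exists r => // b hb; apply: h; rewrite -ball_normE /= normE ltcR //.
apply/nbhs_ballP; exists r%:C; first by rewrite /= ltcR.
by move=> b; rewrite -ball_normE /= normE ltcR; exact: h.
Qed.

End Norm.

Lemma rnorm_complete (V : completeNormedModType R[i]) (u : nat -> V) :
  (forall e : R, 0 < e -> exists N, forall m n, (N <= m)%N -> (N <= n)%N ->
    rnorm (u m - u n) < e) ->
  exists l, forall e : R, 0 < e -> exists N, forall n, (N <= n)%N -> rnorm (u n - l) < e.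
Proof.
move=> h; suff /cvg_ex[l /cvg_rnormP hl] : cvg (u n @[n --> \oo]) by exists l.
apply/cauchy_cvgP/cauchy_ballP => e /gt0_realc[r r0 ->].
have [N hN] := h _ r0; near_simpl.
exists ([set n | (N <= n)%N], [set n | (N <= n)%N]).
  by split; exists N.
by move=> [m n] /= [Nm Nn]; rewrite -ball_normE /= normE ltcR; exact: hN.
Qed.

Lemma dense_rnormP (V : normedModType R[i]) (S : set V) : dense S <->
  forall x (e : R), 0 < e -> exists2 y, S y & rnorm (x - y) < e.
Proof.
split => [dS x e e0|h O [x Ox] oO].
  have e0' : 0 < e%:C by rewrite ltcR.
  have [||y [/interior_subset hb Sy]] := dS (ball x e%:C)^°.
  - by exists x; exact: nbhsx_ballx.
  - exact: open_interior.
  by exists y => //; move: hb; rewrite -ball_normE /= normE ltcR.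
have /near_rnormP[e e0 he] : nbhs x O by apply: open_nbhs_nbhs; split.
by have [y Sy hy] := h x e e0; exists y; split => //; exact: he.
Qed.

End ComplexNorm.

Lemma subACA (V : zmodType) (a b c d : V) : a - b - (c - d) = a - c - (b - d).
Proof. by rewrite !opprB (addrC d) addrACA (addrC d). Qed.

Section RealInner.
Context (R : realType) (H : completeNormedModType R[i])
  (ip : {dot H for @Num.conj R[i]}).
Hypothesis H_norm : forall x : H, `|x| ^+ 2 = ip x x.

Definition rip (x y : H) : R := complex.Re (ip x y).

Lemma ipC x y : ip x y = (ip y x)^*%C.
Proof. by rewrite (hermC ip) expr0 mul1r. Qed.

Lemma ipZr (z : R[i]) x y : ip x (z *: y) = (z^*%C) * ip x y.
Proof. by rewrite linearZr_LR. Qed.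

Lemma ipZl (z : R[i]) x y : ip (z *: x) y = z * ip x y.
Proof. by rewrite linearZl_LR. Qed.

Lemma ripC x y : rip x y = rip y x.
Proof. by rewrite /rip ipC; case: (ip y x). Qed.

Lemma ripDl x y z : rip (x + y) z = rip x z + rip y z.
Proof. by rewrite /rip linearDl raddfD. Qed.

Lemma ripDr x y z : rip x (y + z) = rip x y + rip x z.
Proof. by rewrite ripC ripDl !(ripC x). Qed.

Lemma ripZl (r : R) x y : rip (r%:C *: x) y = r * rip x y.
Proof. by rewrite /rip ipZl; case: (ip x y) => a b /=; rewrite mul0r subr0. Qed.

Lemma ripZr (r : R) x y : rip x (r%:C *: y) = r * rip x y.
Proof. by rewrite ripC ripZl ripC. Qed.

Lemma ripNl x y : rip (- x) y = - rip x y.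
Proof. by rewrite /rip linearNl raddfN. Qed.

Lemma ripNr x y : rip x (- y) = - rip x y.
Proof. by rewrite ripC ripNl ripC. Qed.

Lemma ripBl x y z : rip (x - y) z = rip x z - rip y z.
Proof. by rewrite ripDl ripNl. Qed.

Lemma ripBr x y z : rip x (y - z) = rip x y - rip x z.
Proof. by rewrite ripDr ripNr. Qed.

Lemma rip0l x : rip 0 x = 0.
Proof. by rewrite /rip linear0l. Qed.

Lemma rip0r x : rip x 0 = 0.
Proof. by rewrite ripC rip0l. Qed.

Lemma ripi_l x y : rip ('i%C *: x) y = - complex.Im (ip x y).
Proof. by rewrite /rip ipZl mulrC ReiNIm. Qed.

Lemma Im_ipE x y : complex.Im (ip x y) = rip x ('i%C *: y).
Proof. by rewrite ripC ripi_l ipC; case: (ip y x). Qed.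

Lemma ripi_skew x y : rip ('i%C *: x) y = - rip x ('i%C *: y).
Proof. by rewrite ripi_l Im_ipE. Qed.

Lemma ripii x y : rip ('i%C *: x) ('i%C *: y) = rip x y.
Proof. by rewrite ripi_skew scalerA -expr2 sqr_i scaleN1r ripNr opprK. Qed.

Lemma ripZ_skew (r : R) x : rip ((r%:C * 'i%C) *: x) x = 0.
Proof.
rewrite -scalerA ripZl; have := ripi_skew x x; rewrite (ripC x) => h.
by rewrite (_ : rip _ x = 0) ?mulr0 //; lra.
Qed.

Lemma ip_rip x y : ip x y = rip x y +i* rip x ('i%C *: y).
Proof. by rewrite -Im_ipE /rip; case: (ip x y). Qed.

Lemma rnorm_sqr x : rnorm x ^+ 2 = rip x x.
Proof.
apply: complexI; rewrite rmorphXn /= -normE H_norm /rip.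
by rewrite RRe_real // -H_norm realX // normr_real.
Qed.

Lemma nsq_ge0 x : 0 <= rip x x.
Proof. by rewrite -rnorm_sqr sqr_ge0. Qed.

Lemma nsq_eq0 x : rip x x = 0 -> x = 0.
Proof. by rewrite -rnorm_sqr => /eqP; rewrite sqrf_eq0 => /eqP/rnorm_eq0. Qed.

Lemma nsq_lt_rnorm x (e : R) : 0 < e -> (rip x x < e ^+ 2) = (rnorm x < e).
Proof. by move=> e0; rewrite -rnorm_sqr ltr_pXn2r ?nnegrE ?rnorm_ge0 // ltW. Qed.

Lemma real_hilbert_H : real_hilbert [set: H] rip.
Proof.
split => //.
- by move=> *; exact: ripC.
- by move=> *; exact: ripDl.
- by move=> *; exact: ripZl.
- by move=> *; exact: nsq_ge0.
- move=> u _ hu; have [e e0|l hl] := @rnorm_complete _ _ u.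
    have [N hN] := hu _ (exprn_gt0 2 e0); exists N => m n Nm Nn.
    by rewrite -nsq_lt_rnorm // hN.
  exists l => // e e0.
  have s0 : 0 < Num.sqrt e by rewrite sqrtr_gt0.
  have [N hN] := hl _ s0; exists N => n /hN.
  by rewrite -nsq_lt_rnorm // sqr_sqrtr // ltW.
Qed.

Lemma ripD_nsq x y : rip (x + y) (x + y) = rip x x + 2 * rip x y + rip y y.
Proof. exact: (rh_nsqD real_hilbert_H). Qed.

Lemma ripB_nsq x y : rip (x - y) (x - y) = rip x x - 2 * rip x y + rip y y.
Proof. exact: (rh_nsqB real_hilbert_H). Qed.

Lemma ripZ_nsq (r : R) x : rip (r%:C *: x) (r%:C *: x) = r ^+ 2 * rip x x.
Proof. exact: (rh_nsqZ real_hilbert_H). Qed.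

Lemma nsqD_le x y : rip (x + y) (x + y) <= 2 * (rip x x + rip y y).
Proof. exact: (rh_nsqD_le real_hilbert_H). Qed.

Lemma nsqB_le x y : rip (x - y) (x - y) <= 2 * (rip x x + rip y y).
Proof. by have := nsqD_le x (- y); rewrite !ripNr !ripNl opprK. Qed.

Lemma rip_CS x y : rip x y ^+ 2 <= rip x x * rip y y.
Proof. exact: (rh_CS real_hilbert_H). Qed.

Lemma rip_le x y : `|rip x y| <= (rip x x + rip y y) / 2.
Proof. exact: (rh_dot_le real_hilbert_H). Qed.

Lemma rip_rnorm x y : `|rip x y| <= rnorm x * rnorm y.
Proof.
rewrite -(@ler_pXn2r _ 2) ?nnegrE ?mulr_ge0 ?rnorm_ge0 //.
by rewrite real_normK ?num_real // exprMn !rnorm_sqr rip_CS.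
Qed.

Lemma nsqC x y : rip (x - y) (x - y) = rip (y - x) (y - x).
Proof. exact: (rh_nsqC real_hilbert_H). Qed.

(** * Skew-adjoint operators and their resolvents *)

Section SkewAdjoint.
Variables (D : set H) (B : H -> H).

(** [sa_max] says that the graph contains its negative adjoint, from which real linearity and
    closedness follow. Compatibility with ['i] does not follow from real scalar products and is a
    separate field. *)
Record skew_adjoint : Prop := SkewAdjoint {
  sa_dense : forall f (e : R), 0 < e -> exists2 g, D g & rip (f - g) (f - g) < e;
  sa_i : forall g, D g -> D ('i%C *: g) /\ B ('i%C *: g) = 'i%C *: B g;
  sa_skew : forall f g, D f -> D g -> rip (B f) g = - rip f (B g);
  sa_max : forall f f', (forall g, D g -> rip (B g) f = - rip g f') ->
    D f /\ B f = f' }.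

Hypothesis sB : skew_adjoint.

Lemma sa_D f g : D f -> D g -> D (f + g) /\ B (f + g) = B f + B g.
Proof.
move=> Df Dg; apply: (sa_max sB) => k Dk.
by rewrite !ripDr !(sa_skew sB) // opprD.
Qed.

Lemma sa_Z (r : R) f : D f -> D (r%:C *: f) /\ B (r%:C *: f) = r%:C *: B f.
Proof.
by move=> Df; apply: (sa_max sB) => k Dk; rewrite !ripZr (sa_skew sB) // mulrN.
Qed.

Lemma sa_N f : D f -> D (- f) /\ B (- f) = - B f.
Proof.
by move=> Df; apply: (sa_max sB) => k Dk; rewrite !ripNr (sa_skew sB) // mulrN.
Qed.

Lemma sa_B f g : D f -> D g -> D (f - g) /\ B (f - g) = B f - B g.
Proof.
move=> Df Dg; have [DN EN] := sa_N Dg; have [DB EB] := sa_D Df DN.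
by rewrite EB EN.
Qed.

Lemma sa_0 : D 0 /\ B 0 = 0.
Proof. by apply: (sa_max sB) => k Dk; rewrite !rip0r oppr0. Qed.

Lemma sa_self g : D g -> rip (B g) g = 0.
Proof. by move=> Dg; have := sa_skew sB Dg Dg; rewrite (ripC g); lra. Qed.

Lemma sa_orth0 x : (forall g, D g -> rip g x = 0) -> x = 0.
Proof.
move=> h; apply: nsq_eq0; apply/eqP; rewrite eq_le nsq_ge0 andbT leNgt; apply/negP => x0.
have [g Dg hg] := sa_dense sB x x0.
have := nsq_ge0 g; have := h _ Dg; move: hg; rewrite ripB_nsq (ripC g) => *; lra.
Qed.

(** The cross term vanishes by skewness. Injectivity of [1 - e B], contractivity of its inverse and
    the isometry with the graph norm at [e = 1] all come from this identity. *)
Lemma resolvent_nsq (e : R) x : D x ->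
  rip (x - e%:C *: B x) (x - e%:C *: B x) = rip x x + e ^+ 2 * rip (B x) (B x).
Proof.
by move=> Dx; rewrite ripB_nsq ripZr ripZ_nsq ripC sa_self // !mulr0 subr0.
Qed.

(** Riesz represents [g + e B g |-> rip g y], which is bounded because [g + e B g] is at least as
    long as [g]. The resulting identity puts the representing [u] in the domain of the adjoint, and
    [sa_max] reads off [B u]. *)
Lemma resolvent_exists (e : R) y : e != 0 -> exists x, D x /\ x - e%:C *: B x = y.
Proof.
move=> e0; pose M := [set p : H * R | exists2 g, D g & p = (g + e%:C *: B g, rip g y)].
have [|||||u [_ hu _]] := @riesz_relation _ _ _ _ real_hilbert_H M (rip y y).
- by [].
- by have [D0 B0] := sa_0; exists 0; rewrite // B0 scaler0 addr0 rip0l.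
- move=> _ _ [f Df ->] [g Dg ->] /=; have [DD EE] := sa_D Df Dg.
  by exists (f + g); rewrite // EE scalerDr addrACA ripDl.
- move=> r _ [f Df ->] /=; have [DD EE] := sa_Z r Df.
  by exists (r%:C *: f); rewrite // EE scalerDr ripZl !scalerA mulrC.
- move=> _ [g Dg ->] /=; apply: le_trans (rip_CS _ _) _; rewrite mulrC.
  rewrite ler_wpM2l ?nsq_ge0 //.
  have := @resolvent_nsq (- e) g Dg; rewrite rmorphN scaleNr opprK => ->.
  by rewrite lerDl mulr_ge0 ?nsq_ge0 ?sqr_ge0.
have [Du Eu] : D u /\ B u = e^-1%:C *: (u - y).
  apply: (sa_max sB) => g Dg; have := hu (g + e%:C *: B g, rip g y).
  move=> /(_ (ex_intro2 _ _ g Dg erefl)) /=.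
  rewrite ripDl ripZl ripZr ripBr => h.
  by apply: (mulfI e0); rewrite mulrN mulrA divff // mul1r; lra.
exists u; split => //; rewrite Eu scalerA -rmorphM /= divff // scale1r.
by rewrite opprB addrC subrK.
Qed.

Definition res (e : R) (y : H) : H := xget 0 [set x | D x /\ x - e%:C *: B x = y].

Lemma resP (e : R) y : e != 0 -> D (res e y) /\ res e y - e%:C *: B (res e y) = y.
Proof. by move=> e0; have [x hx] := resolvent_exists y e0; exact: (@xgetPex _ 0 [set x | D x /\ x - e%:C *: B x = y] (ex_intro _ x hx)). Qed.

Lemma res_uniq (e : R) x y : e != 0 -> D x -> x - e%:C *: B x = y -> x = res e y.
Proof.
move=> e0 Dx hx; have [Dr hr] := resP y e0; apply/eqP; rewrite -subr_eq0; apply/eqP.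
have [Dd Ed] := sa_B Dx Dr; apply: nsq_eq0.
have := resolvent_nsq e Dd; rewrite Ed.
have -> : x - res e y - e%:C *: (B x - B (res e y)) =
    (x - e%:C *: B x) - (res e y - e%:C *: B (res e y)).
  by rewrite scalerBr subACA.
rewrite hx hr subrr rip0l => h; have := nsq_ge0 (x - res e y).
have := mulr_ge0 (sqr_ge0 e) (nsq_ge0 (B x - B (res e y))); lra.
Qed.

Lemma resB (e : R) x y : e != 0 -> res e (x - y) = res e x - res e y.
Proof.
move=> e0; have [Dx hx] := resP x e0; have [Dy hy] := resP y e0; have [Dd Ed] := sa_B Dx Dy.
apply/esym/res_uniq => //; rewrite Ed scalerBr subACA.
by rewrite hx hy.
Qed.

Lemma res_nsq (e : R) y : e != 0 -> rip (res e y) (res e y) <= rip y y.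
Proof.
move=> e0; have [Dx hx] := resP y e0; rewrite -[in X in _ <= X]hx resolvent_nsq // lerDl.
by rewrite mulr_ge0 ?nsq_ge0 ?sqr_ge0.
Qed.

Lemma res_adj (e : R) x y : e != 0 -> rip (res e x) y = rip x (res (- e) y).
Proof.
move=> e0; have e0' : - e != 0 by rewrite oppr_eq0.
have [Dx hx] := resP x e0; have [Dy hy] := resP y e0'.
rewrite -[in LHS]hy -{2}hx rmorphN scaleNr opprK ripDr ripBl ripZr ripZl.
by rewrite (sa_skew sB) // mulrN opprK.
Qed.

Lemma res_comm (e : R) g : e != 0 -> D g -> B (res e g) = res e (B g).
Proof.
move=> e0 Dg; have [Dx hx] := resP g e0.
have E0 : B (res e g) = e^-1%:C *: (res e g - g).
  by rewrite -[X in _ - X]hx opprB addrC subrK scalerA -rmorphM mulVf // scale1r.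
have [D1 E1] := sa_B Dx Dg; have [D2 E2] := sa_Z e^-1 D1.
rewrite E1 -E0 in E2; rewrite -E0 in D2; apply: res_uniq => //.
by rewrite E2 scalerA -rmorphM mulfV // scale1r opprB addrC subrK.
Qed.

Lemma res_gen (e : R) y : e != 0 -> e%:C *: B (res e y) = res e y - y.
Proof. by move=> /(resP y)[_ h]; rewrite -[X in _ - X]h opprB addrC subrK. Qed.

(** On [g] in the domain, [res e g - g = e res e (B g)] is of order [e]; density and contractivity
    carry this to every [y]. *)
Lemma res_lim y (d : R) : 0 < d -> exists N, forall n, (N <= n)%N ->
  rip (res n.+1%:R^-1 y - y) (res n.+1%:R^-1 y - y) < d.
Proof.
move=> d0; have [|g Dg hg] := sa_dense sB y (_ : 0 < d / 16); first lra.
have nb := nsq_ge0 (B g); have k0 : 0 < d / (4 * (rip (B g) (B g) + 1)).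
  by rewrite divr_gt0 //; lra.
have [N _ hN] := near_infty_natSinv_lt (PosNum k0); exists N => n /hN /= {}hN.
set e : R := n.+1%:R^-1 in hN *.
have ep : 0 < e by rewrite invr_gt0.
have e0 : e != 0 by rewrite gt_eqF.
have e1 : e <= 1 by rewrite invf_le1 // ler1n.
have -> : res e y - y = (res e (y - g) - (y - g)) + (res e g - g).
  by rewrite resB // subACA subrK.
apply: le_lt_trans (nsqD_le _ _) _.
have := nsqB_le (res e (y - g)) (y - g); have := res_nsq (y - g) e0.
rewrite -(res_gen g e0) // res_comm // ripZ_nsq; have := res_nsq (B g) e0.
move: hN; rewrite ltr_pdivlMr; last lra.
have : e ^+ 2 <= e by rewrite expr2 ler_piMl // ltW.
move: (rip (res e (B g)) _) (nsq_ge0 (res e (B g))) => z z0.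
move: (rip (B g) (B g)) nb => w w0 h1 h2 h3.
have : e ^+ 2 * z <= e * w by apply: ler_pM => //; exact: sqr_ge0.
move: (rip (res e (y-g)) (res e (y-g))) => *; lra.
Qed.

(** [x |-> x - B x] is an isometry from the graph norm to [H], so the preimages of a dense sequence
    are dense in the domain for the graph norm. This is the countable family of test vectors. *)
Lemma sa_graph_dense (g : nat -> H) (S : dense (range g)) x (e : R) : D x -> 0 < e ->
  exists n, let y := res 1 (g n) in
    rip (x - y) (x - y) < e /\ rip (B x - B y) (B x - B y) < e.
Proof.
move=> Dx e0; have s0 : 0 < Num.sqrt e by rewrite sqrtr_gt0.
have [_ [n _ <-]] := (dense_rnormP (range g)).1 S (x - B x) _ s0.
rewrite -nsq_lt_rnorm // sqr_sqrtr ?ltW // => hn; exists n => /=.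
have [Dy hy] := resP (g n) (oner_neq0 R); have [Dd Ed] := sa_B Dx Dy.
have := resolvent_nsq 1 Dd; rewrite Ed expr1n mul1r scale1r.
have -> : x - res 1 (g n) - (B x - B (res 1 (g n))) = x - B x - g n.
  by rewrite -[in RHS]hy scale1r subACA.
move=> E; rewrite E in hn; have := nsq_ge0 (x - res 1 (g n)).
by have := nsq_ge0 (B x - B (res 1 (g n))); split; lra.
Qed.

End SkewAdjoint.

(** Selfadjointness describes the graph of [A] by a complex identity against all of [D]; since [D]
    is stable under ['i], the real identity against [D] carries the same information. *)
Lemma skew_adjoint_of_selfadjoint (D : set H) (A : H -> H) :
  selfadjoint (graph_of ip D A) -> skew_adjoint D (fun g => 'i%C *: A g).
Proof.
move=> [dD sA].
have adjP f f' : (D f /\ f' = A f) <-> forall g, D g -> ip (A g) f = ip g f'.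
  have -> : (D f /\ f' = A f) = graph_of ip D A (f, f') by [].
  rewrite {1}sA; split => [[_ _ h] g Dg|h]; first exact: (h (g, A g)).
  by split => // q [Dq ->]; exact: h.
have Di g : D g -> D ('i%C *: g) /\ A ('i%C *: g) = 'i%C *: A g.
  move=> Dg; suff /adjP[? ->] : forall k, D k -> ip (A k) ('i%C *: g) = ip k ('i%C *: A g) by [].
  by move=> k Dk; rewrite !ipZr; congr (_ * _); apply: ((adjP g (A g)).1 (conj Dg erefl)).
split.
- move=> f e e0; have s0 : 0 < Num.sqrt e by rewrite sqrtr_gt0.
  have [g [_ [h [Dg _]] hg]] := dD f I _ s0; exists g => //.
  have := hg; rewrite /hnorm /= -/(rip (f - g) (f - g)) ltr_sqrt //.
- by move=> g /Di[Dg ->]; rewrite !scalerA.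
- move=> f g Df Dg; rewrite ripi_skew /rip !ipZr.
  by rewrite ((adjP g (A g)).1 (conj Dg erefl)).
(* [A f] must be [- 'i *: f']. The real and imaginary parts of the complex identity at [g] are the
   real one tested with ['i *: g] and with [g]. *)
- move=> f f' h; suff [Df E] : D f /\ (- 'i%C) *: f' = A f.
    by split => //; rewrite -E scalerA mulrN -expr2 sqr_i opprK scale1r.
  apply/adjP => g Dg; rewrite !ip_rip.
  have h1 := h _ Dg; have [Dig Eig] := Di _ Dg; have := h _ Dig; rewrite Eig.
  rewrite ripi_skew in h1; move=> h2.
  congr (_ +i* _).
    by rewrite scaleNr ripNr -ripi_skew; rewrite scalerA -expr2 sqr_i scaleN1r ripNl in h2; lra.
  by rewrite scalerA mulrN -expr2 sqr_i opprK scale1r; lra.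
Qed.

End RealInner.

(** * Strong measurability *)

Section AlmostEverywhere.
Context d (T : measurableType d) (R : realType) (mu : {measure set T -> \bar R}).
Implicit Types (D : set T) (f g : T -> \bar R).

Import HBNNSimple.

Let nnint f := ereal_sup [set sintegral mu h |
  h in [set h : {nnsfun T >-> R} | forall x, ((h x)%:E <= f x)%E]].

(** Cutting a simple function off on the null set leaves its integral unchanged and puts it below
    [g] at every point. *)
Let nnint_le f g : {ae mu, forall x, (f x <= g x)%E} -> (forall x, (0 <= g x)%E) ->
  (nnint f <= nnint g)%E.
Proof.
move=> [N [mN N0 sN]] g0; apply: ge_ereal_sup => _ [h hf <-].
apply: ereal_sup_ubound; exists (proj_nnsfun h (measurableC mN)) => [x|] /=.
  rewrite mindicE; case: (boolP (x \in _)) => [xN|_]; last by rewrite mulr0.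
  rewrite mulr1; apply: le_trans (hf x) _; apply: contrapT => hx.
  by move: xN; rewrite inE; apply; exact: sN.
rewrite -!integralT_nnsfun; apply: ae_eq_integral => //.
- exact/measurable_EFinP.
- exact/measurable_EFinP.
- exists N; split => // x /= /not_implyP[_ hx]; apply: contrapT => Nx; apply: hx.
  by rewrite mindicE mem_set // mulr1.
Qed.

(* Integrals are lower integrals, so no measurability is needed. *)
Lemma ae_integral_eq D f g : {ae mu, forall x, D x -> f x = g x} ->
  (\int[mu]_(x in D) f x = \int[mu]_(x in D) g x)%E.
Proof.
move=> fg.
have E : {ae mu, forall x, (f \_ D) x = (g \_ D) x}.
  apply: filterS fg => x h; rewrite !patchE; case: ifPn => // /set_mem; exact: h.
suff h (f' g' : T -> \bar R) : {ae mu, forall x, f' x = g' x} ->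
    (forall x, 0 <= f' x)%E -> (forall x, 0 <= g' x)%E -> nnint f' = nnint g'.
  rewrite /integral; congr (_ - _)%E; apply: h => //; apply: filterS E => x Ex.
    by rewrite !funeposE Ex.
  by rewrite !funenegE Ex.
move=> h f0 g0; apply/eqP; rewrite eq_le; apply/andP; split; apply: nnint_le => //;
  by apply: filterS h => x ->.
Qed.

Lemma ae_mono2 (P Q S : T -> Prop) : {ae mu, forall x, P x} -> {ae mu, forall x, Q x} ->
  (forall x, P x -> Q x -> S x) -> {ae mu, forall x, S x}.
Proof.
move=> hP hQ h; have : {ae mu, forall x, P x /\ Q x} by exact: filterI.
by apply: filterS => x []; exact: h.
Qed.

Lemma ae_mono (P Q : T -> Prop) : {ae mu, forall x, P x} ->
  (forall x, P x -> Q x) -> {ae mu, forall x, Q x}.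
Proof. by move=> hP h; apply: filterS hP. Qed.

Lemma ae_Rintegral_eq D (f g : T -> R) : {ae mu, forall x, D x -> f x = g x} ->
  Rintegral mu D f = Rintegral mu D g.
Proof.
move=> fg; congr fine; apply: ae_integral_eq.
by apply: filterS fg => x h Dx; rewrite h.
Qed.

End AlmostEverywhere.

(** * Everywhere limits of simple functions *)

Section SimpleLimits.
Context (R : realType).
Notation mu := (@lebesgue_measure R).

Section Two.
Context (V V' : normedModType R[i]).

Lemma simple_preimage2 (s : R -> V) (s' : R -> V') (P : V -> V' -> Prop) : simple_fun s -> simple_fun s' ->
  measurable [set t | P (s t) (s' t)].
Proof.
move=> [fs ms] [fs' ms'].
rewrite (_ : [set t | _] = \bigcup_(p in [set p | (range s `*` range s') p /\ P p.1 p.2])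
    (s @^-1` [set p.1] `&` s' @^-1` [set p.2])).
  apply: fin_bigcup_measurable => [|p _]; last exact: measurableI.
  by apply: sub_finite_set (finite_setX fs fs') => p [].
apply/seteqP; split => [t Pt|t [[v v'] [_ /= Pv] [/= -> ->]] //].
by exists (s t, s' t) => //; split => //; split => /=; exists t.
Qed.

Lemma simple_real2 (s : R -> V) (s' : R -> V') (c : V -> V' -> R) : simple_fun s -> simple_fun s' ->
  measurable_fun setT (fun t => c (s t) (s' t)).
Proof.
move=> hs hs' _ Y mY; rewrite setTI.
exact: (simple_preimage2 (fun v v' => Y (c v v'))).
Qed.

End Two.

Lemma simple_map2 (V V' V'' : normedModType R[i]) (s : R -> V) (s' : R -> V')
    (c : V -> V' -> V'') : simple_fun s -> simple_fun s' ->
  simple_fun (fun t => c (s t) (s' t)).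
Proof.
move=> hs hs'; split=> [|v].
  have := finite_image (fun p => c p.1 p.2) (finite_setX hs.1 hs'.1).
  apply: sub_finite_set => _ [t _ <-]; exists (s t, s' t) => //=.
  by split; [exists t|exists t].
exact: (simple_preimage2 (fun x y => c x y = v) hs hs').
Qed.

Lemma simple_cst (V : normedModType R[i]) (v : V) : simple_fun (fun=> v : V).
Proof.
split; first by apply: sub_finite_set (finite_set1 v) => _ [t _ <-].
by move=> w; rewrite preimage_cst; case: ifP.
Qed.

Lemma simple_if (V : normedModType R[i]) (A : set R) (s s' : R -> V) :
  measurable A -> simple_fun s -> simple_fun s' ->
  simple_fun (fun t => if t \in A then s t else s' t).
Proof.
move=> mA [fs ms] [fs' ms']; split=> [|v].
  have : finite_set (range s `|` range s') by rewrite finite_setU.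
  by apply: sub_finite_set => _ [t _ <-]; case: ifP => _; [left|right]; exists t.
rewrite (_ : _ @^-1` _ = (A `&` s @^-1` [set v]) `|` (~` A `&` s' @^-1` [set v])).
  by apply: measurableU; apply: measurableI => //; exact: measurableC.
apply/seteqP; split => [t /=|t /= [[At <-]|[At <-]]].
- by case: ifPn => [/set_mem|/negP] h e; [left|right; split => // /mem_set].
- by rewrite mem_set.
- by rewrite memNset.
Qed.

(** Convergence is required at every point, unlike in [strongly_measurable], so that real functions
    derived from [u] are Borel measurable without completing the measure. *)
Definition smeas (V : normedModType R[i]) (u : R -> V) : Prop :=
  exists s : nat -> R -> V, (forall n, simple_fun (s n)) /\
    forall t, s n t @[n --> \oo] --> u t.

Lemma smeas_real2 (V V' : normedModType R[i]) (u : R -> V) (u' : R -> V')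
    (c : V -> V' -> R) :
  (forall (a : nat -> V) (b : nat -> V') x y, a n @[n --> \oo] --> x ->
    b n @[n --> \oo] --> y -> c (a n) (b n) @[n --> \oo] --> c x y) ->
  smeas u -> smeas u' -> measurable_fun setT (fun t => c (u t) (u' t)).
Proof.
move=> cc [s [hs su]] [s' [hs' su']].
apply: (@measurable_fun_cvg _ _ _ _ (fun n t => c (s n t) (s' n t))).
  by move=> n; exact: simple_real2.
by move=> t _; exact: cc.
Qed.

Lemma smeas_map2 (V V' V'' : normedModType R[i]) (u : R -> V) (u' : R -> V')
    (c : V -> V' -> V'') :
  (forall (a : nat -> V) (b : nat -> V') x y, a n @[n --> \oo] --> x ->
    b n @[n --> \oo] --> y -> c (a n) (b n) @[n --> \oo] --> c x y) ->
  smeas u -> smeas u' -> smeas (fun t => c (u t) (u' t)).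
Proof.
move=> cc [s [hs su]] [s' [hs' su']].
exists (fun n t => c (s n t) (s' n t)); split => [n|t]; last exact: cc.
exact: simple_map2.
Qed.

Lemma smeas_map (V V'' : normedModType R[i]) (u : R -> V) (c : V -> V'') :
  (forall (a : nat -> V) x, a n @[n --> \oo] --> x ->
    c (a n) @[n --> \oo] --> c x) ->
  smeas u -> smeas (c \o u).
Proof. by move=> cc hu; apply: (smeas_map2 (c := fun x _ => c x) _ hu hu) => *; exact: cc. Qed.

Lemma smeas_if (V : normedModType R[i]) (A : set R) (u u' : R -> V) :
  measurable A -> smeas u -> smeas u' ->
  smeas (fun t => if t \in A then u t else u' t).
Proof.
move=> mA [s [hs su]] [s' [hs' su']].
exists (fun n t => if t \in A then s n t else s' n t); split => [n|t].
  exact: simple_if.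
by case: ifP => _.
Qed.

Lemma smeas_cst (V : normedModType R[i]) (v : V) : smeas (fun=> v).
Proof.
by exists (fun _ _ => v); split => [n|t]; [exact: simple_cst|exact: cvg_cst].
Qed.

Lemma smeas_rnorm (V : normedModType R[i]) (u : R -> V) : smeas u ->
  measurable_fun setT (fun t => rnorm (u t)).
Proof.
move=> hu; apply: (smeas_real2 (c := fun x _ => rnorm x) _ hu hu) => a b x y /cvg_rnormP ax _.
apply/cvgrPdist_lt => e e0; have [N hN] := ax _ e0; exists N => //= n /hN.
by apply: le_lt_trans; rewrite rnormC rnorm_dist.
Qed.

Lemma smeasB (V : normedModType R[i]) (u v : R -> V) : smeas u -> smeas v ->
  smeas (fun t => u t - v t).
Proof. by apply: (smeas_map2 (c := fun x y => x - y)) => a b x y; exact: cvgB. Qed.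

Lemma smeasD (V : normedModType R[i]) (u v : R -> V) : smeas u -> smeas v ->
  smeas (fun t => u t + v t).
Proof. by apply: (smeas_map2 (c := fun x y => x + y)) => a b x y; exact: cvgD. Qed.

Lemma smeasZ (V : normedModType R[i]) (z : R[i]) (u : R -> V) : smeas u ->
  smeas (fun t => z *: u t).
Proof. by apply: (smeas_map (c := fun x => z *: x)) => a x ax; exact: cvgZr. Qed.

Lemma strongly_measurable_smeas (V : normedModType R[i]) D (u : R -> V) :
  smeas u -> strongly_measurable D u.
Proof. by move=> [s [hs su]]; exists s; split => //; exact: aeW. Qed.

Lemma strongly_measurable_ae (V : normedModType R[i]) D (u v : R -> V) :
  {ae mu, forall t, D t -> u t = v t} -> strongly_measurable D u -> strongly_measurable D v.
Proof.
move=> uv [s [hs su]]; exists s; split => //.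
by apply: ae_mono2 uv su _ => t h1 h2 Dt; rewrite -h1 //; exact: h2.
Qed.

Lemma strongly_measurable_rep (V : normedModType R[i]) D (u : R -> V) :
  measurable D -> strongly_measurable D u ->
  exists v, [/\ smeas v, forall t, ~ D t -> v t = 0 &
                {ae mu, forall t, D t -> u t = v t}].
Proof.
move=> mD [s [hs [N [mN N0 sN]]]].
have su t : D t -> ~ N t -> s n t @[n --> \oo] --> u t.
  by move=> Dt Nt; apply: contrapT => h; apply: Nt; apply: sN => /= /(_ Dt).
have mDN : measurable (D `\` N) by exact: measurableD.
exists (fun t => if t \in D `\` N then u t else 0); split.
- exists (fun n t => if t \in D `\` N then s n t else 0); split=> [n|t].
    by apply: simple_if => //; exact: simple_cst.
  by case: ifPn => [/set_mem[Dt Nt]|_]; [exact: su|exact: cvg_cst].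
- by move=> t Dt; rewrite memNset // => -[].
- exists N; split => // t /= /not_implyP[Dt h]; apply: contrapT => Nt; apply: h.
  by rewrite mem_set.
Qed.

Section Separable.
Context (V : normedModType R[i]).
Hypothesis V_separable : separable V.

Lemma separable_seq : exists d : nat -> V, dense (range d).
Proof.
have [S [/countable_injP[f finj] dS]] := V_separable.
exists (fun n => xget 0 [set x | S x /\ f x = n]) => O O0 oO.
have [x [Ox Sx]] := dS O O0 oO; exists x; split => //; exists (f x) => //.
have [Sy fy] := @xgetPex _ 0 [set y | S y /\ f y = f x] (ex_intro _ x (conj Sx erefl)).
by apply: finj; rewrite ?inE.
Qed.

(** A form of Pettis' criterion: the n-th approximation sends [t] to a point nearest to [u t] among
    the first [n + 1] points of a dense sequence, and comparing distances is a measurable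
    condition. *)
Lemma smeas_separable (u : R -> V) :
  (forall x, measurable_fun setT (fun t => rnorm (u t - x))) -> smeas u.
Proof.
move=> mu_; have [d /dense_rnormP dd] := separable_seq.
pose s := fix s n : R -> V := match n with
  | 0%N => fun=> d 0%N
  | n.+1 => fun t => if t \in [set t | rnorm (u t - d n.+1) < rnorm (u t - s n t)]
                  then d n.+1 else s n t end.
have hs n : simple_fun (s n) /\ measurable_fun setT (fun t => rnorm (u t - s n t)).
  elim: n => [|n [hs ms]]; first by split; [exact: simple_cst|exact: mu_].
  have mA : measurable [set t | rnorm (u t - d n.+1) < rnorm (u t - s n t)].
    have := measurable_fun_ltr (mu_ (d n.+1)) ms measurableT (Y := [set true]).
    move=> /(_ I).
    by rewrite setTI.
  split; first by apply: simple_if => //; exact: simple_cst.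
  rewrite (_ : (fun t => _) = (fun t => Num.min (rnorm (u t - d n.+1)) (rnorm (u t - s n t)))).
    exact: measurable_minr.
  apply/funext => t /=; rewrite minElt; case: ifPn => [/set_mem /= ->//|/negP h].
  by case: ifPn => // h'; case: h; rewrite inE.
exists s; split => [n|t]; first exact: (hs n).1.
have dec n k : (k <= n)%N -> rnorm (u t - s n t) <= rnorm (u t - d k).
  elim: n => [|n IH]; first by rewrite leqn0 => /eqP ->.
  rewrite leq_eqVlt => /predU1P[->|]; last rewrite ltnS => /IH {}IH.
    by rewrite /=; case: ifPn => // /negP h; rewrite leNgt; apply/negP => h'; apply: h; rewrite inE.
  by apply: le_trans IH => /=; case: ifPn => // /set_mem /= /ltW.
apply/cvg_rnormP => e e0; have [_ [k _ <-] hk] := dd (u t) _ e0.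
by exists k => n /dec h; rewrite rnormC; exact: le_lt_trans h hk.
Qed.

Lemma smeas_lim (u : nat -> R -> V) (v : R -> V) : (forall n, smeas (u n)) ->
  (forall t, u n t @[n --> \oo] --> v t) -> smeas v.
Proof.
move=> su uv; apply: smeas_separable => x.
apply: (@measurable_fun_cvg _ _ _ _ (fun n t => rnorm (u n t - x))).
  by move=> n; apply: smeas_rnorm; apply: smeasB => //; exact: smeas_cst.
move=> t _; have /cvg_rnormP ut := uv t; apply/cvgrPdist_lt => e e0.
have [N hN] := ut _ e0; exists N => //= n /hN; apply: le_lt_trans.
apply: le_trans (rnorm_dist _ _) _.
by rewrite opprB addrA subrK rnormC.
Qed.

End Separable.
End SimpleLimits.

(** * Square-integrable functions *)

Section L2.
Context (R : realType) (H : completeNormedModType R[i])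
  (ip : {dot H for @Num.conj R[i]}).
Hypothesis H_norm : forall x : H, `|x| ^+ 2 = ip x x.
Hypothesis H_separable : separable H.
Notation mu := (@lebesgue_measure R).
Local Notation rip := (rip ip).
Local Notation L2mem := (@L2mem R H).
Implicit Types (K : set R).

Lemma rip_cvg (a b : nat -> H) (x y : H) : a n @[n --> \oo] --> x ->
  b n @[n --> \oo] --> y -> rip (a n) (b n) @[n --> \oo] --> rip x y.
Proof.
move=> /cvg_rnormP ax /cvg_rnormP by_.
have cv (c : nat -> H) (z : H) : (forall e : R, 0 < e -> exists N, forall n, (N <= n)%N ->
    rnorm (c n - z) < e) -> rnorm (c n - z) @[n --> \oo] --> (0 : R).
  move=> h; apply/cvgrPdist_lt => e /h[N hN]; exists N => //= n /hN.
  by rewrite sub0r normrN ger0_norm // rnorm_ge0.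
have {ax}ax := cv _ _ ax; have {by_}by_ := cv _ _ by_.
apply/subr_cvg0/norm_cvg0P.
apply: (@squeeze_cvgr _ _ _ _ (fun=> 0) (fun n => rnorm (a n - x) * rnorm (b n - y)
   + rnorm (a n - x) * rnorm y + rnorm x * rnorm (b n - y))).
- apply: nearW => n; rewrite normr_ge0 /=.
  have -> : rip (a n) (b n) - rip x y =
     rip (a n - x) (b n - y) + rip (a n - x) y + rip x (b n - y).
    by rewrite !ripBr !ripBl; ring.
  do 2 (apply: (le_trans (ler_normD _ _)); apply: lerD; last exact: rip_rnorm).
  exact: rip_rnorm.
- exact: cvg_cst.
- rewrite [X in _ --> X](_ : 0 = 0 * 0 + 0 * rnorm y + rnorm x * 0 :> R); last by ring.
  by apply: cvgD; [apply: cvgD|]; apply: cvgM => //; exact: cvg_cst.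
Qed.

Lemma rip_meas (u v : R -> H) : smeas u -> smeas v ->
  measurable_fun setT (fun t => rip (u t) (v t)).
Proof. exact: smeas_real2 rip_cvg. Qed.

Definition rdot K (u v : R -> H) : R := Rintegral mu K (fun t => rip (u t) (v t)).

Definition sq_int K (u : R -> H) : Prop :=
  smeas u /\ mu.-integrable K (EFin \o (fun t => rip (u t) (u t))).

Section OnK.
Variables (K : set R) (mK : measurable (K : set (measurableTypeR R))).

Lemma sq_int_rip u v : sq_int K u -> sq_int K v ->
  mu.-integrable K (EFin \o (fun t => rip (u t) (v t))).
Proof.
move=> [su iu] [sv iv]; have := integrableD mK iu iv.
apply: le_integrable => //.
  by apply/measurable_EFinP; apply: measurable_funTS; exact: rip_meas.
move=> t _; rewrite /= lee_fin.
have := rip_le H_norm (u t) (v t); have := nsq_ge0 H_norm (u t); have := nsq_ge0 H_norm (v t).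
by move=> *; rewrite (ger0_norm (_ : 0 <= _ + _)); lra.
Qed.

Lemma sq_int_le (u : R -> H) (v : R -> H) (C : R) : sq_int K u -> smeas v ->
  (forall t, K t -> rip (v t) (v t) <= C * rip (u t) (u t)) -> sq_int K v.
Proof.
move=> [su iu] sv h; split => //; have := integrableZl mK C iu.
apply: le_integrable => //.
  by apply/measurable_EFinP; apply: measurable_funTS; exact: rip_meas.
move=> t Kt /=; rewrite lee_fin ger0_norm ?nsq_ge0 //.
exact: le_trans (h t Kt) (ler_norm _).
Qed.

Lemma sq_intD u v : sq_int K u -> sq_int K v -> sq_int K (fun t => u t + v t).
Proof.
move=> hu hv; have [su iu] := hu; have [sv iv] := hv; split; first exact: smeasD.
have h := integrableD mK (integrableD mK iu (integrableZl mK 2 (sq_int_rip hu hv))) iv.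
by apply: eq_integrable h => // t _ /=; rewrite ripD_nsq.
Qed.

Lemma rnorm_scale_le (z : R[i]) (x : H) : rip (z *: x) (z *: x) =
  rnorm (z : R[i]^o) ^+ 2 * rip x x.
Proof.
rewrite -!(rnorm_sqr H_norm) // -exprMn; congr (_ ^+ 2); apply: complexI.
by rewrite rmorphM /= -!normE normrZ.
Qed.

Lemma sq_intZ (z : R[i]) u : sq_int K u -> sq_int K (fun t => z *: u t).
Proof.
move=> hu; apply: (@sq_int_le u _ (rnorm (z : R[i]^o) ^+ 2)) => //.
  by apply: smeasZ; exact: hu.1.
by move=> t _; rewrite rnorm_scale_le.
Qed.

Lemma sq_intB u v : sq_int K u -> sq_int K v -> sq_int K (fun t => u t - v t).
Proof.
move=> hu hv; have := sq_intD hu (sq_intZ (-1) hv).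
by rewrite (_ : (fun t => _) = (fun t => u t - v t)) //; apply/funext => t; rewrite scaleN1r.
Qed.

Lemma sq_int_cst (x : H) : (mu K < +oo)%E -> sq_int K (fun=> x).
Proof.
move=> fK; split; first exact: smeas_cst.
apply/integrableP; split; first exact/measurable_EFinP/measurable_cst.
by rewrite integral_cst //= lte_mul_pinfty // lee_fin.
Qed.

Lemma sq_int0 : sq_int K (fun=> 0).
Proof.
split; first exact: smeas_cst.
rewrite (_ : _ \o _ = cst 0%E); first exact: integrable0.
by apply/funext => t; rewrite /= rip0l.
Qed.

Lemma sq_int_sub (K' : set R) u : measurable (K' : set (measurableTypeR R)) -> K' `<=` K -> sq_int K u -> sq_int K' u.
Proof. by move=> mK' sK [su iu]; split => //; exact: integrableS iu. Qed.

Lemma rdot_Dl u v w : sq_int K u -> sq_int K v -> sq_int K w ->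
  rdot K (fun t => u t + v t) w = rdot K u w + rdot K v w.
Proof.
move=> hu hv hw; rewrite /rdot -RintegralD //; [|exact: sq_int_rip..].
by apply: eq_Rintegral => t _; rewrite ripDl.
Qed.

Lemma rdot_Zl (r : R) u v : sq_int K u -> sq_int K v ->
  rdot K (fun t => r%:C *: u t) v = r * rdot K u v.
Proof.
move=> hu hv; rewrite /rdot -RintegralZl //; last exact: sq_int_rip.
by apply: eq_Rintegral => t _; rewrite ripZl.
Qed.

Lemma rdotC u v : rdot K u v = rdot K v u.
Proof. by apply: eq_Rintegral => t _; rewrite ripC. Qed.

Lemma rdot_ge0 u : 0 <= rdot K u u.
Proof. by apply: Rintegral_ge0 => t _; exact: nsq_ge0. Qed.

Lemma rdot_ae u v u' v' : {ae mu, forall t, K t -> u t = u' t} ->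
  {ae mu, forall t, K t -> v t = v' t} -> rdot K u v = rdot K u' v'.
Proof.
move=> hu hv; apply: ae_Rintegral_eq; apply: ae_mono2 hu hv _ => t h1 h2 Kt.
by rewrite h1 // h2.
Qed.

Lemma L2mem_rep u : L2mem K u -> exists v, [/\ sq_int K v, forall t, ~ K t -> v t = 0 &
  {ae mu, forall t, K t -> u t = v t}].
Proof.
move=> [su iu]; have [v [sv v0 uv]] := strongly_measurable_rep mK su.
exists v; split => //; split => //; apply/integrableP; split.
  by apply/measurable_EFinP; apply: measurable_funTS; exact: rip_meas.
apply: le_lt_trans iu.
rewrite le_eqVlt; apply/orP; left; apply/eqP; apply: ae_integral_eq.
by apply: ae_mono uv _ => t h Kt; rewrite h //= ger0_norm ?nsq_ge0 // (rnorm_sqr H_norm).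
Qed.

Lemma sq_int_L2mem u : sq_int K u -> L2mem K u.
Proof.
move=> [su /integrableP[_ iu]]; split; first exact: strongly_measurable_smeas.
apply: le_lt_trans iu; rewrite le_eqVlt; apply/orP; left; apply/eqP.
by apply: eq_integral => t _; rewrite /= ger0_norm ?nsq_ge0 // (rnorm_sqr H_norm).
Qed.

Lemma L2mem_ae (u v : R -> H) : {ae mu, forall t, K t -> u t = v t} -> L2mem K u -> L2mem K v.
Proof.
move=> uv [su iu]; split; first exact: strongly_measurable_ae uv su.
apply: le_lt_trans iu; rewrite le_eqVlt; apply/orP; left; apply/eqP; apply: ae_integral_eq.
by apply: ae_mono uv _ => t h Kt; rewrite h.
Qed.

Lemma L2memD u v : L2mem K u -> L2mem K v -> L2mem K (u + v).
Proof.
move=> /L2mem_rep[u' [hu _ eu]] /L2mem_rep[v' [hv _ ev]].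
apply: L2mem_ae (sq_int_L2mem (sq_intD hu hv)).
by apply: ae_mono2 eu ev _ => t h1 h2 Kt; rewrite -h1 // -h2.
Qed.

Lemma L2memZ (z : R[i]) u : L2mem K u -> L2mem K (z *: u).
Proof.
move=> /L2mem_rep[u' [hu _ eu]]; apply: L2mem_ae (sq_int_L2mem (sq_intZ z hu)).
by apply: ae_mono eu _ => t h1 Kt; rewrite -h1.
Qed.

(** The n-th increment has norm at most [sqrt C / 2 ^+ n], so the sequence is Cauchy with a
    geometric tail. *)
Lemma geometric_cauchy (x : nat -> H) (C : R) :
  (forall k, 4 ^+ k * rip (x k.+1 - x k) (x k.+1 - x k) <= C) ->
  exists2 l, x n @[n --> \oo] --> l & forall k, rip (l - x k) (l - x k) <= 4 * C / 4 ^+ k.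
Proof.
move=> hx; have C0 : 0 <= C.
  by apply: le_trans (hx 0%N); rewrite mul1r nsq_ge0.
pose r := Num.sqrt C.
have p2 k : 0 < 2 ^+ k :> R by rewrite exprn_gt0.
have hx1 k : rnorm (x k.+1 - x k) <= r / 2 ^+ k.
  rewrite -(@ler_pXn2r _ 2) ?nnegrE ?rnorm_ge0 ?divr_ge0 ?sqrtr_ge0 ?(ltW (p2 k)) //.
  rewrite (rnorm_sqr H_norm) // expr_div_n sqr_sqrtr // -exprM mulnC exprM ler_pdivlMr ?exprn_gt0 //.
  by rewrite mulrC (_ : 2 ^+ 2 = 4) //; rewrite expr2; ring.
(* The subtracted tail makes the bound telescope, so that the induction on [m] closes. *)
have hm k m : rnorm (x (k + m)%N - x k) <= 2 * r / 2 ^+ k - 2 * r / 2 ^+ (k + m)%N.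
  elim: m => [|m IH]; first by rewrite addn0 !subrr rnorm0.
  apply: le_trans (rnorm_distD _ (x (k + m)%N) _) _; rewrite addnS.
  apply: le_trans (lerD (hx1 _) IH) _; rewrite [in leRHS]exprS invfM.
  have := p2 (k + m)%N; rewrite lt_def => /andP[pn0 _].
  set a := 2 * r / 2 ^+ k; move: (2 ^+ (k + m)%N) pn0 => q q0.
  by rewrite le_eqVlt; apply/orP; left; apply/eqP; field.
have r0 : 0 <= r by exact: sqrtr_ge0.
have hm2 k m : (k <= m)%N -> rnorm (x m - x k) <= 2 * r / 2 ^+ k.
  move=> km; rewrite -(subnKC km); apply: le_trans (hm _ _) _.
  by rewrite gerBl divr_ge0 ?(ltW (p2 _)) // mulr_ge0.
have [|l hl] := @rnorm_complete _ _ x.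
  move=> e e0; have e1 : 0 < e / (4 * r + 1) by rewrite divr_gt0 //; lra.
  have [N hN] : exists N, (2 ^+ N)^-1 < e / (4 * r + 1).
    have [N _ hN] := near_infty_natSinv_expn_lt (PosNum e1).
    by exists N; have := hN N (leqnn N); rewrite /= div1r.
  exists N => m n Nm Nn; apply: le_lt_trans (rnorm_distD _ (x N) _) _.
  rewrite (rnormC (x N)); apply: le_lt_trans (lerD (hm2 _ _ Nm) (hm2 _ _ Nn)) _.
  move: hN; rewrite ltr_pdivlMr; last lra.
  have := p2 N; rewrite -invr_gt0; move: (2 ^+ N)^-1 => q q0; nra.
exists l; first exact/cvg_rnormP.
move=> k; have hk : rnorm (l - x k) <= 2 * r / 2 ^+ k.
  apply/ler_addgt0Pr => e /hl[N hN].
  apply: le_trans (rnorm_distD _ (x (maxn N k)) _) _; rewrite addrC lerD //.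
    by apply: hm2; rewrite leq_maxr.
  by rewrite rnormC ltW // hN // leq_maxl.
rewrite -(rnorm_sqr H_norm); apply: le_trans (_ : (2 * r / 2 ^+ k) ^+ 2 <= _).
  by rewrite ler_pXn2r // ?nnegrE ?rnorm_ge0 // divr_ge0 ?(ltW (p2 _)) // mulr_ge0.
rewrite expr_div_n exprMn sqr_sqrtr // -exprM mulnC exprM.
by rewrite (_ : 2 ^+ 2 = 4) //; rewrite expr2; ring.
Qed.

Lemma rdot_sub u v (u' v' : R -> H) : {ae mu, forall t, K t -> u t = u' t} ->
  {ae mu, forall t, K t -> v t = v' t} ->
  rdot K (u - v) (u - v) = rdot K (fun t => u' t - v' t) (fun t => u' t - v' t).
Proof.
by move=> hu hv; apply: rdot_ae; apply: ae_mono2 hu hv _ => t h1 h2 Kt; rewrite -h1 // -h2.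
Qed.

Lemma EFin_rdot u v : sq_int K u -> sq_int K v ->
  (rdot K u v)%:E = (\int[mu]_(t in K) (rip (u t) (v t))%:E)%E.
Proof.
by move=> hu hv; rewrite /rdot /Rintegral fineK //; apply: integrable_fin_num (sq_int_rip hu hv).
Qed.

(* Riesz-Fischer along a subsequence with quickly decreasing increments. *)
Lemma sq_int_fast_complete (w : nat -> R -> H) : (forall n, sq_int K (w n)) ->
  (forall k, rdot K (fun t => w k.+1 t - w k t) (fun t => w k.+1 t - w k t) <= (8 ^+ k)^-1) ->
  exists2 l, sq_int K l & exists C, forall k,
     rdot K (fun t => l t - w k t) (fun t => l t - w k t) <= C / 4 ^+ k.
Proof.
move=> hw hd.
(* The weight [4 ^+ k] against increments of size [8 ^- k] leaves integrals of size [2 ^- k]; hence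
   [S] has integral at most 2, is finite almost everywhere, and bounds every [d k t] as
   [geometric_cauchy] requires. *)
pose d k t := 4 ^+ k * rip (w k.+1 t - w k t) (w k.+1 t - w k t).
have d0 k t : 0 <= d k t by rewrite mulr_ge0 ?nsq_ge0 // exprn_ge0.
have mdk k : measurable_fun K (EFin \o d k).
  apply/measurable_EFinP/measurable_funM; first exact: measurable_cst.
  by apply: measurable_funTS; apply: rip_meas; apply: smeasB; exact: (hw _).1.
pose S t := (\sum_(0 <= k <oo) (d k t)%:E)%E.
have mS : measurable_fun K S.
  by apply: (ge0_emeasurable_sum (P := xpredT)) => [k t _ _|k _]; rewrite ?lee_fin //; exact: mdk.
have S0 t : (0 <= S t)%E by apply: nneseries_ge0 => k _ _; rewrite lee_fin.
have intS : (\int[mu]_(t in K) S t <= 2%:E)%E.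
  rewrite integral_nneseries //; last by move=> k t _; rewrite lee_fin.
  apply: lime_le.
    by apply: is_cvg_nneseries => k _ _; apply: integral_ge0 => t _; rewrite lee_fin.
  apply: nearW => n.
  apply: (@le_trans _ _ (\sum_(0 <= k < n) ((2 ^+ k)^-1)%:E)%E).
    apply: lee_sum => k _; rewrite /d.
    under eq_integral do rewrite EFinM.
    have hB := sq_intB (hw k.+1) (hw k).
    rewrite integralZl //; last exact: sq_int_rip.
    rewrite -EFin_rdot // -EFinM lee_fin; apply: le_trans (ler_wpM2l _ (hd k)) _.
      by rewrite exprn_ge0.
    rewrite -exprVn -exprMn -exprVn (_ : 4 / 8 = 2^-1 :> R) //; by field.
  rewrite sumEFin lee_fin.
  suff -> : \sum_(0 <= k < n) (2 ^+ k)^-1 = 2 - 2 * (2 ^+ n)^-1 :> R.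
    by rewrite gerBl mulr_ge0 // invr_ge0 exprn_ge0.
  elim: n => [|n IH]; first by rewrite big_geq // expr0 invr1; ring.
  rewrite big_nat_recr //= IH exprS invfM; have : 2 ^+ n != 0 :> R by rewrite expf_neq0.
  by move: (2 ^+ n) => q q0; field.
have iS : mu.-integrable K S.
  apply/integrableP; split => //; apply: (@le_lt_trans _ _ 2%:E); last exact: ltry.
  by apply: le_trans intS; rewrite le_eqVlt; apply/orP; left; apply/eqP/eq_integral => t _; rewrite gee0_abs.
pose G := K `&` [set t | S t \is a fin_num].
have mG : measurable G by exact: emeasurable_fin_num.
have dS k t : G t -> d k t <= fine (S t).
  move=> [Kt Gt]; rewrite -lee_fin fineK //.
  apply: le_trans (nneseries_lim_ge k.+1 _); last by move=> n _ _; rewrite lee_fin.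
  rewrite big_nat_recr //= -[leLHS]add0e leeD2r // sume_ge0 // => n _; by rewrite lee_fin.
have hl t : exists l, G t -> w n t @[n --> \oo] --> l /\
    forall k, rip (l - w k t) (l - w k t) <= 4 * fine (S t) / 4 ^+ k.
  have [Gt|nGt] := pselect (G t); last by exists 0.
  have [l h1 h2] := geometric_cauchy (fun k => dS k t Gt).
  by exists l.
have [l {}hl] := choice hl.
pose l' t := if t \in G then l t else 0.
have sl : smeas l'.
  apply: (smeas_lim H_separable (u := fun n t => if t \in G then w n t else 0)).
    by move=> n; apply: smeas_if => //; [exact: (hw n).1|exact: smeas_cst].
  move=> t; rewrite /l'; case: ifPn => [/set_mem/hl[]//|_]; exact: cvg_cst.
have Gae : {ae mu, forall t, K t -> G t}.
  by apply: ae_mono (integrable_ae mK iS) _ => t h Kt; split => //; exact: h.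
have iS4 k : mu.-integrable K (fun t => (4 / 4 ^+ k)%:E * S t)%E by exact: integrableZl.
have le_l k : (\int[mu]_(t in K) `|(rip (l' t - w k t) (l' t - w k t))%:E| <= (4 / 4 ^+ k)%:E * (\int[mu]_(t in K) S t))%E.
  rewrite -integralZl //.
  (* Off [G] the limit is replaced by [w k t]: the integral does not see it, and the comparison then
     holds at every point of [K]. *)
  apply: (@le_trans _ _ (\int[mu]_(t in K) `|(rip ((if t \in G then l t else w k t) - w k t)
    ((if t \in G then l t else w k t) - w k t))%:E|)%E).
    rewrite le_eqVlt; apply/orP; left; apply/eqP; apply: ae_integral_eq.
    by apply: ae_mono Gae _ => t Gt Kt; rewrite /l' mem_set //; exact: Gt.
  apply: ge0_le_integral => //.
  - apply: measurableT_comp => //; apply/measurable_EFinP; apply: measurable_funTS.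
    have smk : smeas (fun t => (if t \in G then l t else w k t) - w k t).
      apply: smeasB; last exact: (hw k).1.
      rewrite (_ : (fun t => _) = (fun t => if t \in G then l' t else w k t)); last first.
        by apply/funext => t; rewrite /l'; case: ifP.
      by apply: smeas_if => //; exact: (hw k).1.
    exact: rip_meas.
  - exact: measurable_int (iS4 k).
  - move=> t Kt; rewrite gee0_abs ?lee_fin ?nsq_ge0 //; case: ifPn => [/set_mem Gt|_].
      rewrite -(fineK Gt.2) -EFinM lee_fin; apply: le_trans ((hl t Gt).2 k) _.
      by rewrite mulrAC.
    by rewrite subrr rip0l mule_ge0 // lee_fin divr_ge0 // exprn_ge0.
have hl0 k : sq_int K (fun t => l' t - w k t).
  split; first by apply: smeasB => //; exact: (hw k).1.
  apply/integrableP; split.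
    by apply/measurable_EFinP; apply: measurable_funTS; apply: rip_meas; apply: smeasB => //; exact: (hw k).1.
  apply: le_lt_trans (le_l k) _.
  apply: (@le_lt_trans _ _ ((4 / 4 ^+ k)%:E * 2%:E)%E); last by rewrite -EFinM ltry.
  by apply: lee_wpmul2l => //; rewrite lee_fin divr_ge0 // exprn_ge0.
exists l'.
  have := sq_intD (hl0 0%N) (hw 0%N); congr sq_int; apply/funext => t; exact: subrK.
exists 8 => k; rewrite -lee_fin EFin_rdot //.
apply: le_trans (_ : _ <= ((4 / 4 ^+ k)%:E * 2%:E)%E)%E _.
  apply: le_trans (le_trans _ (le_l k)) _; first last.
    by apply: lee_wpmul2l => //; rewrite lee_fin divr_ge0 // exprn_ge0.
  rewrite le_eqVlt; apply/orP; left; apply/eqP/eq_integral => t _.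
  by rewrite /= ger0_norm // nsq_ge0.
by rewrite -EFinM lee_fin le_eqVlt; apply/orP; left; apply/eqP; ring.
Qed.

Lemma L2_complete (u : nat -> R -> H) : (forall n, L2mem K (u n)) ->
  (forall e : R, 0 < e -> exists N, forall m n, (N <= m)%N -> (N <= n)%N ->
       rdot K (u m - u n) (u m - u n) < e) ->
  exists2 l, L2mem K l & forall e : R, 0 < e -> exists N, forall n, (N <= n)%N ->
       rdot K (u n - l) (u n - l) < e.
Proof.
move=> hu hc.
have /choice[v hv] n : exists v, sq_int K v /\ {ae mu, forall t, K t -> u n t = v t}.
  by have [v [h1 _ h3]] := L2mem_rep (hu n); exists v.
pose nd (x y : R -> H) := rdot K (fun t => x t - y t) (fun t => x t - y t).
have hv' m n : rdot K (u m - u n) (u m - u n) = nd (v m) (v n).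
  by apply: rdot_sub; [exact: (hv m).2|exact: (hv n).2].
have e8 k : 0 < (8 ^+ k)^-1 :> R by rewrite invr_gt0 exprn_gt0.
have /choice[N hN] k : exists N, forall m n, (N <= m)%N -> (N <= n)%N ->
    nd (v m) (v n) < (8 ^+ k)^-1.
  by have [N hN] := hc _ (e8 k); exists N => m n Nm Nn; rewrite -hv' hN.
(* Cumulative sums give indices that are nondecreasing and still at least [N k]. *)
pose M k := (\sum_(j < k.+1) N j)%N.
have NM k : (N k <= M k)%N by rewrite /M big_ord_recr leq_addl.
have MM k : (M k <= M k.+1)%N by rewrite [M k.+1]big_ord_recr leq_addr.
have [l hl [C hC]] := @sq_int_fast_complete (fun k => v (M k)) (fun k => (hv (M k)).1)
  (fun k => ltW (hN k _ _ (leq_trans (NM k) (MM k)) (NM k))).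
exists l; first exact: sq_int_L2mem.
move=> e e0; have C0 : 0 <= C.
  by have := hC 0%N; rewrite expr0 divr1; apply: le_trans; exact: rdot_ge0.
(* The final error is at most [2 * (8 ^- k + C / 4 ^+ k)], which is below this. *)
have [k hk] : exists k, (2 * C + 2) / 4 ^+ k < e.
  have e1 : 0 < e / (2 * C + 2) by rewrite divr_gt0 //; lra.
  have [k _ hk] := near_infty_natSinv_expn_lt (PosNum e1); exists k.
  have := hk k (leqnn k); rewrite /= div1r ltr_pdivlMr; last lra.
  rewrite mulrC; apply: le_lt_trans; apply: ler_wpM2l; first lra.
  by rewrite lef_pV2 ?posrE ?exprn_gt0 // lerXn2r ?nnegrE //; lra.
have el : {ae mu, forall t, K t -> l t = l t} by exact: aeW.
exists (M k) => n Mn; rewrite (rdot_sub (hv n).2 el).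
have h1 := hN k n (M k) (leq_trans (NM k) Mn) (NM k).
have h2 := hC k.
have hnl : sq_int K (fun t => v n t - l t) by apply: sq_intB => //; exact: (hv n).1.
apply: le_lt_trans hk.
pose a t := v n t - v (M k) t; pose b t := l t - v (M k) t.
have ha : sq_int K a by apply: sq_intB; exact: (hv _).1.
have hb : sq_int K b by apply: sq_intB => //; exact: (hv _).1.
have : nd (v n) l <= 2 * (nd (v n) (v (M k)) + nd l (v (M k))).
  rewrite /nd /rdot -RintegralD //; [|exact: (sq_int_rip ha ha)|exact: (sq_int_rip hb hb)].
  have iab := integrableD mK (sq_int_rip ha ha) (sq_int_rip hb hb).
  rewrite -RintegralZl //; apply: le_Rintegral => //.
  - exact: (sq_int_rip hnl hnl).
  - by apply: eq_integrable (integrableZl mK 2 iab) => // t _ /=.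
  - move=> t _; have -> : v n t - l t = a t - b t by rewrite /a /b opprB addrA subrK.
    exact: nsqB_le.
rewrite -/(nd (v n) l) => h3; apply: le_trans h3 _.
have : (8 ^+ k)^-1 <= (4 ^+ k)^-1 :> R.
  by rewrite lef_pV2 ?posrE ?exprn_gt0 // lerXn2r ?nnegrE //; lra.
rewrite /nd in h1 h2 *; rewrite mulrDl.
by move: (rdot K _ _) (rdot K _ _) (4 ^+ k)^-1 (8 ^+ k)^-1 h1 h2 => *; lra.
Qed.

Lemma real_hilbert_L2 : real_hilbert (L2mem K) (rdot K).
Proof.
split.
- exact: sq_int_L2mem sq_int0.
- exact: L2memD.
- exact: L2memZ.
- by move=> u v _ _; exact: rdotC.
- move=> u v w /L2mem_rep[u' [hu _ eu]] /L2mem_rep[v' [hv _ ev]] /L2mem_rep[w' [hw _ ew]].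
  rewrite (rdot_ae eu ew) (rdot_ae ev ew) -rdot_Dl //; apply: rdot_ae => //.
  by apply: ae_mono2 eu ev _ => t h1 h2 Kt; rewrite -h1 // -h2.
- move=> r u v /L2mem_rep[u' [hu _ eu]] /L2mem_rep[v' [hv _ ev]].
  rewrite (rdot_ae eu ev) -rdot_Zl //; apply: rdot_ae => //.
  by apply: ae_mono eu _ => t h1 Kt; rewrite -h1.
- by move=> u _; exact: rdot_ge0.
- exact: L2_complete.
Qed.

End OnK.

Lemma L2dotE K u v : L2dot ip K u v = rdot K u v +i* rdot K u ('i%C *: v).
Proof.
by congr (_ +i* _); apply: eq_Rintegral => t _; rewrite Im_ipE.
Qed.

Lemma hnorm_L2 K u : hnorm (E := L2 ip K) u = Num.sqrt (rdot K u u).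
Proof. by []. Qed.

End L2.

(** * Smooth steps *)

Section SmoothStep.
Context (R : realType).
Implicit Types (f g : R -> R) (p : {poly R}).

(** The polynomial makes the family closed under differentiation: the derivative of
    [p(1/x) exp(-1/x)] is [(1/x)^2 (p - p')(1/x) exp(-1/x)]. *)
Definition flat p (x : R) : R := if x <= 0 then 0 else p.[x^-1] * expR (- x^-1).

(** Induction along Horner's scheme, spending half of the exponent on each factor [y]; this is why
    the rate [k] is arbitrary. *)
Lemma poly_expR_bound p (k : R) : 0 < k ->
  exists2 M : R, 0 <= M & forall y : R, 0 <= y -> `|p.[y]| * expR (- (k * y)) <= M.
Proof.
elim/poly_ind: p k => [|p c IH] k k0.
  by exists 0 => // y _; rewrite horner0 normr0 mul0r.
have k20 : 0 < k / 2 by lra.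
have [M M0 hM] := IH _ k20; exists (M * (2 / k) + `|c|).
  by rewrite addr_ge0 // mulr_ge0 // divr_ge0 // ltW.
move=> y y0; have -> : (p * 'X + c%:P).[y] = p.[y] * y + c by rewrite !hornerE.
apply: (@le_trans _ _ ((`|p.[y]| * y + `|c|) * expR (- (k * y)))).
  rewrite ler_wpM2r ?expR_ge0 //; apply: le_trans (ler_normD _ _) _.
  by rewrite normrM (ger0_norm y0).
rewrite mulrDl lerD //; last first.
  by rewrite ler_piMr // expR_le1 oppr_le0 mulr_ge0 // ltW.
have -> : - (k * y) = - (k / 2 * y) + - (k / 2 * y) by field.
rewrite expRD; set E := expR (- (k / 2 * y)).
have -> : `|p.[y]| * y * (E * E) = (`|p.[y]| * E) * (y * E) by ring.
rewrite {}/E.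
apply: ler_pM; rewrite ?mulr_ge0 ?expR_ge0 //; first exact: hM.
rewrite expRN ler_pdivrMr ?expR_gt0 //.
have := expR_ge1Dx (k / 2 * y) => h; have : (2 / k) * (1 + k / 2 * y) <= (2 / k) * expR (k / 2 * y).
  by rewrite ler_wpM2l // divr_ge0 // ltW.
apply: le_trans; rewrite mulrDr mulr1 mulrA (_ : 2 / k * (k / 2) = 1); last by field; rewrite gt_eqF.
by rewrite mul1r lerDr divr_ge0 // ltW.
Qed.

(** The exponential bound for [p * 'X] supplies the additional factor [x]; it gives continuity at 0,
    the only delicate point. *)
Lemma flat_bound p : exists2 M : R, 0 <= M & forall x : R, `|flat p x| <= M * `|x|.
Proof.
have [M M0 hM] := @poly_expR_bound (p * 'X) 1 ltr01; exists M => // x.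
rewrite /flat; case: ifPn => [_|]; first by rewrite normr0 mulr_ge0.
rewrite -ltNge => x0; have xi : 0 <= x^-1 by rewrite invr_ge0 ltW.
have := hM _ xi; rewrite mul1r hornerMX normrM (ger0_norm xi) (ger0_norm (ltW x0)).
rewrite normrM (ger0_norm (expR_ge0 _)) mulrAC ler_pdivrMr //.
Qed.

Lemma flat_derive p (x : R) : is_derive x (1 : R) (flat p) (flat ('X^2 * (p - p^`())) x).
Proof.
have [x0|x0|->] := ltgtP x 0.
- apply: (@near_eq_is_derive _ _ _ (cst 0)).
    by near=> y; rewrite /flat ltW //; near: y; exact: lt_nbhsl.
  by rewrite /flat ltW //; exact: is_derive_cst.
- apply: (near_eq_is_derive (f := fun y : R => p.[y^-1] * expR (- y^-1))).
    near=> y; rewrite /flat leNgt (_ : 0 < y) //; near: y.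
    exact: lt_nbhsr.
  rewrite /flat leNgt x0 /=.
  have hx : x != 0 by rewrite gt_eqF.
  have di : is_derive x (1 : R) (fun y : R => y^-1) (- x ^- 2).
    apply: is_derive_eq (@is_deriveV R id x 1 1 hx (is_derive_id _ _)) _.
    by rewrite /GRing.scale /= mulr1.
  have dp := is_derive1_comp (is_derive_poly p x^-1) di.
  have dN := is_deriveN di.
  have de := is_derive1_comp (g := fun y => - y^-1) (is_derive_expR (- x^-1)) dN.
  apply: is_derive_eq (is_deriveM dp de) _.
  by rewrite /GRing.scale /= !hornerE /=; field.
(* At 0 the difference quotient of [flat p] is [flat (p * 'X)], which is continuous there with value
   0. *)
- have E : flat ('X^2 * (p - p^`())) 0 = 0 by rewrite /flat lexx.
  rewrite E; apply/is_derive1_caratheodory; exists (flat (p * 'X)); split.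
  + move=> z; rewrite {2}/flat lexx !subr0 /flat; case: ifPn => [_|]; first by rewrite mul0r.
    rewrite -ltNge => z0; rewrite hornerMX; field; by rewrite gt_eqF.
  + have [M M0 hM] := flat_bound (p * 'X).
    apply/cvgrPdist_lt => e e0; have d0 : 0 < e / (M + 1) by rewrite divr_gt0 //; lra.
    near=> y; rewrite {1}/flat lexx sub0r normrN; apply: le_lt_trans (hM y) _.
    have hy : `|y| < e / (M + 1).
      near: y; have := nbhsx_ballx (0 : R) _ d0; apply: filterS => y.
      by rewrite /ball /= sub0r normrN.
    move: hy; rewrite ltr_pdivlMr; last lra.
    have := normr_ge0 y; nra.
  + by rewrite /flat lexx.
Unshelve. all: by end_near. Qed.

(** A syntax closed under differentiation: one structural induction then gives derivatives of all
    orders. *)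
Inductive smooth_expr : (R -> R) -> Prop :=
| SE_flat p : smooth_expr (flat p)
| SE_cst c : smooth_expr (fun=> c)
| SE_affine f a b : smooth_expr f -> smooth_expr (fun x => f (a * x + b))
| SE_add f g : smooth_expr f -> smooth_expr g -> smooth_expr (fun x => f x + g x)
| SE_mul f g : smooth_expr f -> smooth_expr g -> smooth_expr (fun x => f x * g x)
| SE_inv f : smooth_expr f -> (forall x, f x != 0) -> smooth_expr (fun x => (f x)^-1).

Lemma SE_scale c f : smooth_expr f -> smooth_expr (fun x => c * f x).
Proof. by move=> hf; exact: SE_mul (SE_cst c) hf. Qed.

Lemma affine_derive (a b x : R) : is_derive x (1 : R) (fun y => a * y + b) a.
Proof.
apply/is_derive1_caratheodory; exists (cst a); split => //; last exact: cst_continuous.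
by move=> z /=; ring.
Qed.

Lemma smooth_expr_derive f : smooth_expr f ->
  exists2 g, smooth_expr g & forall x : R, is_derive x (1 : R) f (g x).
Proof.
elim=> {f} [p|c|f a b _ [f' sf' df]|f g _ [f' sf' df] _ [g' sg' dg]
  |f g sf [f' sf' df] sg [g' sg' dg]|f sf [f' sf' df] f0].
- by exists (flat ('X^2 * (p - p^`()))); [exact: SE_flat|exact: flat_derive].
- by exists (fun=> 0); [exact: SE_cst|move=> x; exact: is_derive_cst].
- exists (fun x => a * f' (a * x + b)); first exact/SE_scale/SE_affine.
  move=> x; have := is_derive1_comp (g := fun y => a * y + b) (df (a * x + b)) (affine_derive a b x).
  by rewrite mulrC.
- exists (fun x => f' x + g' x); first exact: SE_add.
  by move=> x; exact: is_deriveD.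
- exists (fun x => f x * g' x + g x * f' x); first by apply: SE_add; exact: SE_mul.
  by move=> x; exact: is_deriveM.
- exists (fun x => - 1 * ((f x)^-1 * (f x)^-1) * f' x).
    by apply: SE_mul => //; apply: SE_scale; apply: SE_mul; exact: SE_inv.
  move=> x; apply: is_derive_eq (is_deriveV (f0 x) (df x)) _.
  by rewrite /GRing.scale /= expr2 invfM mulN1r.
Qed.

Lemma is_derive_derive1 f g : (forall x : R, is_derive x (1 : R) f (g x)) -> derive1 f = g.
Proof. by move=> h; apply/funext => x; rewrite derive1E; exact: derive_val. Qed.

Lemma smooth_expr_derive1 f : smooth_expr f ->
  smooth_expr (derive1 f) /\ forall x : R, is_derive x (1 : R) f (derive1 f x).
Proof. by move=> /smooth_expr_derive[g sg h]; rewrite (is_derive_derive1 h). Qed.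

Lemma smooth_expr_derivable f : smooth_expr f ->
  forall n t, derivable (derive1n n f) t 1.
Proof.
move=> sf n; have : smooth_expr (derive1n n f).
  elim: n => [//|n IH]; rewrite derive1nS; exact: (smooth_expr_derive1 IH).1.
by move=> /smooth_expr_derive1[_ h] t; have [] := h t.
Qed.

Lemma is_derive_continuous f (x a : R) : is_derive x (1 : R) f a -> {for x, continuous f}.
Proof. by move=> [h _]; apply: differentiable_continuous; exact/derivable1_diffP. Qed.

Lemma smooth_expr_continuous f : smooth_expr f -> continuous f.
Proof. by move=> /smooth_expr_derive1[_ h] x; exact: is_derive_continuous (h x). Qed.

(** The usual smooth transition [f(x) / (f(x) + f(1 - x))] with [f(x) = exp(-1/x)]. *)
Definition step (x : R) : R := flat 1 x * (flat 1 x + flat 1 (-1 * x + 1))^-1.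

Lemma flat1_ge0 (x : R) : 0 <= flat 1 x.
Proof. by rewrite /flat; case: ifP => // _; rewrite hornerE mul1r expR_ge0. Qed.

Lemma flat1_gt0 (x : R) : 0 < x -> 0 < flat 1 x.
Proof. by move=> x0; rewrite /flat leNgt x0 /= hornerE mul1r expR_gt0. Qed.

Lemma step_den_neq0 (x : R) : flat 1 x + flat 1 (-1 * x + 1) != 0.
Proof.
rewrite gt_eqF //; have [x0|x0] := leP x 0; last first.
  by rewrite ltr_wpDr ?flat1_ge0 ?flat1_gt0.
by rewrite ltr_wpDl ?flat1_ge0 ?flat1_gt0 //; lra.
Qed.

Lemma smooth_step : smooth_expr step.
Proof.
apply: SE_mul; first exact: SE_flat.
apply: SE_inv; last exact: step_den_neq0.
by apply: SE_add; [exact: SE_flat|apply: SE_affine; exact: SE_flat].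
Qed.

Lemma step_le0 (x : R) : x <= 0 -> step x = 0.
Proof. by move=> x0; rewrite /step {1}/flat x0 mul0r. Qed.

Lemma step_ge1 (x : R) : 1 <= x -> step x = 1.
Proof.
move=> x1; rewrite /step (_ : flat 1 (-1 * x + 1) = 0); last first.
  by rewrite /flat ifT //; lra.
by rewrite addr0 divff // gt_eqF // flat1_gt0 //; lra.
Qed.

Lemma step_itv (x : R) : 0 <= step x <= 1.
Proof.
have h := step_den_neq0 x; have h1 := flat1_ge0 x; have h2 := flat1_ge0 (-1 * x + 1).
have h3 : 0 < flat 1 x + flat 1 (-1 * x + 1) by rewrite lt_def h addr_ge0.
by rewrite /step divr_ge0 ?(ltW h3) //= ler_pdivrMr // mul1r lerDl.
Qed.

Lemma derive_near_cst f (x c a : R) : (\near x, f x = c) -> is_derive x (1 : R) f a -> a = 0.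
Proof.
move=> h [_ <-]; rewrite -(near_eq_derive (f := cst c)) ?derive_cst //.
by apply: filterS h => y ->.
Qed.

Lemma dstep_out (x : R) : ~ (0 <= x <= 1) -> derive1 step x = 0.
Proof.
move=> hx; have := (smooth_expr_derive1 smooth_step).2 x.
have [x0|x0] := ltP x 0.
  by apply: (@derive_near_cst _ _ 0); near=> y; apply: step_le0; apply: ltW; near: y; exact: lt_nbhsl.
have x1 : 1 < x by rewrite ltNge; apply/negP => x1; apply: hx; rewrite x0.
by apply: (@derive_near_cst _ _ 1); near=> y; apply: step_ge1; apply: ltW; near: y; exact: lt_nbhsr.
Unshelve. all: by end_near. Qed.

Lemma continuous_norm_bound f (a b : R) : continuous f ->
  exists2 C : R, 0 <= C & forall x : R, a <= x <= b -> `|f x| <= C.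
Proof.
move=> cf; have [ab|ab] := leP a b; last first.
  by exists 0 => // x; lra.
have [|c _ hc] := @EVT_max R (fun x => `|f x|) a b ab.
  by apply: continuous_subspaceT => x; apply: continuous_comp; [exact: cf|exact: norm_continuous].
by exists `|f c| => // x xab; apply: hc; rewrite in_itv.
Qed.

Lemma dstep_bound : exists2 C : R, 0 <= C & forall x : R, `|derive1 step x| <= C.
Proof.
have [|C C0 hC] := @continuous_norm_bound (derive1 step) 0 1.
  exact/smooth_expr_continuous/(smooth_expr_derive1 smooth_step).1.
exists C => // x; have [h|h] := pselect (0 <= x <= 1); first exact: hC.
by rewrite dstep_out // normr0.
Qed.

End SmoothStep.

(** * Lebesgue points and test functions *)

Section Weak.
Context (R : realType).
Notation mu := (@lebesgue_measure R).
Implicit Types (a b : R -> R) (I K : set R).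

Lemma Rintegral_subset (A B : set R) (f : R -> R) : A `<=` B ->
  (forall x, B x -> ~ A x -> f x = 0) -> Rintegral mu A f = Rintegral mu B f.
Proof.
move=> AB f0; rewrite Rintegral_mkcond [RHS]Rintegral_mkcond; congr Rintegral.
apply/funext => x; rewrite !patchE; case: ifPn => [/set_mem/AB Bx|/negP nA].
  by rewrite mem_set.
case: ifPn => // /set_mem Bx; rewrite f0 // => Ax.
by apply: nA; exact: mem_set.
Qed.

Lemma locally_integrable_bounded a (x y : R) : locally_integrable setT a ->
  mu.-integrable `[x, y] (EFin \o a).
Proof.
move=> [ma _ ia]; apply/integrableP; split.
  by apply/measurable_EFinP; exact: measurable_funTS.
by apply: ia => //; exact: segment_compact.
Qed.

Lemma locally_integrable_sub a K (x y : R) : locally_integrable setT a ->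
  measurable (K : set (measurableTypeR R)) -> K `<=` `[x, y]%classic ->
  mu.-integrable K (EFin \o a).
Proof.
move=> la mK Kxy; apply: integrableS (locally_integrable_bounded x y la) => //.
Qed.

Lemma integrable_bounded_mul a (c : R -> R) K (C : R) :
  measurable (K : set (measurableTypeR R)) ->
  measurable_fun setT c -> (forall x, K x -> `|c x| <= C) ->
  mu.-integrable K (EFin \o a) -> mu.-integrable K (EFin \o (fun x => c x * a x)).
Proof.
move=> mK mc hc ia; have := integrableZl mK C ia; apply: le_integrable => //.
  apply/measurable_EFinP/measurable_funM; first exact: measurable_funTS.
  by apply/measurable_EFinP; exact: measurable_int ia.
move=> x Kx; rewrite /= lee_fin !normrM ler_wpM2r //.
exact: le_trans (hc x Kx) (ler_norm _).
Qed.

Lemma integrable_supp K a : measurable (K : set (measurableTypeR R)) ->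
  (forall x, ~ K x -> a x = 0) -> mu.-integrable K (EFin \o a) ->
  mu.-integrable setT (EFin \o a).
Proof.
move=> mK a0; rewrite integrable_mkcond // (_ : _ \_ _ = EFin \o a) //.
apply/funext => x; rewrite patchE; case: ifPn => // /negP h.
by rewrite /= a0 // => Kx; apply: h; exact: mem_set.
Qed.

Lemma Rintegral_dominated K (f_ : nat -> R -> R) (f g : R -> R) :
  measurable (K : set (measurableTypeR R)) ->
  (forall n, measurable_fun K (EFin \o f_ n)) -> measurable_fun K (EFin \o f) ->
  (forall x, K x -> f_ n x @[n --> \oo] --> f x) ->
  mu.-integrable K (EFin \o g) -> (forall n x, K x -> `|f_ n x| <= `|g x|) ->
  Rintegral mu K (f_ n) @[n --> \oo] --> Rintegral mu K f.
Proof.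
move=> mK mf_ mf cf ig hb.
have [|||i1 _ i2] := @dominated_convergence _ _ _ mu K mK (fun n => EFin \o f_ n) (EFin \o f)
  (abse \o (EFin \o g)) mf_ mf.
- by apply: aeW => x Kx; apply: cvg_EFin; [exact: nearW|exact: cf].
- exact: integrable_abse.
- by apply: aeW => x n Kx /=; rewrite lee_fin; exact: hb.
- by apply: fine_cvg; rewrite fineK //; exact: integrable_fin_num.
Qed.

(** The derivative of a rescaled [step], so that the mass is 1 and the primitive is explicit;
    differences of these primitives are the test functions below. *)
Definition bump (s : R) (n : nat) (x : R) : R :=
  n.+1%:R * derive1 (@step R) (n.+1%:R * x + - (n.+1%:R * s)).

Lemma bump_derive (s : R) n (x : R) :
  is_derive x (1 : R) (fun x => step (n.+1%:R * x + - (n.+1%:R * s))) (bump s n x).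
Proof.
have := is_derive1_comp (g := fun y => n.+1%:R * y + - (n.+1%:R * s))
  ((smooth_expr_derive1 (smooth_step R)).2 _) (affine_derive n.+1%:R (- (n.+1%:R * s)) x).
by rewrite [X in is_derive _ _ _ X -> _]mulrC.
Qed.

Lemma bump_smooth (s : R) n : smooth_expr (bump s n).
Proof.
apply: SE_scale; apply: (SE_affine (f := derive1 (@step R))).
exact: (smooth_expr_derive1 (smooth_step R)).1.
Qed.

Lemma bump_supp (s : R) n (x : R) : ~ (s <= x <= s + n.+1%:R^-1) -> bump s n x = 0.
Proof.
move=> h; rewrite /bump dstep_out ?mulr0 // => /andP[h1 h2]; apply: h.
have n0 : 0 < n.+1%:R :> R by [].
apply/andP; split; first by rewrite -(ler_pM2l n0); lra.
by rewrite -(ler_pM2l n0) mulrDr mulfV ?gt_eqF //; lra.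
Qed.

Lemma bump_int (s : R) n : Rintegral mu setT (bump s n) = 1.
Proof.
have n0 : 0 < n.+1%:R^-1 :> R by rewrite invr_gt0.
rewrite -(@Rintegral_subset `[s, s + n.+1%:R^-1]) //; last first.
  by move=> x _ h; apply: bump_supp => h'; apply: h; rewrite /= in_itv.
rewrite /Rintegral (@continuous_FTC2 _ _ (fun x => step (n.+1%:R * x + - (n.+1%:R * s)))).
- rewrite /= mulrDr mulfV ?gt_eqF // step_ge1 ?step_le0; lra.
- by rewrite ltrDl.
- by apply: continuous_subspaceT; exact: smooth_expr_continuous (bump_smooth s n).
- have c x := is_derive_continuous (bump_derive s n x).
  split; first by move=> x _; have [] := bump_derive s n x.
    by apply: cvg_at_right_filter; exact: c.
  by apply: cvg_at_left_filter; exact: c.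
- by move=> x _; rewrite derive1E; have [_ ->] := bump_derive s n x.
Qed.

Lemma locally_integrable_cst (c : R) : locally_integrable setT (fun=> c).
Proof.
split => //; first exact: openT.
move=> K _ cK; rewrite integral_cst /=; last exact: compact_measurable.
by rewrite lte_mul_pinfty // compact_finite_measure.
Qed.

(** The bump is at most [(n+1) C] on a ball of radius comparable to [1/(n+1)]; the error is thus a
    constant times the mean of [|a - a s|] over that ball, which vanishes in the limit at a Lebesgue
    point. *)
Lemma bump_mollify a (s : R) : locally_integrable setT a -> lebesgue_pt a s ->
  Rintegral mu setT (fun x => bump s n x * a x) @[n --> \oo] --> a s.
Proof.
move=> la lp; have [C C0 hC] := dstep_bound R.
have la' : locally_integrable setT (fun x => a x - a s).
  by apply: locally_integrableB => //; exact: locally_integrable_cst.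
(* Twice the width of the support, so that the open ball contains the closed interval
   [[s, s + 1/(n+1)]]. *)
pose e n : R := 2 * n.+1%:R^-1.
have e0 n : 0 < e n by rewrite mulr_gt0 // invr_gt0.
pose Bn n : set R := ball s (e n).
have mB n : measurable (Bn n : set (measurableTypeR R)) by exact: measurable_ball.
have subB n : Bn n `<=` `[s - e n, s + e n]%classic.
  by move=> x; rewrite /Bn /ball /= in_itv /= ltr_norml => /andP[*]; apply/andP; split; lra.
have insB n x : s <= x <= s + n.+1%:R^-1 -> Bn n x.
  have := e0 n; rewrite /Bn /ball /= /e ltr_norml => h /andP[h1 h2].
  by move: (n.+1%:R^-1) h h2 => q h h2; apply/andP; split; lra.
have mb n : measurable_fun setT (bump s n).
  by apply: continuous_measurable_fun; exact: smooth_expr_continuous (bump_smooth s n).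
have bb n x : `|bump s n x| <= n.+1%:R * C.
  by rewrite /bump normrM ger0_norm // ler_wpM2l.
have toB n (f : R -> R) : Rintegral mu setT (fun x => bump s n x * f x) =
    Rintegral mu (Bn n) (fun x => bump s n x * f x).
  by apply/esym/Rintegral_subset => // x _ h; rewrite bump_supp ?mul0r // => /insB.
have iB n f : locally_integrable setT f -> mu.-integrable (Bn n) (EFin \o (fun x => bump s n x * f x)).
  move=> lf; apply: (@integrable_bounded_mul _ _ _ (n.+1%:R * C)) => //.
  exact: locally_integrable_sub lf (mB n) (subB n).
have E n : Rintegral mu setT (fun x => bump s n x * a x) - a s =
    Rintegral mu (Bn n) (fun x => bump s n x * (a x - a s)).
  have h1 : a s = Rintegral mu (Bn n) (fun x => bump s n x * a s).
    rewrite -toB -[LHS]mul1r -(bump_int s n).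
    rewrite -(@Rintegral_subset (Bn n)) // -?RintegralZr //; last first.
      by move=> x _ h; rewrite bump_supp // => /insB.
    have := iB n (fun=> 1) (locally_integrable_cst 1).
      by under eq_fun do rewrite /= mulr1.
  rewrite toB [X in _ - X = _]h1 -RintegralB //; [|exact: iB|exact/iB/locally_integrable_cst].
  by apply: eq_Rintegral => x _; rewrite mulrBr.
(* The 4 comes from the measure [4/(n+1)] of that ball. *)
have bnd n : `|Rintegral mu setT (fun x => bump s n x * a x) - a s| <=
    4 * C * fine (davg a s (e n)).
  rewrite E; apply: le_trans (le_normr_Rintegral _ (iB n _ la')) _ => //.
  apply: (@le_trans _ _ (Rintegral mu (Bn n) (fun x => n.+1%:R * C * `|a x - a s|))).
    apply: le_Rintegral => //.
    - by have := integrable_norm (iB n _ la').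
    - apply: (@integrable_bounded_mul (fun x => `|a x - a s|) (fun=> n.+1%:R * C) _ (`|n.+1%:R * C|)) => //.
      by apply: integrable_norm; exact: locally_integrable_sub la' (mB n) (subB n).
    - by move=> x _; rewrite normrM ler_wpM2r.
  have ia : mu.-integrable (Bn n) (EFin \o (fun x => `|a x - a s|)).
    by apply: integrable_norm; exact: locally_integrable_sub la' (mB n) (subB n).
  rewrite RintegralZl // /davg /iavg lebesgue_measure_ball; last exact: ltW.
  have en0 : e n *+ 2 != 0 by rewrite mulrn_eq0 /= gt_eqF.
  rewrite inver (negbTE en0) /Rintegral.
  have fi := integrable_fin_num (mB n) ia.
  rewrite fineM //= -mulrA (_ : n.+1%:R = 4 * (e n *+ 2)^-1).
    rewrite -/(Bn n); move: (fine _) (_^-1) => F q.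
    by rewrite (_ : 4 * q * (C * F) = 4 * C * (q * F)) //; ring.
  have n0 : n.+1%:R != 0 :> R by rewrite pnatr_eq0.
  by rewrite /e; move: (n.+1%:R : R) n0 => q q0; field.
apply/subr_cvg0/norm_cvg0P.
apply: (@squeeze_cvgr _ _ _ _ (fun=> 0) (fun n => 4 * C * fine (davg a s (e n)))).
- by apply: nearW => n; rewrite normr_ge0 bnd.
- exact: cvg_cst.
- rewrite -(mulr0 (4 * C)); apply: cvgM; first exact: cvg_cst.
  have /fine_cvgP[_ h] := lp.
  apply/cvgrPdist_lt => eps eps0; move: h => /cvgrPdist_lt/(_ eps eps0)[d /= d0 hd].
  have d20 : 0 < d / 2 by lra.
  have [N _ hN] := near_infty_natSinv_lt (PosNum d20); exists N => //= n /hN /= h1.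
  apply: hd => //=; rewrite sub0r normrN ger0_norm ?ltW // /e.
  by move: h1; rewrite ltr_pdivlMr // mulrC.
Qed.

Lemma test_fun_smooth I (phi : R -> R) (x y : R) : smooth_expr phi -> `[x, y]%classic `<=` I ->
  (forall t, ~ (x <= t <= y) -> phi t = 0) -> test_fun I phi.
Proof.
move=> sp sI p0; split; first exact: smooth_expr_derivable.
by exists `[x, y]%classic; split => //; exact: segment_compact.
Qed.

(* Test with smoothed indicators of [s, t] at Lebesgue points of [a]. *)
Lemma du_bois_reymond I a b (s t : R) : is_interval I -> open I ->
  locally_integrable setT a -> locally_integrable setT b ->
  (forall phi, test_fun I phi -> - Rintegral mu I (fun x => derive1 phi x * a x) =
     Rintegral mu I (fun x => phi x * b x)) ->
  I s -> I t -> s < t -> lebesgue_pt a s -> lebesgue_pt a t ->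
  a t - a s = Rintegral mu `]s, t] b.
Proof.
move=> itvI oI la lb hw Is It st ls lt_.
(* The bumps lie to the right of their base points, so the test functions overshoot [t]; [d] is the
   room for this inside [I]. *)
have [d d0 hd] : exists2 d : R, 0 < d & `[s, t + d] `<=` I.
  have /nbhs_ballP[d /= d0 hd] : nbhs t I by exact: open_nbhs_nbhs.
  exists (d / 2); first by lra.
  move=> x; rewrite /= in_itv /= => /andP[sx xt].
  have [xt'|xt'] := leP x t; first by apply: (itvI s t) => //; rewrite sx.
  by apply: hd; rewrite /ball /= ltr_norml; apply/andP; split; lra.
have [N _ hN] := near_infty_natSinv_lt (PosNum d0).
pose S (u : R) n x := step (n.+1%:R * x + - (n.+1%:R * u)).
have sS u n : smooth_expr (S u n) by apply: (SE_affine (f := @step R)); exact: smooth_step.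
pose phi n x := S s n x + -1 * S t n x.
have sphi n : smooth_expr (phi n) by apply: SE_add => //; exact: SE_scale.
have Sl u n x : x <= u -> S u n x = 0.
  by move=> xu; rewrite /S step_le0 // subr_le0 ler_pM2l.
have Sr u n x : u + n.+1%:R^-1 <= x -> S u n x = 1.
  move=> xu; rewrite /S step_ge1 // -mulrBr.
  by rewrite -[leLHS](@mulfV _ (n.+1%:R : R)) ?pnatr_eq0 // ler_pM2l // lerBrDl.
have dphi n : derive1 (phi n) = (fun x => bump s n x + - bump t n x).
  apply: is_derive_derive1 => x; apply: is_deriveD; first exact: bump_derive.
  have := is_deriveZ (-1) (bump_derive t n x).
  by rewrite /GRing.scale /= mulN1r.
have tphi0 n : (N <= n)%N -> forall x, ~ (s <= x <= t + d) -> phi n x = 0.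
  move=> /hN /= nd x hx.
  have i0 : 0 < n.+1%:R^-1 :> R by rewrite invr_gt0.
  have [xs|xs] := leP x s; first by rewrite /phi !Sl //; [ring|lra].
  have xt : t + d < x by rewrite ltNge; apply/negP => h; apply: hx; rewrite h ltW.
  by rewrite /phi !Sr; [ring|move: (n.+1%:R^-1) i0 nd => *; lra..].
have tphi n : (N <= n)%N -> test_fun I (phi n).
  by move=> Nn; apply: (@test_fun_smooth _ _ s (t + d)) => // x hx; exact: tphi0.
have [C C0 hC] := dstep_bound R.
have L1 : - Rintegral mu setT (fun x => derive1 (phi n) x * a x) @[n --> \oo] --> a t - a s.
  rewrite (_ : (fun n => _) = (fun n => Rintegral mu setT (fun x => bump t n x * a x) -
      Rintegral mu setT (fun x => bump s n x * a x))).
    by apply: cvgB; exact: bump_mollify.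
  apply/funext => n.
  have ib u : mu.-integrable setT (EFin \o (fun x => bump u n x * a x)).
    apply: (@integrable_supp `[u, u + n.+1%:R^-1]) => [|x h|].
    - exact: measurable_itv.
    - by rewrite bump_supp ?mul0r // => h'; apply: h; rewrite /= in_itv.
    - apply: (@integrable_bounded_mul _ _ _ (n.+1%:R * C)) => //.
      + by apply: continuous_measurable_fun; exact: smooth_expr_continuous (bump_smooth u n).
      + by move=> x _; rewrite /bump normrM ger0_norm // ler_wpM2l.
      + exact: locally_integrable_bounded.
  rewrite -RintegralB // -[LHS]mulN1r -RintegralZl //.
    by apply: eq_Rintegral => x _; rewrite dphi mulN1r mulrBl opprB.
  have h := integrableB measurableT (ib s) (ib t).
  by apply: eq_integrable h => // x _ /=; rewrite dphi mulrBl.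
have L2 : Rintegral mu setT (fun x => phi n x * b x) @[n --> \oo] --> Rintegral mu `]s, t] b.
  have mphi n : measurable_fun setT (phi n).
    by apply: continuous_measurable_fun; exact: smooth_expr_continuous.
  have phi2 n x : `|phi n x| <= 2.
    have /andP[h1 h2] := step_itv (n.+1%:R * x + - (n.+1%:R * s)).
    have /andP[h3 h4] := step_itv (n.+1%:R * x + - (n.+1%:R * t)).
    by rewrite /phi /S ler_norml; apply/andP; split; lra.
  have phi0 n x : ~ (s <= x <= t + 1) -> phi n x = 0.
    move=> hx; have i0 : n.+1%:R^-1 <= 1 :> R by rewrite invf_le1 // ler1n.
    have [xs|xs] := leP x s; first by rewrite /phi !Sl //; [ring|lra].
    have xt : t + 1 < x by rewrite ltNge; apply/negP => h; apply: hx; rewrite h ltW.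
    by rewrite /phi !Sr; [ring|move: (n.+1%:R^-1) i0 => *; lra..].
  pose K := `[s, t + 1]%classic.
  have mK : measurable (K : set (measurableTypeR R)) by exact: measurable_itv.
  have ibK : mu.-integrable K (EFin \o b) by exact: locally_integrable_bounded.
  pose f x := if x \in `]s, t]%classic then b x else 0.
  have -> : Rintegral mu `]s, t] b = Rintegral mu K f.
    rewrite -(@Rintegral_subset `]s, t]) //; last first.
    - by move=> x _ h; rewrite /f memNset.
    - by move=> x; rewrite /K /= !in_itv /= => /andP[*]; apply/andP; split; lra.
    by apply: eq_Rintegral => x xst; rewrite /f xst.
  rewrite (_ : (fun n => _) = (fun n => Rintegral mu K (fun x => phi n x * b x))); last first.
    apply/funext => n; apply/esym/Rintegral_subset => // x _ h.
    by rewrite phi0 ?mul0r // => h'; apply: h; rewrite /K /= in_itv.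
  apply: (@Rintegral_dominated K _ _ (fun x => 2 * b x)) => //.
  - by move=> n; apply: measurable_int (integrable_bounded_mul mK (mphi n) (fun x _ => phi2 n x) ibK).
  - have mf : measurable_fun setT (fun x => if x \in `]s, t]%classic then b x else 0).
      have [mb _ _] := lb.
      rewrite (_ : (fun x => _) = b \_ `]s, t]%classic); last first.
        by apply/funext => x; rewrite patchE.
      apply/(measurable_restrictT _ _).1; first exact: measurable_itv.
      exact: measurable_funTS.
    by apply/measurable_EFinP; exact: measurable_funTS.
  - move=> x _; have [xs|xs] := leP x s.
      rewrite /f memNset; last by rewrite /= in_itv /= ltNge xs.
      by apply: cvg_near_cst; apply: nearW => n; rewrite /phi !Sl //; [ring|lra].
    have xs0 : 0 < x - s by lra.
    have [N1 _ hN1] := near_infty_natSinv_lt (PosNum xs0).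
    have [xt|xt] := leP x t.
      rewrite /f mem_set; last by rewrite /= in_itv /= xs xt.
      apply: cvg_near_cst; exists N1 => // n /hN1 /= h1.
      by rewrite /phi (Sl t) // (Sr s); [ring|move: (n.+1%:R^-1) h1 => *; lra].
    have xt0 : 0 < x - t by lra.
    have [N2 _ hN2] := near_infty_natSinv_lt (PosNum xt0).
    rewrite /f memNset; last by rewrite /= in_itv /= leNgt xt andbF.
    apply: cvg_near_cst; exists N2 => // n /hN2 /= h1.
    by rewrite /phi !Sr; [ring|move: (n.+1%:R^-1) h1 => *; lra..].
  - by have := integrableZl mK 2 ibK.
  - by move=> n x _; rewrite !normrM ler_wpM2r // (ger0_norm (_ : 0 <= 2)).
have E n : (N <= n)%N -> - Rintegral mu setT (fun x => derive1 (phi n) x * a x) =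
    Rintegral mu setT (fun x => phi n x * b x).
  move=> Nn; have := hw _ (tphi n Nn).
  have out x : ~ I x -> ~ (s <= x <= t + d).
    by move=> nI h; apply: nI; apply: hd; rewrite /= in_itv.
  have nd := hN n Nn.
  rewrite !(@Rintegral_subset I setT) // => x _ /out nx.
    by rewrite (tphi0 n) ?mul0r.
  rewrite dphi !bump_supp ?oppr0 ?addr0 ?mul0r // => h; apply: nx;
    by move: (n.+1%:R^-1) nd h => /= q nd /andP[*]; apply/andP; split; lra.
apply: cvg_unique L2 => //; apply: cvg_trans L1; apply: near_eq_cvg.
by exists N => // n /E.
Qed.

Lemma weak_zero I b (s : R) : open I -> locally_integrable setT b ->
  (forall phi, test_fun I phi -> Rintegral mu I (fun x => phi x * b x) = 0) ->
  I s -> lebesgue_pt b s -> b s = 0.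
Proof.
move=> oI lb hw Is lp.
have /nbhs_ballP[d /= d0 hd] : nbhs s I by exact: open_nbhs_nbhs.
have [N _ hN] := near_infty_natSinv_lt (PosNum d0).
have L := bump_mollify lb lp.
apply: cvg_unique L _ => //; apply: cvg_near_cst; exists N => // n /hN /= nd.
have sI : `[s, s + n.+1%:R^-1]%classic `<=` I.
  move=> x; rewrite /= in_itv /= => /andP[sx xs]; apply: hd.
  rewrite /ball /= ltr_norml; move: (n.+1%:R^-1) nd xs => q *; apply/andP; split; lra.
have t0 x : ~ (s <= x <= s + n.+1%:R^-1) -> bump s n x = 0 by exact: bump_supp.
rewrite -(@Rintegral_subset I setT) //.
  by apply: hw; apply: test_fun_smooth sI t0; exact: bump_smooth.
move=> x _ nI; rewrite t0 ?mul0r // => h; apply: nI; apply: sI.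
by rewrite /= in_itv.
Qed.

End Weak.

(** * The evolution equation and integration by parts *)

Section Intervals.
Context (R : realType).
Notation mu := (@lebesgue_measure R).

Lemma integrable_addR (K : set R) (f g : R -> R) : measurable (K : set (measurableTypeR R)) ->
  mu.-integrable K (EFin \o f) -> mu.-integrable K (EFin \o g) ->
  mu.-integrable K (EFin \o (fun x => f x + g x)).
Proof. by move=> mK i1 i2; exact: (integrableD mK i1 i2). Qed.

Lemma integrable_subR (K : set R) (f g : R -> R) : measurable (K : set (measurableTypeR R)) ->
  mu.-integrable K (EFin \o f) -> mu.-integrable K (EFin \o g) ->
  mu.-integrable K (EFin \o (fun x => f x - g x)).
Proof. by move=> mK i1 i2; exact: (integrableB mK i1 i2). Qed.

Lemma integrable_scaleR (K : set R) (c : R) (f : R -> R) : measurable (K : set (measurableTypeR R)) ->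
  mu.-integrable K (EFin \o f) -> mu.-integrable K (EFin \o (fun x => c * f x)).
Proof. by move=> mK i1; exact: (integrableZl mK c i1). Qed.

Lemma ae_dense (E : set R) (x y : R) : {ae mu, forall t, `]x, y[%classic t -> E t} -> x < y ->
  exists2 m, E m & x < m < y.
Proof.
move=> [N [mN N0 sN]] xy; apply: contrapT => h.
have sub : `]x, y[%classic `<=` N.
  move=> m /= mxy; apply: sN => /= /(_ mxy) Em; apply: h; by exists m.
have : (mu `]x, y[%classic <= mu N)%E.
  by apply: le_measure => //; rewrite inE.
rewrite N0 lebesgue_measure_itv /= lte_fin xy -EFinB lee_fin; lra.
Qed.

(** An additive [F] bounded by length times an additive [M] gains a factor [2/3] at each
    subdivision. Division points must lie in [E], so the exact midpoint is replaced by some point of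
    the middle third. *)
Lemma bisection_zero (E : set R) (F M : R -> R -> R) :
  (forall s t, E s -> E t -> s < t -> exists2 m, E m & s + (t - s) / 3 < m < t - (t - s) / 3) ->
  (forall s m t, E s -> E m -> E t -> s < m -> m < t -> F s t = F s m + F m t) ->
  (forall s m t, E s -> E m -> E t -> s < m -> m < t -> M s t = M s m + M m t) ->
  (forall s t, E s -> E t -> s < t -> 0 <= M s t) ->
  (forall s t, E s -> E t -> s < t -> `|F s t| <= (t - s) * M s t) ->
  forall s t, E s -> E t -> s < t -> F s t = 0.
Proof.
move=> dE Fa Ma M0 h0.
have key n : forall s t, E s -> E t -> s < t -> `|F s t| <= (2 / 3) ^+ n * ((t - s) * M s t).
  elim: n => [|n IH] s t Es Et st; first by rewrite expr0 mul1r; exact: h0.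
  have [m Em /andP[h1 h2]] := dE s t Es Et st.
  have sm : s < m by lra.
  have mt : m < t by lra.
  rewrite (Fa s m t) //; apply: le_trans (ler_normD _ _) _.
  apply: le_trans (lerD (IH s m Es Em sm) (IH m t Em Et mt)) _.
  rewrite -mulrDr exprSr -mulrA ler_wpM2l ?exprn_ge0 ?divr_ge0 //.
  rewrite (Ma s m t) //; have := M0 _ _ Es Em sm; have := M0 _ _ Em Et mt.
  move: (M s m) (M m t) => a b a0 b0; nra.
move=> s t Es Et st; apply/eqP; rewrite -normr_le0; apply/ler_addgt0Pr => e e0; rewrite add0r.
have C0 : 0 <= (t - s) * M s t by rewrite mulr_ge0 ?M0 //; lra.
set C := (t - s) * M s t in C0.
have c : (2 / 3 : R) ^+ n @[n --> \oo] --> (0 : R).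
  by apply: cvg_expr; rewrite ger0_norm ?divr_ge0 //; lra.
have d0 : 0 < e / (C + 1) by rewrite divr_gt0 //; lra.
have [N _ hN] := (cvgrPdist_lt _ _).1 c _ d0.
have := hN N (leqnn N); rewrite /= sub0r normrN ger0_norm ?exprn_ge0 ?divr_ge0 //.
rewrite ltr_pdivlMr; last lra.
move=> h; apply: le_trans (key N s t Es Et st) _; rewrite -/C.
have : 0 <= (2 / 3 : R) ^+ N by rewrite exprn_ge0 // divr_ge0.
by move: ((2 / 3) ^+ N) h => q h q0; nra.
Qed.

End Intervals.

(** * Weak primitives, Green's formula and uniform continuity *)

Section Evolution.
Context (R : realType) (H : completeNormedModType R[i])
  (ip : {dot H for @Num.conj R[i]}).
Hypothesis H_norm : forall x : H, `|x| ^+ 2 = ip x x.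
Hypothesis H_separable : separable H.
Notation mu := (@lebesgue_measure R).
Local Notation rip := (rip ip).
Local Notation rdot := (rdot ip).
Local Notation sq_int := (sq_int ip).
Implicit Types (u h : R -> H) (E : set R).

Let mitv (s t : R) : measurable (`]s, t]%classic : set (measurableTypeR R)).
Proof. exact: measurable_itv. Qed.

Let finite_itv (s t : R) : (mu `]s, t]%classic < +oo)%E.
Proof. by rewrite lebesgue_measure_itv /=; case: ifP => // _; rewrite -EFinB ltry. Qed.

Let mu_itv (s t : R) : s < t -> fine (mu `]s, t]%classic) = t - s.
Proof. by move=> st; rewrite lebesgue_measure_itv /= lte_fin st -EFinB. Qed.

Section Fixed.
Variables (I : set R) (mI : measurable (I : set (measurableTypeR R))) (itvI : is_interval I).

Lemma sub_itv (s t : R) : I s -> I t -> `]s, t]%classic `<=` I.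
Proof.
move=> Is It x; rewrite /= in_itv /= => /andP[h1 h2]; apply: (itvI Is It).
by rewrite ltW.
Qed.

Lemma sq_int_itv u (s t : R) : I s -> I t -> sq_int I u -> sq_int `]s, t] u.
Proof. by move=> Is It; apply: sq_int_sub => //; exact: sub_itv. Qed.

Lemma Rintegral_itv_cat (f : R -> R) (s m t : R) : s < m -> m < t ->
  mu.-integrable `]s, t] (EFin \o f) ->
  Rintegral mu `]s, t] f = Rintegral mu `]s, m] f + Rintegral mu `]m, t] f.
Proof.
move=> sm mt i; have E : `]s, t]%classic = `]s, m] `|` `]m, t] :> set R.
  by rewrite -itv_bndbnd_setU // bnd_simp ltW.
rewrite E Rintegral_setU //; first by rewrite -E.
apply/disj_setPS => x [] /=; rewrite !in_itv /= => /andP[_ h1] /andP[h2 _]; lra.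
Qed.

Definition primitive E (x k : R -> H) : Prop :=
  forall s t, E s -> E t -> s < t -> forall y,
    rip (x t - x s) y = Rintegral mu `]s, t] (fun r => rip (k r) y).

(** The increment is tested against itself, and the integrand is split by the arithmetic-geometric
    inequality. *)
Lemma primitive_holder E x k : E `<=` I -> sq_int I k -> primitive E x k ->
  forall s t, E s -> E t -> s < t ->
  rip (x t - x s) (x t - x s) <= (t - s) * rdot `]s, t] k k.
Proof.
move=> EI hk px s t Es Et st; set y := x t - x s.
have kst := sq_int_itv (EI _ Es) (EI _ Et) hk.
have cst := sq_int_cst ip (mitv s t) y (finite_itv s t).
have L0 : 0 < t - s by lra.
have ikk := sq_int_rip H_norm (mitv s t) kst kst.
have iyy := sq_int_rip H_norm (mitv s t) cst cst.
suff : rip y y <= (t - s) / 2 * rdot `]s, t] k k + rip y y / 2 by lra.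
rewrite [X in X <= _](px s t Es Et st y).
(* The weights are such that the term in [rip y y] integrates to exactly half of the left-hand
   side. *)
apply: (@le_trans _ _ (Rintegral mu `]s, t] (fun r => (t - s) / 2 * rip (k r) (k r) + (2 * (t - s))^-1 * rip y y))).
  apply: le_Rintegral => //; first exact: sq_int_rip.
    by apply: integrable_addR => //; exact: integrable_scaleR.
  move=> r _; have := rip_le H_norm ((t - s)%:C *: k r) y; rewrite ripZl (ripZ_nsq H_norm).
  rewrite normrM (gtr0_norm L0) => h; have := ler_norm (rip (k r) y) => h2.
  rewrite -(ler_pM2l L0); apply: le_trans (ler_wpM2l (ltW L0) h2) _.
  apply: le_trans h _; rewrite le_eqVlt; apply/orP; left; apply/eqP.
  by field; rewrite gt_eqF.
rewrite RintegralD //; [|exact: integrable_scaleR|exact: integrable_scaleR].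
rewrite (RintegralZl _ (mitv s t) ikk) (Rintegral_cst mu (mitv s t)).
rewrite (_ : fine _ = t - s); last exact: mu_itv.
rewrite lerD2l le_eqVlt; apply/orP; left; apply/eqP.
by field; rewrite gt_eqF.
Qed.

Lemma rdot_itv_le k (s r t : R) : I s -> I t -> s <= r -> r < t -> sq_int I k ->
  rdot `]r, t] k k <= rdot `]s, t] k k.
Proof.
move=> Is It sr rt hk; have := sr; rewrite le_eqVlt => /predU1P[->//|{}sr].
have kst := sq_int_itv Is It hk.
rewrite /rdot [leRHS](Rintegral_itv_cat sr rt); last exact: sq_int_rip.
by rewrite lerDr; exact: rdot_ge0.
Qed.

Lemma rdot_itv_le2 k (s r t : R) : I s -> I t -> s < r -> r <= t -> sq_int I k ->
  rdot `]s, r] k k <= rdot `]s, t] k k.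
Proof.
move=> Is It sr rt hk; have := rt; rewrite le_eqVlt => /predU1P[->//|{}rt].
have kst := sq_int_itv Is It hk.
rewrite /rdot [leRHS](Rintegral_itv_cat sr rt); last exact: sq_int_rip.
by rewrite lerDl; exact: rdot_ge0.
Qed.

(** The product rule without differentiability: its defect [F] is additive, and by the Hölder bound
    it is at most [t - s] times the additive [M], so [bisection_zero] applies. *)
Lemma primitive_product E x k x' k' : E `<=` I -> {ae mu, forall t, I t -> E t} ->
  sq_int I x -> sq_int I k -> sq_int I x' -> sq_int I k' ->
  primitive E x k -> primitive E x' k' ->
  forall s t, E s -> E t -> s < t ->
  rip (x t) (x' t) - rip (x s) (x' s) =
    Rintegral mu `]s, t] (fun r => rip (k r) (x' r) + rip (x r) (k' r)).
Proof.
move=> EI aeE hx hk hx' hk' px px'.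
pose th r := rip (k r) (x' r) + rip (x r) (k' r).
pose F s t := rip (x t) (x' t) - rip (x s) (x' s) - Rintegral mu `]s, t] th.
pose M s t := rdot `]s, t] k k + rdot `]s, t] k' k'.
suff h : forall s t, E s -> E t -> s < t -> F s t = 0.
  by move=> s t Es Et st; apply/eqP; rewrite -subr_eq0; apply/eqP; exact: h.
have ith s t : E s -> E t -> mu.-integrable `]s, t] (EFin \o th).
  move=> /EI Is /EI It.
  have i1 := sq_int_rip H_norm (mitv s t) (sq_int_itv Is It hk) (sq_int_itv Is It hx').
  have i2 := sq_int_rip H_norm (mitv s t) (sq_int_itv Is It hx) (sq_int_itv Is It hk').
  exact: (integrableD (mitv s t) i1 i2).
apply: (@bisection_zero _ E F M).
- move=> s t Es Et st; apply: ae_dense; last lra.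
  apply: ae_mono aeE _ => r h hr; apply: h; apply: (itvI (EI _ Es) (EI _ Et)).
  by move: hr; rewrite /= in_itv /= => /andP[*]; apply/andP; split; lra.
- move=> s m t Es Em Et sm mt; rewrite /F (Rintegral_itv_cat sm mt); last exact: ith.
  by ring.
- move=> s m t /EI Is /EI Im /EI It sm mt; rewrite /M /rdot !(Rintegral_itv_cat sm mt); first by ring.
  + by apply: sq_int_rip => //; exact: sq_int_itv.
  + by apply: sq_int_rip => //; exact: sq_int_itv.
- by move=> s t _ _ _; rewrite addr_ge0 //; exact: rdot_ge0.
- move=> s t Es Et st; have Is := EI _ Es; have It := EI _ Et; set L := t - s.
  have L0 : 0 < L by rewrite /L; lra.
  have cx := sq_int_cst ip (mitv s t) (x s) (finite_itv s t).
  have cx' := sq_int_cst ip (mitv s t) (x' t) (finite_itv s t).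
  have k1 := sq_int_itv Is It hk; have k1' := sq_int_itv Is It hk'.
  have x1 := sq_int_itv Is It hx; have x1' := sq_int_itv Is It hx'.
  have d1' := sq_intB H_norm (mitv s t) cx' x1'; have d1 := sq_intB H_norm (mitv s t) cx x1.
  have i1 := sq_int_rip H_norm (mitv s t) k1 d1'.
  have i2 := sq_int_rip H_norm (mitv s t) d1 k1'.
  (* Testing one increment with [x' t] and the other with [x s] writes the defect through increments
     only, each small by [primitive_holder]. *)
  pose G r := rip (k r) (x' t - x' r) + rip (x s - x r) (k' r).
  have iG : mu.-integrable `]s, t] (EFin \o G) by exact: integrableD i1 i2.
  have -> : F s t = Rintegral mu `]s, t] G.
    have -> : F s t = rip (x t - x s) (x' t) + rip (x' t - x' s) (x s) - Rintegral mu `]s, t] th.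
      by rewrite /F ripBl (ripC ip (x' t - x' s)) ripBr; ring.
    rewrite px // px' // -RintegralD //; [|exact: sq_int_rip..].
    rewrite -RintegralB //; [|by apply: integrable_addR => //; exact: sq_int_rip|exact: ith].
    by apply: eq_Rintegral => r _; rewrite /G /th ripBr ripBl (ripC ip (k' r)); ring.
  apply: le_trans (le_normr_Rintegral (mitv s t) iG) _.
  have ikk := sq_int_rip H_norm (mitv s t) k1 k1.
  have ikk' := sq_int_rip H_norm (mitv s t) k1' k1'.
  pose Bd r := L / 2 * (rip (k r) (k r) + rip (k' r) (k' r)) + M s t / 2.
  have icst (c : R) : mu.-integrable `]s, t] (EFin \o (fun=> c)).
    apply/integrableP; split; first exact/measurable_EFinP/measurable_cst.
    by rewrite integral_cst //= lte_mul_pinfty // lee_fin.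
  have iBd : mu.-integrable `]s, t] (EFin \o Bd).
    by apply: integrable_addR => //; apply: integrable_scaleR => //; exact: integrable_addR.
  (* The Hölder bound is available only at points of [E], hence an almost-everywhere comparison. *)
  have bae : {ae mu, forall r, `]s, t]%classic r -> `|G r| <= Bd r}.
    apply: ae_mono aeE _ => r hE hr; have Ir := sub_itv Is It hr; have Er := hE Ir.
    move: hr; rewrite /= in_itv /= => /andP[sr rt].
    have b1 : rip (x s - x r) (x s - x r) <= L * rdot `]s, t] k k.
      rewrite nsqC //; apply: le_trans (primitive_holder EI hk px Es Er sr) _.
      apply: ler_pM; rewrite ?rdot_ge0 //; try (rewrite /L; lra).
      exact: rdot_itv_le2.
    have b2 : rip (x' t - x' r) (x' t - x' r) <= L * rdot `]s, t] k' k'.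
      have [->|rt'] := eqVneq r t; first by rewrite subrr rip0l mulr_ge0 ?rdot_ge0 // ltW.
      have {}rt : r < t by rewrite lt_def eq_sym rt'.
      apply: le_trans (primitive_holder EI hk' px' Er Et rt) _.
      apply: ler_pM; rewrite ?rdot_ge0 //; try (rewrite /L; lra).
      by apply: rdot_itv_le => //; exact: ltW.
    have am (p q : H) : `|rip p q| <= L / 2 * rip p p + (2 * L)^-1 * rip q q.
      have := rip_le H_norm (L%:C *: p) q; rewrite ripZl (ripZ_nsq H_norm) normrM (gtr0_norm L0) => h.
      rewrite -(ler_pM2l L0); apply: le_trans h _; rewrite le_eqVlt; apply/orP; left; apply/eqP.
      by field; rewrite gt_eqF.
    apply: le_trans (ler_normD _ _) _; apply: le_trans (lerD (am _ _) (_ : _ <= L / 2 * rip (k' r) (k' r) + (2 * L)^-1 * rip (x s - x r) (x s - x r))) _.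
      by rewrite ripC am.
    have L20 : 0 <= (2 * L)^-1 by rewrite invr_ge0 mulr_ge0 // ltW.
    have := ler_wpM2l L20 b1; have := ler_wpM2l L20 b2.
    rewrite !mulrA (_ : (2 * L)^-1 * L = 1 / 2); last by field; rewrite gt_eqF.
    rewrite /Bd /M; lra.
  apply: (@le_trans _ _ (Rintegral mu `]s, t] Bd)).
    have fG : (\int[mu]_(r in `]s, t]) (`|G r|)%:E \is a fin_num)%E.
      exact: integrable_fin_num (integrable_norm iG).
    have fB := integrable_fin_num (mitv s t) iBd.
    apply: fine_le => //; apply: ae_ge0_le_integral => //.
    + by apply: measurable_int (integrable_norm iG).
    + move=> r _; rewrite lee_fin /Bd addr_ge0 ?divr_ge0 ?addr_ge0 ?rdot_ge0 //.
      by rewrite mulr_ge0 //; [lra|rewrite addr_ge0 // nsq_ge0].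
    + exact: measurable_int iBd.
  rewrite RintegralD //; [|by apply: integrable_scaleR => //; exact: integrable_addR].
  rewrite RintegralZl //; last exact: integrable_addR.
  rewrite RintegralD // (Rintegral_cst mu (mitv s t)) (_ : fine _ = L); last exact: mu_itv.
  rewrite -/(rdot _ k k) -/(rdot _ k' k') -/(M s t).
  by rewrite le_eqVlt; apply/orP; left; apply/eqP; field.
Qed.


Section Skew.
Variables (D : set H) (B : H -> H).
Hypothesis sB : skew_adjoint ip D B.
Local Notation res := (res D B).

(** The equation [u' = B u + h], with [B] moved to the test vector by skewness. *)
Definition evolves E u h : Prop :=
  forall s t, E s -> E t -> s < t -> forall g, D g ->
    rip (u t) g - rip (u s) g = Rintegral mu `]s, t] (fun r => rip (h r) g - rip (u r) (B g)).

Lemma evolves_sub E E' u h : E' `<=` E -> evolves E u h -> evolves E' u h.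
Proof. by move=> sE eu s t /sE Es /sE Et; exact: eu. Qed.

Lemma sq_int_res (e : R) K u : measurable (K : set (measurableTypeR R)) -> e != 0 ->
  sq_int K u -> sq_int K (fun t => res e (u t)).
Proof.
move=> mK e0 hu.
have b t : K t -> rip (res e (u t)) (res e (u t)) <= 1 * rip (u t) (u t).
  by move=> _; rewrite mul1r; exact: (res_nsq H_norm sB).
apply: (sq_int_le H_norm mK hu _ b).
apply: (smeas_map (c := res e)) hu.1 => a x /cvg_rnormP ax; apply/cvg_rnormP => d d0.
have [N hN] := ax d d0; exists N => n /hN h.
rewrite -(resB H_norm sB) //; apply: le_lt_trans h.
rewrite -(@ler_pXn2r _ 2) ?nnegrE ?rnorm_ge0 // !(rnorm_sqr H_norm).
exact: (res_nsq H_norm sB).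
Qed.

(** Here [B (res e u) = e^-1 (res e u - u)] is bounded in [u], and [res (- e) y] is an admissible
    test vector for every [y]; so the regularised solution has a square-integrable derivative. *)
Lemma evolves_res E u h (e : R) : e != 0 -> E `<=` I -> sq_int I u -> sq_int I h ->
  evolves E u h -> primitive E (fun t => res e (u t))
    (fun t => res e (h t) + (e^-1)%:C *: (res e (u t) - u t)).
Proof.
move=> e0 EI hu hh eu s t Es Et st y.
have e0' : - e != 0 by rewrite oppr_eq0.
have [Dy _] := resP H_norm sB y e0'; have gy := res_gen H_norm sB y e0'.
have -> : rip (res e (u t) - res e (u s)) y = rip (u t) (res (- e) y) - rip (u s) (res (- e) y).
  by rewrite ripBl !(res_adj H_norm sB).
rewrite (eu s t Es Et st _ Dy); apply: eq_Rintegral => r _.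
rewrite ripDl ripZl ripBl !(res_adj H_norm sB) //; congr (_ + _).
rewrite -ripBr -gy ripZr; by field.
Qed.

Lemma evolves_resE E u h (e : R) : e != 0 -> evolves E u h ->
  evolves E (fun t => res e (u t)) (fun t => res e (h t)).
Proof.
move=> e0 eu s t Es Et st g Dg; have e0' : - e != 0 by rewrite oppr_eq0.
have [Dy _] := resP H_norm sB g e0'.
rewrite !(res_adj H_norm sB) // (eu s t Es Et st _ Dy); apply: eq_Rintegral => r _.
by rewrite !(res_adj H_norm sB) // (res_comm H_norm sB).
Qed.

Lemma evolvesB E u h u' h' : E `<=` I -> sq_int I u -> sq_int I h ->
  sq_int I u' -> sq_int I h' -> evolves E u h -> evolves E u' h' ->
  evolves E (fun t => u t - u' t) (fun t => h t - h' t).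
Proof.
move=> EI hu hh hu' hh' eu eu' s t Es Et st g Dg.
have c x := sq_int_cst ip (mitv s t) x (finite_itv s t).
have i v w : sq_int I v -> sq_int I w ->
    mu.-integrable `]s, t] (EFin \o (fun r => rip (v r) g - rip (w r) (B g))).
  move=> hv hw; apply: integrable_subR => //; apply: sq_int_rip => //; apply: sq_int_itv => //; exact: EI.
rewrite !ripBl (_ : _ - _ = (rip (u t) g - rip (u s) g) - (rip (u' t) g - rip (u' s) g)); last by ring.
rewrite eu // eu' // -RintegralB //; [|exact: i|exact: i].
by apply: eq_Rintegral => r _; rewrite !ripBl; ring.
Qed.

Lemma res_nsq_cvg x : rip (x - res n.+1%:R^-1 x) (x - res n.+1%:R^-1 x) @[n --> \oo] --> (0 : R).
Proof.
apply/cvgrPdist_lt => d d0; have [N hN] := res_lim H_norm sB x d0.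
by exists N => // n /hN; rewrite /= sub0r normrN ger0_norm ?nsq_ge0 // (nsqC H_norm).
Qed.

Lemma res_cvg x : res n.+1%:R^-1 x @[n --> \oo] --> x.
Proof.
apply/cvg_rnormP => d d0; have [N hN] := res_lim H_norm sB x (exprn_gt0 2 d0).
by exists N => n /hN; rewrite nsq_lt_rnorm.
Qed.

Let inv0 n : (n.+1%:R^-1 : R) != 0. Proof. by rewrite invr_eq0 pnatr_eq0. Qed.

Lemma green_ae E u h u' h' : E `<=` I -> {ae mu, forall t, I t -> E t} ->
  sq_int I u -> sq_int I h -> sq_int I u' -> sq_int I h' ->
  evolves E u h -> evolves E u' h' ->
  forall s t, E s -> E t -> s < t ->
  rip (u t) (u' t) - rip (u s) (u' s) =
    Rintegral mu `]s, t] (fun r => rip (h r) (u' r) + rip (u r) (h' r)).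
Proof.
move=> EI aeE hu hh hu' hh' eu eu' s t Es Et st.
pose e n : R := n.+1%:R^-1.
have key n : rip (res (e n) (u t)) (res (e n) (u' t)) - rip (res (e n) (u s)) (res (e n) (u' s)) =
   Rintegral mu `]s, t] (fun r => rip (res (e n) (h r)) (res (e n) (u' r)) + rip (res (e n) (u r)) (res (e n) (h' r))).
  have J v : sq_int I v -> sq_int I (fun t => res (e n) (v t)) by apply: sq_int_res => //; exact: inv0.
  have hk v w : sq_int I v -> sq_int I w ->
      sq_int I (fun t => res (e n) (w t) + ((e n)^-1)%:C *: (res (e n) (v t) - v t)).
    by move=> hv hw; apply: sq_intD => //; [exact: J|apply: sq_intZ => //; apply: sq_intB => //; exact: J].
  rewrite (@primitive_product E _ _ _ _ EI aeE (J _ hu) (hk _ _ hu hh) (J _ hu') (hk _ _ hu' hh')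
    (evolves_res (inv0 n) EI hu hh eu) (evolves_res (inv0 n) EI hu' hh' eu')) //.
  apply: eq_Rintegral => r _; rewrite ripDl ripDr ripZl ripZr.
  (* The singular terms [e^-1 (res e u - u)] are turned back into [B (res e u)] and cancel by
     skewness; the rest is bounded uniformly in [n]. *)
  rewrite -!(res_gen H_norm sB _ (inv0 n)) ripZl ripZr.
  have [Du _] := resP H_norm sB (u r) (inv0 n); have [Du' _] := resP H_norm sB (u' r) (inv0 n).
  rewrite (sa_skew sB) //; ring.
have L1 : rip (res (e n) (u t)) (res (e n) (u' t)) - rip (res (e n) (u s)) (res (e n) (u' s))
    @[n --> \oo] --> rip (u t) (u' t) - rip (u s) (u' s).
  by apply: cvgB; apply: rip_cvg => //; exact: res_cvg.
apply: cvg_unique L1 _ => //.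
rewrite (_ : (fun n => _) = (fun n => Rintegral mu `]s, t] (fun r => rip (res (e n) (h r)) (res (e n) (u' r)) + rip (res (e n) (u r)) (res (e n) (h' r))))); last first.
  by apply/funext => n; exact: key.
have st_ v : sq_int I v -> sq_int `]s, t] v by apply: sq_int_itv; exact: EI.
have su := st_ _ hu; have sh := st_ _ hh; have su' := st_ _ hu'; have sh' := st_ _ hh'.
have i v w : sq_int `]s, t] v -> sq_int `]s, t] w -> mu.-integrable `]s, t] (EFin \o (fun r => rip (v r) (w r))).
  by exact: sq_int_rip.
have J n v : sq_int `]s, t] v -> sq_int `]s, t] (fun t => res (e n) (v t)) by apply: sq_int_res => //; exact: inv0.
apply: (@Rintegral_dominated _ _ _ _ (fun r => (rip (h r) (h r) + rip (u' r) (u' r)) + (rip (u r) (u r) + rip (h' r) (h' r)))) => //.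
- move=> n; apply: measurable_int (integrable_addR _ (i _ _ (J n _ sh) (J n _ su')) (i _ _ (J n _ su) (J n _ sh'))) => //.
- by apply: measurable_int (integrable_addR _ (i _ _ sh su') (i _ _ su sh')).
- by move=> r _; apply: cvgD; apply: rip_cvg => //; exact: res_cvg.
- by apply: integrable_addR => //; apply: integrable_addR => //; exact: i.
- move=> n r _; have b v w : `|rip (res (e n) v) (res (e n) w)| <= rip v v + rip w w.
    have := rip_le H_norm (res (e n) v) (res (e n) w).
    have := res_nsq H_norm sB v (inv0 n); have := res_nsq H_norm sB w (inv0 n).
    have := nsq_ge0 H_norm v; have := nsq_ge0 H_norm w; rewrite -/(e n); lra.
  apply: le_trans (ler_normD _ _) _; apply: le_trans (lerD (b _ _) (b _ _)) _.
  exact: ler_norm.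
Qed.

Lemma rdot_res_cvg u : sq_int I u ->
  rdot I (fun t => u t - res n.+1%:R^-1 (u t)) (fun t => u t - res n.+1%:R^-1 (u t)) @[n --> \oo] --> (0 : R).
Proof.
move=> hu; have -> : (0 : R) = Rintegral mu I (fun=> 0) by rewrite Rintegral_cst // mul0r.
have J n : sq_int I (fun t => u t - res n.+1%:R^-1 (u t)).
  by apply: sq_intB => //; apply: sq_int_res.
apply: (@Rintegral_dominated _ _ _ _ (fun r => 4 * rip (u r) (u r))) => //.
- by move=> n; apply: measurable_int (sq_int_rip H_norm mI (J n) (J n)).
- exact/measurable_EFinP/measurable_cst.
- by move=> t _; exact: res_nsq_cvg.
- by apply: integrable_scaleR => //; exact: sq_int_rip.
- move=> n t _; rewrite !ger0_norm ?mulr_ge0 ?nsq_ge0 //.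
  apply: le_trans (nsqB_le H_norm _ _) _; have := res_nsq H_norm sB (u t) (inv0 n); lra.
Qed.

Lemma rdot_sub_le (K : set R) u : measurable (K : set (measurableTypeR R)) -> K `<=` I -> sq_int I u ->
  rdot K u u <= rdot I u u.
Proof.
move=> mK KI hu; have hK := sq_int_sub mI mK KI hu.
rewrite -lee_fin !EFin_rdot //; apply: ge0_subset_integral => //.
- exact: measurable_int (sq_int_rip H_norm mI hu hu).
- by move=> t _; rewrite lee_fin nsq_ge0.
Qed.

(** Green's formula for [u] with itself bounds all values by a single one and two norms over [I],
    regardless of the distance between the points. *)
Lemma evolves_bound E u h s t : E `<=` I -> {ae mu, forall t, I t -> E t} ->
  sq_int I u -> sq_int I h -> evolves E u h -> E s -> E t ->
  rip (u t) (u t) <= rip (u s) (u s) + rdot I h h + rdot I u u.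
Proof.
move=> EI aeE hu hh eu Es Et.
have bnd a b : E a -> E b -> a < b ->
    `|rip (u b) (u b) - rip (u a) (u a)| <= rdot I h h + rdot I u u.
  move=> Ea Eb ab; rewrite (green_ae EI aeE hu hh hu hh eu eu Ea Eb ab).
  have su := sq_int_itv (EI _ Ea) (EI _ Eb) hu; have sh := sq_int_itv (EI _ Ea) (EI _ Eb) hh.
  have i1 := sq_int_rip H_norm (mitv a b) sh su; have i2 := sq_int_rip H_norm (mitv a b) su sh.
  apply: le_trans (le_normr_Rintegral (mitv a b) (integrable_addR (mitv a b) i1 i2)) _.
  have ih := sq_int_rip H_norm (mitv a b) sh sh; have iu := sq_int_rip H_norm (mitv a b) su su.
  have sI := sub_itv (EI _ Ea) (EI _ Eb).
  apply: le_trans (lerD (rdot_sub_le (mitv a b) sI hh) (rdot_sub_le (mitv a b) sI hu)).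
  rewrite /rdot -RintegralD //; apply: le_Rintegral => //.
  - by apply: integrable_norm; exact: integrable_addR.
  - exact: integrable_addR.
  - move=> r _; apply: le_trans (ler_normD _ _) _.
    have := rip_le H_norm (h r) (u r); have := rip_le H_norm (u r) (h r); lra.
have [st|ts|->] := ltgtP s t.
- by have := bnd s t Es Et st; rewrite ler_norml => /andP[]; lra.
- by have := bnd t s Et Es ts; rewrite ler_norml => /andP[]; lra.
- by rewrite -addrA lerDl addr_ge0 ?rdot_ge0.
Qed.

(** [u - res e u] solves the equation with small data, so [evolves_bound] makes it small uniformly
    on [E]; the regularised part is Hölder continuous. *)
Lemma evolves_uniform E u h : E `<=` I -> {ae mu, forall t, I t -> E t} ->
  sq_int I u -> sq_int I h -> evolves E u h ->
  forall d : R, 0 < d -> exists2 c : R, 0 < c & forall s t, E s -> E t -> `|t - s| < c ->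
    rip (u t - u s) (u t - u s) < d.
Proof.
move=> EI aeE hu hh eu d d0.
have [[s0 Es0]|nE] := pselect (exists s, E s); last first.
  by exists 1 => // s t Es; case: nE; exists s.
have hB n v : sq_int I v -> sq_int I (fun t => v t - res n.+1%:R^-1 (v t)).
  by move=> hv; apply: sq_intB => //; apply: sq_int_res.
pose bd n := rip (u s0 - res n.+1%:R^-1 (u s0)) (u s0 - res n.+1%:R^-1 (u s0)) +
  rdot I (fun t => h t - res n.+1%:R^-1 (h t)) (fun t => h t - res n.+1%:R^-1 (h t)) +
  rdot I (fun t => u t - res n.+1%:R^-1 (u t)) (fun t => u t - res n.+1%:R^-1 (u t)).
have cb : bd n @[n --> \oo] --> (0 : R).
  rewrite (_ : 0 = 0 + 0 + 0 :> R); last by rewrite !addr0.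
  apply: cvgD; [apply: cvgD|]; [|exact: rdot_res_cvg|exact: rdot_res_cvg].
  exact: res_nsq_cvg.
(* Two errors [u - res e u] and one increment, each below [d / 16], add up to at most
   [2 * (2 * (d/16 + d/16) + d/16) < d]. *)
have d90 : 0 < d / 16 by lra.
have [n hn] : exists n, bd n < d / 16.
  have [N _ hN] := (cvgrPdist_lt _ _).1 cb _ d90; exists N.
  by have := hN N (leqnn N); rewrite /= sub0r normrN; apply: le_lt_trans; exact: ler_norm.
set e : R := n.+1%:R^-1 in bd cb hn *.
pose k t := res e (h t) + (e^-1)%:C *: (res e (u t) - u t).
have hk : sq_int I k.
  have J v : sq_int I v -> sq_int I (fun t => res e (v t)) by apply: sq_int_res => //; exact: inv0.
  by apply: sq_intD => //; [exact: J|apply: sq_intZ => //; apply: sq_intB => //; exact: J].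
have pr := evolves_res (inv0 n) EI hu hh eu.
have close t : E t -> rip (u t - res e (u t)) (u t - res e (u t)) < d / 16.
  move=> Et; apply: le_lt_trans hn; rewrite /bd.
  have J v : sq_int I v -> sq_int I (fun t => res e (v t)) by apply: sq_int_res => //; exact: inv0.
  exact: (evolves_bound EI aeE (hB n _ hu) (hB n _ hh)
    (evolvesB EI hu hh (J _ hu) (J _ hh) eu (evolves_resE (inv0 n) eu)) Es0 Et).
have kk0 := rdot_ge0 H_norm I k.
pose c := d / 16 / (rdot I k k + 1).
have c0 : 0 < c by rewrite divr_gt0 //; lra.
exists c => //.
have lem s t : E s -> E t -> s < t -> t - s < c -> rip (u t - u s) (u t - u s) < d.
  move=> Es Et st tsc; have := primitive_holder EI hk pr Es Et st.
  have := rdot_sub_le (mitv s t) (sub_itv (EI _ Es) (EI _ Et)) hk.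
  have := rdot_ge0 H_norm `]s, t] k.
  move: (rdot `]s, t] k k) => q q0 qk hh1.
  have b1 : rip (res e (u t) - res e (u s)) (res e (u t) - res e (u s)) < d / 16.
    apply: le_lt_trans hh1 _; move: tsc; rewrite /c ltr_pdivlMr; last lra.
    apply: le_lt_trans; apply: ler_pM => //; lra.
  have -> : u t - u s = ((u t - res e (u t)) - (u s - res e (u s))) + (res e (u t) - res e (u s)).
    by rewrite subACA subrK.
  apply: le_lt_trans (nsqD_le H_norm _ _) _.
  have := nsqB_le H_norm (u t - res e (u t)) (u s - res e (u s)).
  have := close _ Es; have := close _ Et; lra.
move=> s t Es Et; have [st|ts|->] := ltgtP s t.
- by rewrite gtr0_norm ?subr_gt0 //; exact: lem.
- by rewrite distrC gtr0_norm ?subr_gt0 // nsqC //; exact: lem.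
- by rewrite !subrr rip0l.
Qed.

End Skew.
End Fixed.
End Evolution.

(** * Weak solutions *)

Section TestFunctions.
Context (R : realType).
Notation mu := (@lebesgue_measure R).

Lemma test_fun_facts (I : set R) (phi : R -> R) : test_fun I phi ->
  [/\ forall x : R, is_derive x (1 : R) phi (derive1 phi x), continuous phi, continuous (derive1 phi) &
   exists x y : R, [/\ x <= y, forall t, ~ (x <= t <= y) -> phi t = 0 /\ derive1 phi t = 0 &
     forall t, ~ I t -> phi t = 0 /\ derive1 phi t = 0]].
Proof.
move=> [dphi [K [cK KI phi0]]].
have d1 x : is_derive x (1 : R) phi (derive1 phi x).
  by rewrite derive1E; apply: derivableP; exact: (dphi 0%N x).
have c0 : continuous phi by move=> x; exact: is_derive_continuous (d1 x).
have c1 : continuous (derive1 phi).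
  move=> x; apply: differentiable_continuous; apply/derivable1_diffP; exact: (dphi 1%N x).
have phi0' t : ~ K t -> derive1 phi t = 0.
  move=> Kt; apply: derive_near_cst (d1 t).
  have : open (~` K) by apply: closed_openC; apply: compact_closed => //; exact: Rhausdorff.
  move=> oK; have : \forall y \near t, (~` K) y by exact: open_nbhs_nbhs.
  by apply: filterS => y; exact: phi0.
split => //; have [M [_ hM]] := compact_bounded cK.
have bK t : K t -> `|t| <= `|M| + 1.
  by move=> Kt; apply: (hM (`|M| + 1)) => //; have := ler_norm M; lra.
exists (- (`|M| + 1)), (`|M| + 1); split.
- by have := normr_ge0 M; lra.
- move=> t ht; have Kt : ~ K t by move=> /bK; rewrite ler_norml.
  by split; [exact: phi0|exact: phi0'].
- move=> t It; have Kt : ~ K t by move=> /KI.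
  by split; [exact: phi0|exact: phi0'].
Qed.

Lemma derive_compact_support_int (I : set R) (phi psi : R -> R) :
  (forall x : R, is_derive x (1 : R) phi (derive1 phi x)) -> continuous phi -> continuous (derive1 phi) ->
  test_fun I psi ->
  Rintegral mu I (fun t => derive1 psi t * phi t + psi t * derive1 phi t) = 0.
Proof.
move=> dphi cphi cphi' /test_fun_facts[dpsi cpsi cpsi' [x [y [xy o1 o2]]]].
rewrite (@Rintegral_subset _ I setT) //; last first.
  by move=> t _ /o2[-> ->]; rewrite !mul0r addr0.
rewrite -(@Rintegral_subset _ `[x - 1, y + 1] setT) //; last first.
  move=> t _ ht; have [-> ->] : psi t = 0 /\ derive1 psi t = 0.
    apply: o1 => h; apply: ht; rewrite /= in_itv /=; lra.
  by rewrite !mul0r addr0.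
have dd t : is_derive t (1 : R) (fun r => psi r * phi r) (derive1 psi t * phi t + psi t * derive1 phi t).
  apply: is_derive_eq (is_deriveM (dpsi t) (dphi t)) _.
  by rewrite /GRing.scale /= addrC mulrC.
have cc t := is_derive_continuous (dd t).
have c1 : continuous (fun t : R => derive1 psi t * phi t) by move=> t; exact: cvgM (cpsi' t) (cphi t).
have c2 : continuous (fun t : R => psi t * derive1 phi t) by move=> t; exact: cvgM (cpsi t) (cphi' t).
have c12 : continuous (fun t : R => derive1 psi t * phi t + psi t * derive1 phi t).
  by move=> t; exact: cvgD (c1 t) (c2 t).
rewrite /Rintegral (@continuous_FTC2 _ _ (fun r => psi r * phi r)) /=.
- have [-> _] : psi (y + 1) = 0 /\ derive1 psi (y + 1) = 0 by apply: o1; lra.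
  have [-> _] : psi (x - 1) = 0 /\ derive1 psi (x - 1) = 0 by apply: o1; lra.
  by rewrite !mul0r subrr.
- lra.
- exact: continuous_subspaceT.
- split; first by move=> t _; have [] := dd t.
    by apply: cvg_at_right_filter; exact: cc.
  by apply: cvg_at_left_filter; exact: cc.
- by move=> t _; rewrite derive1E; have [_ ->] := dd t.
Qed.

(** A test function on the whole line with value 1 at the endpoint: its product with [g] has trace
    [g], which test functions inside [I] cannot give. *)
Definition plateau (a x : R) : R := step (1 * x + (2 - a)) * (step (-1 * x + (a + 2))).

Lemma plateau_test a : test_fun setT (plateau a).
Proof.
apply: (@test_fun_smooth _ _ _ (a - 2) (a + 2)) => //.
  by apply: SE_mul; apply: SE_affine; exact: smooth_step.
move=> t ht; have [h|h] := ltP t (a - 2); first by rewrite /plateau step_le0 ?mul0r //; lra.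
have h2 : a + 2 < t by rewrite ltNge; apply/negP => h2; apply: ht; rewrite h.
by rewrite /plateau mulrC step_le0 ?mul0r //; lra.
Qed.

Lemma plateau1 a : plateau a a = 1.
Proof. by rewrite /plateau !step_ge1 ?mulr1 //; lra. Qed.

End TestFunctions.

Section WeakSolutions.
Context (R : realType) (H : completeNormedModType R[i])
  (ip : {dot H for @Num.conj R[i]}).
Hypothesis H_norm : forall x : H, `|x| ^+ 2 = ip x x.
Hypothesis H_separable : separable H.
Notation mu := (@lebesgue_measure R).
Local Notation rip := (rip ip).
Local Notation rdot := (rdot ip).
Local Notation sq_int := (sq_int ip).
Local Notation L2mem := (@L2mem R H).
Implicit Types (u h : R -> H) (E : set R).

Definition tens (phi : R -> R) (g : H) (t : R) : H := (phi t)%:C *: g.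

Lemma sq_int_tens (K : set R) (phi : R -> R) (g : H) (x y : R) :
  measurable (K : set (measurableTypeR R)) -> continuous phi ->
  (forall t, ~ (x <= t <= y) -> phi t = 0) -> sq_int K (tens phi g).
Proof.
move=> mK cphi phi0; have mphi := continuous_measurable_fun cphi.
have rE (t : R) z : rip (tens phi g t - z) (tens phi g t - z) =
    phi t ^+ 2 * rip g g - 2 * rip g z * phi t + rip z z.
  by rewrite ripB_nsq // /tens ripZ_nsq // ripZl; ring.
split.
  apply: smeas_separable => // z.
  rewrite (_ : (fun t => _) = Num.sqrt \o (fun t => phi t ^+ 2 * rip g g - 2 * rip g z * phi t + rip z z)).
    apply: measurableT_comp.
      by apply: continuous_measurable_fun; exact: sqrt_continuous.
    apply: measurable_funD => //; apply: measurable_funB.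
      by apply: measurable_funM => //; exact: measurable_funX.
    by apply: measurable_funM.
  by apply/funext => t /=; rewrite -rE -(rnorm_sqr H_norm) sqrtr_sqr ger0_norm // rnorm_ge0.
have [C C0 hC] := @continuous_norm_bound _ phi x y cphi.
have hb t : `|phi t| <= C.
  by have [/hC//|/phi0 ->] := pselect (x <= t <= y); rewrite normr0.
have i0 : mu.-integrable `[x, y] (EFin \o (fun t => phi t ^+ 2 * rip g g)).
  apply: (@integrable_bounded_mul _ (fun=> rip g g) _ _ (C ^+ 2)) => //.
  - exact: measurable_funX.
  - by move=> t _; rewrite normrX lerXn2r ?nnegrE.
  - exact: locally_integrable_bounded (locally_integrable_cst (rip g g)).
have i1 : mu.-integrable setT (EFin \o (fun t => phi t ^+ 2 * rip g g)).
  by apply: integrable_supp i0 => // t ht; rewrite phi0 ?expr0n ?mul0r.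
rewrite (_ : EFin \o _ = EFin \o (fun t => phi t ^+ 2 * rip g g)).
  exact: integrableS i1.
by apply/funext => t /=; rewrite /tens ripZ_nsq.
Qed.

Section OnI.
Variables (I : set R).
Hypotheses (mI : measurable (I : set (measurableTypeR R))) (itvI : is_interval I) (oI : open I).
Variables (D : set H) (B : H -> H).
Hypothesis sB : skew_adjoint ip D B.

Let hL := real_hilbert_L2 H_norm H_separable mI.

(** The equation [u' = B u + h] in the sense of distributions, tested with the products [phi(t) g];
    no condition is imposed at the endpoint. *)
Definition weak_sol u h : Prop := [/\ L2mem I u, L2mem I h &
  forall phi, test_fun I phi -> forall g, D g ->
    - rdot I u (tens (derive1 phi) g) =
      rdot I h (tens phi g) - rdot I u (tens phi (B g))].

Lemma test_tens phi (J : set R) g : test_fun J phi ->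
  sq_int I (tens phi g) /\ sq_int I (tens (derive1 phi) g).
Proof.
move=> /test_fun_facts[_ c0 c1 [x [y [_ h _]]]].
split; apply: (@sq_int_tens _ _ _ x y) => // t /h[] //.
Qed.

Lemma test_tens_mem phi (J : set R) g : test_fun J phi ->
  L2mem I (tens phi g) /\ L2mem I (tens (derive1 phi) g).
Proof. by move=> /test_tens h; have [h1 h2] := h g; split; exact: (sq_int_L2mem H_norm). Qed.

Lemma weak_sol_ae u u' h h' : {ae mu, forall t, I t -> u t = u' t} ->
  {ae mu, forall t, I t -> h t = h' t} -> weak_sol u h -> weak_sol u' h'.
Proof.
move=> eu eh [mu_ mh w]; split; [exact: L2mem_ae eu mu_|exact: L2mem_ae eh mh|].
move=> phi tphi g Dg; have r v : {ae mu, forall t, I t -> v t = v t :> H} by exact: aeW.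
by rewrite -(rdot_ae ip eu (r _)) -(rdot_ae ip eh (r _)) -(rdot_ae ip eu (r _)) w.
Qed.

Lemma weak_solD u h u' h' : weak_sol u h -> weak_sol u' h' -> weak_sol (u + u') (h + h').
Proof.
move=> [mu_ mh w] [mu' mh' w']; split; [exact: (rhD hL)|exact: (rhD hL)|].
move=> phi tphi g Dg; have [t1 t2] := test_tens_mem g tphi; have [t3 _] := test_tens_mem (B g) tphi.
rewrite !(rh_Dl hL) // opprD w // w' //; ring.
Qed.

Lemma weak_solZ (r : R) u h : weak_sol u h -> weak_sol (r%:C *: u) (r%:C *: h).
Proof.
move=> [mu_ mh w]; split; [exact: (rhZ hL)|exact: (rhZ hL)|].
move=> phi tphi g Dg; have [t1 t2] := test_tens_mem g tphi; have [t3 _] := test_tens_mem (B g) tphi.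
rewrite !(rh_Zl hL) // -mulrN w //; ring.
Qed.

Lemma weak_sol0 : weak_sol 0 0.
Proof.
have h v : L2mem I v -> rdot I 0 v = 0.
  by move=> mv; have := rh_Zl hL 0 (rh0 hL) mv; rewrite scale0r mul0r.
split; [exact: (rh0 hL)|exact: (rh0 hL)|].
move=> phi tphi g Dg; have [t1 t2] := test_tens_mem g tphi; have [t3 _] := test_tens_mem (B g) tphi.
by rewrite (h _ t1) (h _ t2) (h _ t3) oppr0 addr0.
Qed.

Lemma rdot_i u v : L2mem I u -> L2mem I v -> rdot I ('i%C *: u) v = - rdot I u ('i%C *: v).
Proof.
move=> mu_ mv.
transitivity (Rintegral mu I (fun t => - rip (u t) ('i%C *: v t))).
  by apply: eq_Rintegral => t _; rewrite ripi_skew.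
have := rh_Zl hL (- 1) mu_ (_ : L2mem I ('i%C *: v)); rewrite mulN1r => <-; last exact: L2memZ.
by apply: eq_Rintegral => t _; rewrite ripZl mulN1r.
Qed.

Lemma weak_soli u h : weak_sol u h -> weak_sol ('i%C *: u) ('i%C *: h).
Proof.
move=> [mu_ mh w]; split; [exact: (rhZ hL)|exact: (rhZ hL)|].
move=> phi tphi g Dg; have [Di Bi] := sa_i sB Dg.
have it psi x : 'i%C *: tens psi x = tens psi ('i%C *: x).
  by apply/funext => t; rewrite /tens /= scalerA mulrC -scalerA.
have [t1 t2] := test_tens_mem g tphi; have [t3 _] := test_tens_mem (B g) tphi.
rewrite !rdot_i // !it -Bi; have := w _ tphi _ Di; lra.
Qed.

Lemma weak_sol_closed u h : L2mem I u -> L2mem I h ->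
  (forall e : R, 0 < e -> exists p : (R -> H) * (R -> H), [/\ weak_sol p.1 p.2,
     rdot I (u - p.1) (u - p.1) < e & rdot I (h - p.2) (h - p.2) < e]) -> weak_sol u h.
Proof.
move=> mu_ mh app; split => // phi tphi g Dg.
have [t1 t2] := test_tens_mem g tphi; have [t3 _] := test_tens_mem (B g) tphi.
apply/eqP; rewrite -subr_eq0 -normr_le0; apply/ler_addgt0Pr => e e0; rewrite add0r.
pose C := rdot I (tens phi g) (tens phi g) + rdot I (tens (derive1 phi) g) (tens (derive1 phi) g)
  + rdot I (tens phi (B g)) (tens phi (B g)) + 1.
have n1 := rh_ge0 hL t1; have n2 := rh_ge0 hL t2; have n3 := rh_ge0 hL t3.
have C1 : 1 <= C by rewrite /C; lra.
have d0 : 0 < (e / 3) ^+ 2 / C by rewrite divr_gt0 ?exprn_gt0 //; lra.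
have [[v k] [[mv mk w] hv hk]] := app _ d0; rewrite /= in mv mk w hv hk.
have b f t : L2mem I f -> L2mem I t -> rdot I t t <= C -> rdot I f f < (e / 3) ^+ 2 / C ->
    `|rdot I f t| <= e / 3.
  move=> mf mt tC fd; rewrite -(@ler_pXn2r _ 2) ?nnegrE //; last lra.
  rewrite real_normK ?num_real //; apply: le_trans (rh_CS hL mf mt) _.
  have f0 := rh_ge0 hL mf; have t0 := rh_ge0 hL mt.
  apply: le_trans (ler_wpM2l f0 tC) _; rewrite -ler_pdivlMr //; [exact: ltW|lra].
have -> : - rdot I u (tens (derive1 phi) g) - (rdot I h (tens phi g) - rdot I u (tens phi (B g))) =
   - rdot I (u - v) (tens (derive1 phi) g) + - rdot I (h - k) (tens phi g) + rdot I (u - v) (tens phi (B g)).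
  have := w _ tphi _ Dg; rewrite !(rh_Bl hL) //; lra.
apply: le_trans (ler_normD _ _) _; apply: le_trans (lerD (ler_normD _ _) (lexx _)) _.
rewrite !normrN; have muv := rhB hL mu_ mv; have mhk := rhB hL mh mk.
have := b _ _ muv t2 (_ : _ <= C) hv; have := b _ _ mhk t1 (_ : _ <= C) hk; have := b _ _ muv t3 (_ : _ <= C) hv.
move=> h1 h2 h3; have {}h1 := h1 ltac:(rewrite /C; lra); have {}h2 := h2 ltac:(rewrite /C; lra).
have {}h3 := h3 ltac:(rewrite /C; lra); lra.
Qed.

(** [phi] may be nonzero at the endpoint of [I]; only the test function [psi] has to vanish near it
    for the integration by parts. *)
Lemma weak_sol_tens phi g : test_fun setT phi -> D g ->
  weak_sol (tens phi g) (fun t => tens (derive1 phi) g t - tens phi (B g) t).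
Proof.
move=> tphi Dg; have [s1 s2] := test_tens g tphi; have [s3 _] := test_tens (B g) tphi.
have sh := sq_intB H_norm mI s2 s3.
split; [exact: (sq_int_L2mem H_norm)|exact: (sq_int_L2mem H_norm)|].
move=> psi tpsi g' Dg'; have [q1 q2] := test_tens g' tpsi; have [q3 _] := test_tens (B g') tpsi.
have [dphi c0 c1 _] := test_fun_facts tphi.
have := derive_compact_support_int dphi c0 c1 tpsi => h0.
apply/eqP; rewrite -subr_eq0 -opprB oppr_eq0 opprK; apply/eqP.
have i1 := sq_int_rip H_norm mI sh q1; have i2 := sq_int_rip H_norm mI s1 q3.
have i3 := sq_int_rip H_norm mI s1 q2.
rewrite /rdot -RintegralB // -RintegralD //; last exact: integrable_subR.
transitivity (Rintegral mu I (fun t => rip g g' * (derive1 psi t * phi t + psi t * derive1 phi t))).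
  apply: eq_Rintegral => t _; rewrite /tens ripBl !ripZl !ripZr (sa_skew sB) //; ring.
(* Integrability of the scalar factor is obtained by dividing by [rip g g'], so the value 0 is
   treated apart. *)
have [->|n0] := eqVneq (rip g g') 0.
  rewrite -[RHS](mul0r (Rintegral mu I (fun=> 0))) -RintegralZl //; last exact: integrable0.
  by apply: eq_Rintegral => t _; rewrite !mul0r.
rewrite RintegralZl ?h0 ?mulr0 //.
have := integrable_scaleR (rip g g')^-1 mI (integrable_addR mI i3 (integrable_subR mI i1 i2)).
apply: eq_integrable => // t _ /=; congr EFin.
rewrite /tens ripBl !ripZl !ripZr (sa_skew sB) //; by field.
Qed.

Lemma sq_int_setT v : sq_int I v -> (forall t, ~ I t -> v t = 0) -> sq_int setT v.
Proof.
move=> [sv iv] v0; split => //; apply: integrable_supp iv => // t /v0 ->.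
by rewrite rip0l.
Qed.

Lemma rip_locally_integrable v x : sq_int setT v -> locally_integrable setT (fun t => rip (v t) x).
Proof.
move=> sv; split; first exact: rip_meas sv.1 (smeas_cst x).
  exact: openT.
move=> K _ cK; have mK := compact_measurable cK.
have sK := sq_int_sub (measurableT : measurable (setT : set (measurableTypeR R))) mK (@subsetT _ K) sv.
have cst := sq_int_cst ip mK x (compact_finite_measure cK).
by have /integrableP[_] := sq_int_rip H_norm mK sK cst.
Qed.

Lemma cvg_nsq (a : nat -> H) (l : H) :
  (forall n, rip (l - a n) (l - a n) < n.+1%:R^-1) -> a n @[n --> \oo] --> l.
Proof.
move=> hl; apply/cvg_rnormP => e e0; have [N _ hN] := near_infty_natSinv_lt (PosNum (exprn_gt0 2 e0)).
exists N => // n /hN /= h; rewrite -(nsq_lt_rnorm H_norm) // nsqC //; exact: lt_trans (hl n) h.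
Qed.

(** Lebesgue points depend on the test vector; a countable graph-dense family gives one common set
    [E] of full measure. The identity at [g k] passes to every [g] in [D] by graph convergence and
    domination. *)
Lemma weak_sol_evolves u h : weak_sol u h -> exists u' h' E,
  [/\ sq_int I u' /\ sq_int I h', {ae mu, forall t, I t -> u t = u' t},
      {ae mu, forall t, I t -> h t = h' t}, E `<=` I /\ {ae mu, forall t, I t -> E t} &
      evolves ip D B E u' h'].
Proof.
move=> ws; have [mu_ mh _] := ws.
have [u' [su u0 eu]] := L2mem_rep H_norm mI mu_; have [h' [sh h0 eh]] := L2mem_rep H_norm mI mh.
have [_ _ w] := weak_sol_ae eu eh ws.
have [d dd] := separable_seq H_separable.
pose g k := res D B 1 (d k).
have Dg k : D (g k) by have [] := resP H_norm sB (d k) (oner_neq0 R).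
have suT := sq_int_setT su u0; have shT := sq_int_setT sh h0.
have li := rip_locally_integrable.
pose E := I `&` [set t | forall k, lebesgue_pt (fun t => rip (u' t) (g k)) t].
have aeE : {ae mu, forall t, I t -> E t}.
  have : {ae mu, forall t, forall k, lebesgue_pt (fun t => rip (u' t) (g k)) t}.
    by apply/ae_foralln => k; apply: lebesgue_differentiation; exact: li.
  by move=> hh; apply: ae_mono hh _ => t ht It; split.
have key s t k : E s -> E t -> s < t -> rip (u' t) (g k) - rip (u' s) (g k) =
    Rintegral mu `]s, t] (fun r => rip (h' r) (g k) - rip (u' r) (B (g k))).
  move=> [Is ls] [It lt_] st.
  apply: (@du_bois_reymond _ I (fun t => rip (u' t) (g k))) => //.
  - exact: li.
  - by apply: locally_integrableB; exact: li.
  - move=> phi tphi; have [q1 q2] := test_tens (g k) tphi; have [q3 _] := test_tens (B (g k)) tphi.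
    have := w _ tphi _ (Dg k).
    rewrite {2 3}/rdot -RintegralB //; [|exact: sq_int_rip..].
    move=> hw; transitivity (- rdot I u' (tens (derive1 phi) (g k))).
      by congr (- _); apply: eq_Rintegral => r _; rewrite /tens ripZr.
    by rewrite hw; apply: eq_Rintegral => r _; rewrite /tens !ripZr; ring.
exists u', h', E; split => //; first by split => // t [].
move=> s t Es Et st x Dx.
have /choice[k hk] n : exists k, let y := g k in
    rip (x - y) (x - y) < n.+1%:R^-1 /\ rip (B x - B y) (B x - B y) < n.+1%:R^-1.
  by apply: (sa_graph_dense H_norm sB dd Dx); rewrite invr_gt0.
have cg := cvg_nsq (fun n => (hk n).1).
have cB := cvg_nsq (fun n => (hk n).2).
have Lf : rip (u' t) (g (k n)) - rip (u' s) (g (k n)) @[n --> \oo] --> rip (u' t) x - rip (u' s) x.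
  by apply: cvgB; apply: rip_cvg => //; exact: cvg_cst.
apply: cvg_unique Lf _ => //.
rewrite (_ : (fun n => _) = (fun n => Rintegral mu `]s, t] (fun r => rip (h' r) (g (k n)) - rip (u' r) (B (g (k n)))))); last first.
  by apply/funext => n; exact: key.
have mst : measurable (`]s, t]%classic : set (measurableTypeR R)) by exact: measurable_itv.
have fst_ : (mu `]s, t]%classic < +oo)%E.
  by rewrite lebesgue_measure_itv /= lte_fin st -EFinB ltry.
have sub := sub_itv itvI Es.1 Et.1.
have s1 := sq_int_sub mI mst sub su; have s2 := sq_int_sub mI mst sub sh.
have c z := sq_int_cst ip mst z fst_.
have i v z : sq_int `]s, t] v -> mu.-integrable `]s, t] (EFin \o (fun r => rip (v r) z)).
  by move=> sv; exact: sq_int_rip sv (c z).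
pose C := 2 * rip x x + 2 * rip (B x) (B x) + 4.
have nb n (l : H) (a : nat -> H) : (forall n, rip (l - a n) (l - a n) < n.+1%:R^-1) -> rip (a n) (a n) <= 2 * rip l l + 2.
  move=> /(_ n) hl; have -> : a n = l - (l - a n) by rewrite opprB addrC subrK.
  apply: le_trans (nsqB_le H_norm _ _) _.
  have : n.+1%:R^-1 <= 1 :> R by rewrite invf_le1 // ler1n.
  by move: (n.+1%:R^-1) hl => q hl q1; lra.
apply: (@Rintegral_dominated _ _ _ _ (fun r => (rip (h' r) (h' r) + rip (u' r) (u' r)) + C)) => //.
- by move=> n; apply: measurable_int (integrable_subR mst (i _ _ s2) (i _ _ s1)).
- by apply: measurable_int (integrable_subR mst (i _ _ s2) (i _ _ s1)).
- by move=> r _; apply: cvgB; apply: rip_cvg => //; exact: cvg_cst.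
- apply: integrable_addR => //; first by apply: integrable_addR => //; exact: sq_int_rip.
  apply/integrableP; split; first exact/measurable_EFinP/measurable_cst.
  by rewrite integral_cst //= lte_mul_pinfty // lee_fin.
- move=> n r _; apply: le_trans (ler_normB _ _) _.
  have := rip_le H_norm (h' r) (g (k n)); have := rip_le H_norm (u' r) (B (g (k n))).
  have := nb n x _ (fun n => (hk n).1); have := nb n (B x) (fun n => B (g (k n))) (fun n => (hk n).2).
  have := nsq_ge0 H_norm (h' r); have := nsq_ge0 H_norm (u' r).
  have := nsq_ge0 H_norm x; have := nsq_ge0 H_norm (B x).
  move=> *; rewrite [leRHS]ger0_norm; rewrite /C; lra.
Qed.

(** The equation determines [h] from [u]. It is used for density of the domain: a vector orthogonal
    to the domain becomes such an [h]. *)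
Lemma weak_sol_zero h : weak_sol 0 h -> {ae mu, forall t, I t -> h t = 0}.
Proof.
move=> [_ mh w]; have [h' [sh h0 eh]] := L2mem_rep H_norm mI mh.
have [d dd] := separable_seq H_separable.
pose g k := res D B 1 (d k).
have Dg k : D (g k) by have [] := resP H_norm sB (d k) (oner_neq0 R).
have shT := sq_int_setT sh h0.
have ae1 : {ae mu, forall t, forall k, lebesgue_pt (fun t => rip (h' t) (g k)) t}.
  by apply/ae_foralln => k; apply: lebesgue_differentiation; exact: rip_locally_integrable.
have eh2 := eh; apply: ae_mono2 eh2 ae1 _ => t hh lp It; rewrite hh //.
have key k : rip (h' t) (g k) = 0.
  apply: (weak_zero oI (rip_locally_integrable _ shT) _ It (lp k)) => phi tphi.
  have := w _ tphi _ (Dg k); have [t1 t2] := test_tens_mem (g k) tphi; have [t3 _] := test_tens_mem (B (g k)) tphi.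
  have z v : L2mem I v -> rdot I 0 v = 0.
    by move=> mv; have := rh_Zl hL 0 (rh0 hL) mv; rewrite scale0r mul0r.
  rewrite (z _ t2) (z _ t3) oppr0 addr0 => /esym hw.
  have r v : {ae mu, forall t, I t -> v t = v t :> H} by exact: aeW.
  rewrite -hw (rdot_ae ip eh (r _)); apply: eq_Rintegral => x _; rewrite /tens ripZr //.
apply: (sa_orth0 H_norm sB) => x Dx.
have /choice[k hk] n : exists k, let y := g k in
    rip (x - y) (x - y) < n.+1%:R^-1 /\ rip (B x - B y) (B x - B y) < n.+1%:R^-1.
  by apply: (sa_graph_dense H_norm sB dd Dx); rewrite invr_gt0.
have cg := cvg_nsq (fun n => (hk n).1).
have L : rip (h' t) (g (k n)) @[n --> \oo] --> rip (h' t) x by apply: rip_cvg => //; exact: cvg_cst.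
rewrite (_ : (fun n => _) = fun=> 0) in L; last by apply/funext => n; exact: key.
by rewrite ripC //; apply: cvg_unique L (cvg_cst 0).
Qed.

End OnI.
End WeakSolutions.

(** * Traces at the endpoint of a half line *)

Section UniformExtension.
Context (R : realType) (H : completeNormedModType R[i])
  (ip : {dot H for @Num.conj R[i]}).
Hypothesis H_norm : forall x : H, `|x| ^+ 2 = ip x x.
Local Notation rip := (rip ip).

Definition adherent (E : set R) (t : R) : Prop :=
  forall c : R, 0 < c -> exists2 s, E s & `|s - t| < c.

(** The pair [d], [c] is quantified after [l], so that the same limit serves every modulus of
    continuity; the factor 4 comes from squaring the triangle inequality. *)
Lemma uniform_limit (E : set R) (u : R -> H) (t : R) : adherent E t ->
  (forall d : R, 0 < d -> exists2 c : R, 0 < c & forall s t, E s -> E t -> `|t - s| < c ->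
    rip (u t - u s) (u t - u s) < d) ->
  exists l, forall d c : R, 0 < d ->
    (forall s t, E s -> E t -> `|t - s| < c -> rip (u t - u s) (u t - u s) < d) ->
    forall s, E s -> `|s - t| < c -> rip (u s - l) (u s - l) <= 4 * d.
Proof.
move=> aE U.
have /choice[q hq] (n : nat) : exists q, E q /\ `|q - t| < n.+1%:R^-1.
  by have [|q Eq hq] := aE n.+1%:R^-1; [rewrite invr_gt0|exists q].
have near_t (c : R) : 0 < c -> exists N, forall n, (N <= n)%N -> `|q n - t| < c.
  move=> c0; have [N _ hN] := near_infty_natSinv_lt (PosNum c0).
  by exists N => n /hN /= h; apply: lt_trans (hq n).2 h.
have [l hl] : exists l, forall e : R, 0 < e -> exists N, forall n, (N <= n)%N -> rnorm (u (q n) - l) < e.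
  apply: rnorm_complete => e e0; have [c c0 hc] := U _ (exprn_gt0 2 e0).
  have [N hN] := near_t (c / 2) (divr_gt0 c0 (ltr0n _ 2)).
  exists N => m n Nm Nn; rewrite -(nsq_lt_rnorm H_norm) //; apply: hc; [exact: (hq n).1|exact: (hq m).1|].
  have -> : q m - q n = (q m - t) - (q n - t) by rewrite opprB addrA subrK.
  by apply: le_lt_trans (ler_normB _ _) _; have := hN _ Nm; have := hN _ Nn; lra.
exists l => d c d0 hc s Es st.
have [N1 hN1] := near_t (c - `|s - t|) ltac:(lra).
have [N2 hN2] := hl (Num.sqrt d) ltac:(by rewrite sqrtr_gt0).
pose n := maxn N1 N2.
have h1 := hN1 n (leq_maxl _ _); have := hN2 n (leq_maxr _ _).
have sq : Num.sqrt d ^+ 2 = d by rewrite sqr_sqrtr // ltW.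
rewrite -(nsq_lt_rnorm H_norm) ?sqrtr_gt0 // sq => h2.
have h3 : rip (u s - u (q n)) (u s - u (q n)) < d.
  apply: hc => //; first exact: (hq n).1.
  have -> : s - q n = (s - t) - (q n - t) by rewrite opprB addrA subrK.
  by apply: le_lt_trans (ler_normB _ _) _; lra.
have -> : u s - l = (u s - u (q n)) + (u (q n) - l) by rewrite addrA subrK.
apply: le_trans (nsqD_le H_norm _ _) _; lra.
Qed.

Lemma uniform_extension (E : set R) (u : R -> H) :
  (forall d : R, 0 < d -> exists2 c : R, 0 < c & forall s t, E s -> E t -> `|t - s| < c ->
    rip (u t - u s) (u t - u s) < d) ->
  exists w, (forall t, E t -> w t = u t) /\
    forall d : R, 0 < d -> exists2 c : R, 0 < c & forall s t, adherent E s -> adherent E t -> `|t - s| < c ->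
    rip (w t - w s) (w t - w s) < d.
Proof.
move=> U.
have /choice[w hw] t : exists l, adherent E t -> forall d c : R, 0 < d ->
    (forall s t, E s -> E t -> `|t - s| < c -> rip (u t - u s) (u t - u s) < d) ->
    forall s, E s -> `|s - t| < c -> rip (u s - l) (u s - l) <= 4 * d.
  have [h|h] := pselect (adherent E t); last by exists 0.
  by have [l hl] := uniform_limit h U; exists l.
exists w; split.
  move=> t Et; have aE : adherent E t by move=> c c0; exists t; rewrite // subrr normr0.
  apply/esym/eqP; rewrite -subr_eq0; apply/eqP/(nsq_eq0 H_norm)/eqP.
  rewrite eq_le nsq_ge0 // andbT; apply/ler_addgt0Pr => e e0; rewrite add0r.
  have d0 : 0 < e / 4 by lra.
  have [c c0 hc] := U _ d0; have := hw _ aE _ _ d0 hc _ Et; rewrite subrr normr0 => /(_ c0); lra.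
(* Both limits are compared with one value [u r], at a cost of at most
   [2 * (4 * d/20 + 4 * d/20) < d]. *)
move=> d d0; have d1 : 0 < d / 20 by lra.
have [c c0 hc] := U _ d1; exists (c / 2); first lra.
move=> s t aS aT st; have [r Er hr] := aS _ (divr_gt0 c0 (ltr0n _ 2)).
have h1 := hw _ aS _ _ d1 hc _ Er; have h2 := hw _ aT _ _ d1 hc _ Er.
have {}h1 := h1 ltac:(lra).
have {}h2 : rip (u r - w t) (u r - w t) <= 4 * (d / 20).
  apply: h2; have -> : r - t = (r - s) - (t - s) by rewrite opprB addrA subrK.
  by apply: le_lt_trans (ler_normB _ _) _; lra.
have -> : w t - w s = (u r - w s) - (u r - w t) by rewrite opprB addrACA subrr add0r addrC opprK || rewrite opprB [RHS]addrC addrA subrK.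
apply: le_lt_trans (nsqB_le H_norm _ _) _; lra.
Qed.

End UniformExtension.

Section HalfLine.
Context (R : realType).
Notation mu := (@lebesgue_measure R).

(* The half line with endpoint [a] on which the boundary term of an integration *)
(* by parts carries the sign [s].                                              *)
Definition half_line (I : set R) (a s : R) : Prop :=
  (I = `]-oo, a[%classic /\ s = 1) \/ (I = `]a, +oo[%classic /\ s = -1).

Section OnI.
Variables (I : set R) (a sg : R).
Hypothesis hI : half_line I a sg.

Lemma half_line_measurable : measurable (I : set (measurableTypeR R)).
Proof. by case: hI => -[-> _]; exact: measurable_itv. Qed.

Lemma half_line_open : open I.
Proof. by case: hI => -[-> _]; exact: interval_open. Qed.

Lemma half_line_interval : is_interval I.
Proof. by case: hI => -[-> _]; exact: interval_is_interval. Qed.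

Lemma half_line_end : ~ I a.
Proof. by case: hI => -[-> _]; rewrite /= in_itv /= ltxx. Qed.

Lemma half_line_sg : sg ^+ 2 = 1.
Proof. by case: hI => -[_ ->]; rewrite ?sqrrN expr1n. Qed.

Lemma half_line_adherent (E : set R) : {ae mu, forall t, I t -> E t} ->
  forall t, I t \/ t = a -> adherent (I `&` E) t.
Proof.
move=> aeE t It c c0.
suff [x [y [xy sub]]] : exists x y, x < y /\ `]x, y[%classic `<=` I `&` [set s | `|s - t| < c].
  have aeE' : {ae mu, forall s, `]x, y[%classic s -> E s}.
    by apply: ae_mono aeE _ => s h /sub[/h].
  by have [m Em mxy] := ae_dense aeE' xy; exists m; have [Im ] : (I `&` [set s | `|s - t| < c]) m by apply: sub; rewrite /= in_itv.
case: hI => -[IE _]; rewrite IE in It *; rewrite /= in_itv /= in It.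
- exists (t - c), t; split; first lra.
  by move=> s; rewrite /= !in_itv /= => /andP[h1 h2]; split; [lra|rewrite ltr_norml; apply/andP; split; lra].
- exists t, (t + c); split; first lra.
  by move=> s; rewrite /= !in_itv /= => /andP[h1 h2]; split; [lra|rewrite ltr_norml; apply/andP; split; lra].
Qed.

(** If [|G|] were at least [e] almost everywhere on [J K], its integral would be at least [e * K];
    the chosen [K] makes this one more than the whole integral. *)
Lemma small_far_value (E : set R) (G : R -> R) (J : R -> set R) :
  {ae mu, forall t, I t -> E t} ->
  (forall K : R, 0 < K -> [/\ measurable (J K : set (measurableTypeR R)), J K `<=` I & mu (J K) = K%:E]) ->
  mu.-integrable I (EFin \o G) ->
  forall e : R, 0 < e -> exists t K, [/\ E t, 0 < K, J K t & `|G t| < e].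
Proof.
move=> aeE hJ iG e e0; apply: contrapT => hn.
have mI := half_line_measurable.
have iN : mu.-integrable I (EFin \o (fun t => `|G t|)) by exact: integrable_norm iG.
pose S := Rintegral mu I (fun t => `|G t|).
have S0 : 0 <= S by apply: Rintegral_ge0.
pose K := (S + 1) / e; have K0 : 0 < K by rewrite divr_gt0 //; lra.
have [mJ JI muJ] := hJ _ K0.
have iJ := integrableS mI mJ JI iN.
have le1 : Rintegral mu (J K) (fun t => `|G t|) <= S.
  rewrite /S -lee_fin /Rintegral !fineK ?(integrable_fin_num _ iN) ?(integrable_fin_num _ iJ) //.
  by apply: ge0_subset_integral => //; exact: measurable_int iN.
have : e * K <= Rintegral mu (J K) (fun t => `|G t|).
  rewrite -lee_fin /Rintegral fineK ?(integrable_fin_num _ iJ) // EFinM -muJ -integral_cst //.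
  apply: ae_ge0_le_integral => //.
  - by move=> t _; rewrite lee_fin ltW.
  - exact: measurable_int iJ.
  - apply: ae_mono aeE _ => t h Jt; rewrite lee_fin leNgt; apply/negP => Gt.
    by apply: hn; exists t, K; split => //; exact/h/JI.
rewrite /K mulrC divfK ?gt_eqF //; lra.
Qed.

(** Endpoints for a limit over the whole half line: [p] tends to the finite end and [q] escapes to
    infinity through points where [G] is small. The last clause fixes the orientation that produces
    the sign in Green's formula. *)
Lemma approx_interval (E : set R) (G : R -> R) : {ae mu, forall t, I t -> E t} ->
  mu.-integrable I (EFin \o G) ->
  exists p q : nat -> R, [/\ forall n, [/\ I (p n), E (p n), `|p n - a| < n.+1%:R^-1, I (q n) & E (q n)],
    forall n, `|G (q n)| < n.+1%:R^-1,
    forall t, I t -> \forall n \near \oo, Num.min (p n) (q n) < t <= Num.max (p n) (q n) &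
    forall n, sg * (p n - q n) > 0].
Proof.
move=> aeE iG.
have n0 n : 0 < n.+1%:R^-1 :> R by rewrite invr_gt0.
have aE := half_line_adherent aeE (or_intror erefl).
have /choice[p hp] (n : nat) : exists p, [/\ I p, E p & `|p - a| < n.+1%:R^-1].
  by have [p [Ip Ep] h] := aE _ (n0 n); exists p.
(* At distance at least [n + 1] from [p n], which makes the intervals exhaust [I]. *)
pose far (n : nat) (K : R) : set R := if sg == 1 then `]p n - n.+1%:R - K, p n - n.+1%:R[%classic
  else `]p n + n.+1%:R, p n + n.+1%:R + K[%classic.
have hfar n (K : R) : 0 < K -> [/\ measurable (far n K : set (measurableTypeR R)), far n K `<=` I & mu (far n K) = K%:E].
  move=> K0; have [Ip _ _] := hp n; have n1 : 0 < n.+1%:R :> R by [].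
  rewrite /far; case: ifP => sg1; (split; first exact: measurable_itv).
  - case: hI => -[IE s]; last by move: sg1; rewrite s -subr_eq0; lra.
    by move: Ip; rewrite IE /= => + t; rewrite /= !in_itv /= => *; lra.
  - by rewrite lebesgue_measure_itv /= lte_fin ifT -?EFinB; [congr (_%:E); ring|lra].
  - case: hI => -[IE s]; first by rewrite s eqxx in sg1.
    by move: Ip; rewrite IE /= => + t; rewrite /= !in_itv /= => *; lra.
  - by rewrite lebesgue_measure_itv /= lte_fin ifT -?EFinB; [congr (_%:E); ring|lra].
have /choice[q hq] (n : nat) : exists q, [/\ E q, (exists2 K : R, 0 < K & far n K q) & `|G q| < n.+1%:R^-1].
  have [q [K [Eq K0 hK hG]]] := small_far_value aeE (hfar n) iG (n0 n).
  by exists q; split => //; exists K.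
have qp n : 0 < sg * (p n - q n) /\ n.+1%:R < `|p n - q n|.
  have [_ [K K0 fq] _] := hq n; have n1 : 0 < n.+1%:R :> R by [].
  move: fq; rewrite /far; case: ifP => sg1; rewrite /= in_itv /= => /andP[h1 h2].
    rewrite (eqP sg1) mul1r gtr0_norm; lra.
  case: hI => -[_ s]; first by rewrite s eqxx in sg1.
  rewrite s mulN1r ltr0_norm; lra.
exists p, q; split.
- move=> n; have [Ip Ep pa] := hp n; have [Eq [K K0 fq] _] := hq n; split => //.
  by have [_ h _] := hfar n K K0; exact: h.
- by move=> n; have [] := hq n.
- move=> t It.
  have at0 : 0 < `|a - t| by rewrite normr_gt0 subr_eq0; apply/eqP => e; case: (half_line_end); rewrite e.
  have at1 : 0 < (`|a - t| + 1)^-1 by rewrite invr_gt0; lra.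
  have [N1 _ hN1] := near_infty_natSinv_lt (PosNum at0).
  have [N2 _ hN2] := near_infty_natSinv_lt (PosNum at1).
  exists (maxn N1 N2) => // n /=; rewrite geq_max => /andP[/hN1 /= k1 /hN2 /= k2].
  have [Ip _ pa] := hp n; have [sp fp] := qp n.
  have b0 : 0 < `|a - t| + 1 by lra.
  have n1 : `|a - t| + 1 < n.+1%:R by rewrite -ltf_pV2 ?posrE.
  have inv1 : n.+1%:R^-1 <= 1 :> R by rewrite invf_le1 // ler1n.
  move: (n.+1%:R : R) (n.+1%:R^-1 : R) k1 k2 pa fp n1 inv1 => m m' k1 k2 pa fp n1 inv1.
  move: pa; rewrite ltr_norml => /andP[pa1 pa2].
  case: hI => -[IE s]; move: sp fp k1 n1 It; rewrite s ?mul1r ?mulN1r IE /= in_itv /= => sp + + + ta.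
  - rewrite !gtr0_norm; [|lra..] => *; rewrite min_r ?max_l; lra.
  - rewrite !ltr0_norm; [|lra..] => *; rewrite min_l ?max_r; lra.
- by move=> n; have [] := qp n.
Qed.

End OnI.
End HalfLine.

Section Trace.
Context (R : realType) (H : completeNormedModType R[i])
  (ip : {dot H for @Num.conj R[i]}).
Hypothesis H_norm : forall x : H, `|x| ^+ 2 = ip x x.
Hypothesis H_separable : separable H.
Notation mu := (@lebesgue_measure R).
Local Notation rip := (rip ip).
Local Notation rdot := (rdot ip).
Implicit Types (u h : R -> H) (E : set R).

Variables (I : set R) (a sg : R).
Hypothesis hI : half_line I a sg.
Let mI := half_line_measurable hI.
Let itvI := half_line_interval hI.
Let oI := half_line_open hI.

(** A limit along a set of full measure, hence invariant under changes almost everywhere, with no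
    continuous representative to choose. *)
Definition trace u (x : H) : Prop := exists2 E : set R, {ae mu, forall t, I t -> E t} &
  forall e : R, 0 < e -> exists2 c : R, 0 < c & forall t, I t -> E t -> `|t - a| < c ->
    rip (u t - x) (u t - x) < e.

Lemma trace_ae u v x : {ae mu, forall t, I t -> u t = v t} -> trace u x -> trace v x.
Proof.
move=> uv [E aeE hE]; exists (E `&` [set t | u t = v t]).
  by apply: ae_mono2 aeE uv _ => t h1 h2 It; split; [exact: h1|exact: h2].
by move=> e /hE[c c0 hc]; exists c => // t It [Et <-]; exact: hc.
Qed.

Lemma traceD u v x y : trace u x -> trace v y -> trace (u + v) (x + y).
Proof.
move=> [E aeE hE] [E' aeE' hE']; exists (E `&` E').
  by apply: ae_mono2 aeE aeE' _ => t h1 h2 It; split; [exact: h1|exact: h2].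
move=> e e0; have d0 : 0 < e / 4 by lra.
have [c c0 hc] := hE _ d0; have [c' c0' hc'] := hE' _ d0.
exists (Num.min c c'); first by rewrite lt_min c0.
move=> t It [Et Et']; rewrite lt_min => /andP[h1 h2].
rewrite [(u + v) t]/(u t + v t) opprD addrACA; apply: le_lt_trans (nsqD_le H_norm _ _) _.
have := hc _ It Et h1; have := hc' _ It Et' h2; lra.
Qed.

Lemma traceZ (z : R[i]) u x : trace u x -> trace (z *: u) (z *: x).
Proof.
move=> [E aeE hE]; exists E => // e e0; pose K := rnorm (z : R[i]^o) ^+ 2 + 1.
have K0 : 0 < K by rewrite /K ltr_wpDl ?sqr_ge0.
have [c c0 hc] := hE _ (divr_gt0 e0 K0); exists c => // t It Et ta.
rewrite [(z *: u) t]/(z *: u t) -scalerBr rnorm_scale_le //.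
have := hc _ It Et ta; rewrite ltr_pdivlMr // mulrC => h; apply: le_lt_trans h.
by apply: ler_wpM2r; [exact: nsq_ge0|rewrite /K; lra].
Qed.

Lemma trace_uniq u x y : trace u x -> trace u y -> x = y.
Proof.
move=> hx hy; have [E aeE hE] := traceD hx (traceZ (-1) hy).
apply/eqP; rewrite -subr_eq0; apply/eqP/(nsq_eq0 H_norm)/eqP.
rewrite eq_le nsq_ge0 // andbT leNgt; apply/negP => e0.
have [c c0 hc] := hE _ e0; have [t [It Et] ta] := half_line_adherent hI aeE (or_intror erefl) c0.
have := hc _ It Et ta; have -> : (u + -1 *: u) t = 0 by rewrite -[LHS]/(u t + -1 *: u t) scaleN1r subrr.
rewrite scaleN1r.
by rewrite sub0r ripNl ripNr opprK ltxx.
Qed.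

Lemma trace_tens (phi : R -> R) g : continuous phi -> trace (tens phi g) ((phi a)%:C *: g).
Proof.
move=> cphi; exists setT; first exact: aeW.
move=> e e0; pose K := rip g g + 1; have K0 : 0 < K by rewrite /K; have := nsq_ge0 H_norm g; lra.
have d0 : 0 < Num.sqrt (e / K) by rewrite sqrtr_gt0 divr_gt0.
have /cvgrPdist_lt/(_ _ d0) := cphi a.
move=> /nbhs_ballP[c /= c0 hc]; exists c => // t It _ ta.
rewrite /tens -scalerBl -rmorphB ripZ_nsq //.
have {hc} : `|phi a - phi t| < Num.sqrt (e / K) by apply: hc; rewrite /ball /= distrC.
rewrite distrC -(@ltr_pXn2r _ 2) ?nnegrE ?sqrtr_ge0 // real_normK ?num_real // sqr_sqrtr; last first.
  by apply: ltW; rewrite divr_gt0.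
rewrite ltr_pdivlMr // => h; apply: le_lt_trans h; apply: ler_wpM2l; first exact: sqr_ge0.
by rewrite /K; lra.
Qed.

Lemma boundary_trace u x : boundary_value I a u x -> trace u x.
Proof.
move=> [w [uw cw <-]]; apply: (@trace_ae w); first by apply: ae_mono uw _ => t h /h.
exists setT; first exact: aeW.
move=> e e0; have /subspace_continuousP/(_ a (or_intror erefl)) := cw.
have s0 : 0 < Num.sqrt e by rewrite sqrtr_gt0.
have s1 : 0 < (Num.sqrt e)%:C by rewrite ltcR.
move=> /cvgrPdist_lt/(_ _ s1) /nbhs_ballP[c /= c0 hc]; exists c => // t It _ ta.
have : `|w a - w t| < (Num.sqrt e)%:C by apply: hc; [rewrite /ball /= distrC|left].
rewrite normE ltcR rnormC -(nsq_lt_rnorm H_norm) // sqr_sqrtr //; exact: ltW.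
Qed.

Variables (D : set H) (B : H -> H).
Hypothesis sB : skew_adjoint ip D B.
Local Notation weak_sol := (weak_sol ip I D B).

Lemma weak_sol_extension u h : weak_sol u h -> exists w,
  [/\ {ae mu, forall t, I t -> u t = w t}, {within I `|` [set a], continuous w} & trace u (w a)].
Proof.
move=> ws; have [u' [h' [E [[su sh] eu eh [EI aeE] ev]]]] := weak_sol_evolves H_norm H_separable mI itvI oI sB ws.
have U := evolves_uniform H_norm mI itvI sB EI aeE su sh ev.
have [w [wu wc]] := uniform_extension H_norm U.
have ad t : I t \/ t = a -> adherent E t.
  by move=> It c c0; have [s [_ Es] hs] := half_line_adherent hI aeE It c0; exists s.
have uw : {ae mu, forall t, I t -> u t = w t}.
  by apply: ae_mono2 eu aeE _ => t h1 h2 It; rewrite h1 // wu //; exact: h2.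
exists w; split => //.
  apply/subspace_continuousP => t It; apply/cvgrPdist_lt => e /gt0_realc[r r0 ->].
  have [c c0 hc] := wc _ (exprn_gt0 2 r0); apply/nbhs_ballP; exists c => //= s; rewrite /ball /= => ts Is.
  rewrite normE ltcR -(nsq_lt_rnorm H_norm) //; apply: hc => //; exact: ad.
apply: (@trace_ae w); first by apply: ae_mono uw _ => t ht /ht.
exists setT; first exact: aeW.
move=> e e0; have [c c0 hc] := wc _ e0; exists c => // t It _ ta.
by apply: hc => //; apply: ad; [right|left].
Qed.

Lemma trace_exists u h : weak_sol u h -> exists x, trace u x.
Proof. by move=> /weak_sol_extension[w [_ _ hw]]; exists (w a). Qed.

Lemma trace_boundary u h x : weak_sol u h -> trace u x -> boundary_value I a u x.
Proof.
by move=> /weak_sol_extension[w [uw cw hw]] hx; exists w; split => //; exact: trace_uniq hw hx.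
Qed.

(** [green_ae] between [p n] and [q n]: the near end gives the traces, the far end vanishes because
    the product of the solutions is integrable, and the integrals converge by domination. *)
Lemma green_trace u h u' h' x x' : weak_sol u h -> weak_sol u' h' -> trace u x -> trace u' x' ->
  sg * rip x x' = rdot I h u' + rdot I u h'.
Proof.
move=> ws ws' tx tx'.
have [v [k [E [[sv sk] ev ek [EI aeE] evo]]]] := weak_sol_evolves H_norm H_separable mI itvI oI sB ws.
have [v' [k' [E' [[sv' sk'] ev' ek' [EI' aeE'] evo']]]] := weak_sol_evolves H_norm H_separable mI itvI oI sB ws'.
rewrite (rdot_ae ip ek ev') (rdot_ae ip ev ek').
have [Ex aeEx hEx] := trace_ae ev tx; have [Ex' aeEx' hEx'] := trace_ae ev' tx'.
pose F := (E `&` E') `&` (Ex `&` Ex').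
have aeF : {ae mu, forall t, I t -> F t}.
  have h1 : {ae mu, forall t, I t -> (E `&` E') t}.
    by apply: ae_mono2 aeE aeE' _ => t h1 h2 It; split; [exact: h1|exact: h2].
  have h2 : {ae mu, forall t, I t -> (Ex `&` Ex') t}.
    by apply: ae_mono2 aeEx aeEx' _ => t q1 q2 It; split; [exact: q1|exact: q2].
  by apply: ae_mono2 h1 h2 _ => t q1 q2 It; split; [exact: q1|exact: q2].
have FI : F `<=` I by move=> t [[/EI]].
have FE : F `<=` E by move=> t [[]].
have FE' : F `<=` E' by move=> t [[]].
have gr := green_ae H_norm mI itvI sB FI aeF sv sk sv' sk' (evolves_sub FE evo) (evolves_sub FE' evo').
pose G t := rip (v t) (v' t); pose f r := rip (k r) (v' r) + rip (v r) (k' r).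
have iG : mu.-integrable I (EFin \o G) by exact: sq_int_rip.
have i1 := sq_int_rip H_norm mI sk sv'; have i2 := sq_int_rip H_norm mI sv sk'.
have if_ : mu.-integrable I (EFin \o f) by exact: integrable_addR.
have [p [q [hpq Gq lim sgpq]]] := approx_interval hI aeF iG.
pose J n : set R := `]Num.min (p n) (q n), Num.max (p n) (q n)]%classic.
pose fn n r := f r * \1_(J n) r.
have J1 n t : \1_(J n) t = if Num.min (p n) (q n) < t <= Num.max (p n) (q n) then 1 else 0 :> R.
  by rewrite indicE mem_setE /= in_itv /=; case: ifP.
have mf : measurable_fun I f by have /measurable_EFinP := measurable_int _ if_.
have L1 : Rintegral mu I (fn n) @[n --> \oo] --> Rintegral mu I f.
  apply: (@Rintegral_dominated _ _ _ _ f) => //.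
  - move=> n; apply/measurable_EFinP; apply: measurable_funM => //.
    by apply: measurable_funTS; apply: measurable_indic; exact: measurable_itv.
  - exact/measurable_EFinP.
  - move=> t It; apply: cvg_near_cst; apply: filterS (lim t It) => n hn.
    by rewrite /fn J1 hn mulr1.
  - move=> n t It; rewrite /fn J1; case: ifP => _; rewrite ?mulr1 // mulr0 normr0 normr_ge0 //.
have E1 n : Rintegral mu I (fn n) = sg * (G (p n) - G (q n)).
  have [Ip Fp _ Iq Fq] := hpq n.
  have JI : J n `<=` I.
    rewrite /J; case: (ltP (p n) (q n)) => _; exact: sub_itv.
  rewrite -(@Rintegral_subset _ (J n) I) //; last first.
    by move=> t It nJ; rewrite /fn indicE memNset // mulr0.
  transitivity (Rintegral mu (J n) f).
    by apply: eq_Rintegral => t Jt; rewrite /fn indicE Jt mulr1.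
  move: (sgpq n); case: hI => -[_ ->]; rewrite ?mul1r ?mulN1r => hn.
    have qp : q n < p n by lra.
    by rewrite /J min_r ?max_l ?(ltW qp) // -(gr _ _ Fq Fp qp).
  have pq : p n < q n by lra.
  by rewrite /J min_l ?max_r ?(ltW pq) // -(gr _ _ Fp Fq pq) opprB.
have cv w y Ew : (forall n, Ew (p n)) -> (forall e : R, 0 < e -> exists2 c : R, 0 < c & forall t, I t -> Ew t -> `|t - a| < c ->
    rip (w t - y) (w t - y) < e) -> w (p n) @[n --> \oo] --> y.
  move=> hw hE; apply/cvg_rnormP => e e0; have [c c0 hc] := hE _ (exprn_gt0 2 e0).
  have [N _ hN] := near_infty_natSinv_lt (PosNum c0); exists N => n /hN /= nc.
  have [Ip _ pa _ _] := hpq n.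
  rewrite -(nsq_lt_rnorm H_norm) //; apply: hc => //; exact: lt_trans pa nc.
have c1 : v (p n) @[n --> \oo] --> x by apply: cv hEx => n; have [_ [_ []]] := hpq n.
have c2 : v' (p n) @[n --> \oo] --> x' by apply: cv hEx' => n; have [_ [_ []]] := hpq n.
have c3 : G (p n) @[n --> \oo] --> rip x x' by exact: rip_cvg.
have c4 : G (q n) @[n --> \oo] --> (0 : R).
  apply/cvgrPdist_lt => e e0; have [N _ hN] := near_infty_natSinv_lt (PosNum e0).
  by exists N => // n /hN /= hn; rewrite sub0r normrN; exact: lt_trans (Gq n) hn.
have L2 : sg * (G (p n) - G (q n)) @[n --> \oo] --> sg * (rip x x' - 0).
  by apply: cvgM; [exact: cvg_cst|exact: cvgB].
rewrite subr0 in L2; rewrite (_ : (fun n => _) = (fun n => Rintegral mu I (fn n))) in L2; last first.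
  by apply/funext => n; rewrite E1.
rewrite (cvg_unique _ L2 L1) // /rdot -RintegralD //.
Qed.

(** Green's formula for [u] with itself. It makes the trace continuous for the graph norm. *)
Lemma trace_bound u h x : weak_sol u h -> trace u x -> rip x x <= rdot I u u + rdot I h h.
Proof.
move=> ws tx; have [mu_ mh _] := ws; have hL := real_hilbert_L2 H_norm H_separable mI.
have E := green_trace ws ws tx tx; have := rh_dot_le hL mh mu_; rewrite ler_norml => /andP[h1 h2].
have := nsq_ge0 H_norm x; rewrite (rdotC ip I u h) in E.
case: hI E => -[_ ->]; lra.
Qed.

End Trace.

(** * Bochner integrals and the negative space *)

Section Bochner.
Context (R : realType) (V : completeNormedModType R[i]).
Notation mu := (@lebesgue_measure R).
(** A family of real functionals that determines the norm up to a factor 2, modelling the pairing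
    with [D] and its positive norm. The factor appears because real functionals see real and
    imaginary parts separately. *)
Variables (T : Type) (l : T -> V -> R) (C : T -> R).
Hypothesis C_ge0 : forall g, 0 <= C g.
Hypothesis lD : forall g x y, l g (x + y) = l g x + l g y.
Hypothesis lZ : forall g (r : R) x, l g (r%:C *: x) = r * l g x.
Hypothesis l_le : forall g x, `|l g x| <= rnorm x * C g.
Hypothesis l_norming : forall x (c : R), 0 <= c -> (forall g, `|l g x| <= c * C g) -> rnorm x <= 2 * c.
Variables (K : set R) (mK : measurable (K : set (measurableTypeR R))).

Let lB g x y : l g (x - y) = l g x - l g y.
Proof.
have -> : x - y = x + (-1)%:C *: y by rewrite raddfN /= scaleN1r.
by rewrite lD lZ mulN1r.
Qed.

Let l0 g : l g 0 = 0.
Proof. by rewrite -(subrr 0) lB subrr. Qed.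

Let l_cvg g (u : nat -> V) x : u n @[n --> \oo] --> x -> l g (u n) @[n --> \oo] --> l g x.
Proof.
move=> /cvg_rnormP h; apply/cvgrPdist_lt => e e0.
have K0 : 0 < C g + 1 by have := C_ge0 g; lra.
have [N hN] := h _ (divr_gt0 e0 K0); exists N => // n /hN; rewrite ltr_pdivlMr // => hn.
rewrite distrC -lB; apply: le_lt_trans (l_le _ _) (le_lt_trans _ hn).
by apply: ler_wpM2l; [exact: rnorm_ge0|lra].
Qed.

Lemma bounded_simple_integral (s : R -> V) g : simple_fun s ->
  (forall v, v != 0 -> (mu (K `&` s @^-1` [set v]) < +oo)%E) ->
  mu.-integrable K (EFin \o (fun t => l g (s t))) /\
  l g (simple_integral K s) = Rintegral mu K (fun t => l g (s t)).
Proof.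
move=> [fs ms] fin.
have mKs v : measurable (K `&` s @^-1` [set v] : set (measurableTypeR R)) := measurableI _ _ mK (ms v).
pose f v t := l g v * \1_(K `&` s @^-1` [set v]) t.
have if_ v : mu.-integrable K (EFin \o f v) /\ Rintegral mu K (f v) = l g ((fine (mu (K `&` s @^-1` [set v])))%:C *: v).
  have [->|v0] := eqVneq v 0.
    rewrite /f l0 scaler0 l0; split.
      by apply: eq_integrable (integrable0 mu K) => // t _; rewrite /= mul0r.
    rewrite -[RHS](mul0r (fine (mu K))) -Rintegral_cst //; apply: eq_Rintegral => t _; by rewrite mul0r.
  have i1 : mu.-integrable K (EFin \o \1_(K `&` s @^-1` [set v])).
    apply/integrableP; split; first by apply/measurable_EFinP; apply: measurable_indic.
    under eq_integral do rewrite /= ger0_norm //.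
    by rewrite integral_indic // setIAC setIid; exact: fin.
  split; first exact: integrable_scaleR.
  rewrite RintegralZl // lZ mulrC; congr (_ * _).
  by rewrite /Rintegral integral_indic // setIAC setIid.
pose S := finmap.enum_fset (fset_set (range s)).
have sum_ t : K t -> l g (s t) = \sum_(v <- S) f v t.
  move=> Kt; rewrite (bigD1_seq (s t)) /=; last 2 first.
  - by rewrite in_fset_set // mem_set //; exists t.
  - exact: finmap.fset_uniq.
  rewrite {1}/f indicE mem_set // mulr1 big1 ?addr0 // => v vs.
  by rewrite /f indicE memNset ?mulr0 // => -[_ /= e]; rewrite e eqxx in vs.
have ind (r : seq V) : mu.-integrable K (EFin \o (fun t => \sum_(v <- r) f v t)) /\
   Rintegral mu K (fun t => \sum_(v <- r) f v t) = \sum_(v <- r) Rintegral mu K (f v).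
  elim: r => [|v r [i1 i2]].
    split; first by apply: eq_integrable (integrable0 mu K) => // t _; rewrite /= big_nil.
    rewrite big_nil -[RHS](mul0r (fine (mu K))) -Rintegral_cst //; apply: eq_Rintegral => t _; by rewrite big_nil.
  have [j1 j2] := if_ v; split.
    by apply: eq_integrable (integrable_addR mK j1 i1) => // t _; rewrite /= big_cons.
  rewrite big_cons -i2 -RintegralD //; apply: eq_Rintegral => t _; by rewrite big_cons.
have [i1 i2] := ind S; split.
  by apply: eq_integrable i1 => // t /set_mem Kt; rewrite /= sum_.
rewrite (_ : Rintegral mu K _ = Rintegral mu K (fun t => \sum_(v <- S) f v t)); last first.
  by apply: eq_Rintegral => t /set_mem Kt; rewrite sum_.
rewrite i2 /simple_integral fsbig_finite //= (big_morph (l g) (lD g) (l0 g)).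
by apply: eq_bigr => v _; rewrite (if_ v).2.
Qed.

Lemma integral_bochner (F : R -> V) x g : is_bochner_integral K F x ->
  (\int[mu]_(t in K) (rnorm (F t))%:E < +oo)%E -> l g x = Rintegral mu K (fun t => l g (F t)).
Proof.
move=> [sF [s [hs fin X L]]] iF.
have [F' [sF' _ eF]] := strongly_measurable_rep mK sF.
have mF' : measurable_fun K (fun t => rnorm (F' t)) by apply: measurable_funTS; exact: smeas_rnorm.
have iF' : mu.-integrable K (EFin \o (fun t => rnorm (F' t))).
  apply/integrableP; split; first exact/measurable_EFinP.
  apply: le_lt_trans iF; rewrite le_eqVlt; apply/orP; left; apply/eqP; apply: ae_integral_eq.
  by apply: ae_mono eF _ => t h Kt; rewrite h //= ger0_norm ?rnorm_ge0.
have ilF : mu.-integrable K (EFin \o (fun t => l g (F' t))).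
  apply: le_integrable (integrable_scaleR (C g) mK iF') => //.
    apply/measurable_EFinP; apply: measurable_funTS.
    by apply: (smeas_real2 (c := fun x _ => l g x) _ sF' sF') => a b z y az _; exact: l_cvg.
  move=> t _; rewrite /= lee_fin (ger0_norm (mulr_ge0 (C_ge0 g) (rnorm_ge0 _))) mulrC; exact: l_le.
have -> : Rintegral mu K (fun t => l g (F t)) = Rintegral mu K (fun t => l g (F' t)).
  by apply: ae_Rintegral_eq; apply: ae_mono eF _ => t h Kt; rewrite h.
have L' : l g (simple_integral K (s n)) @[n --> \oo] --> l g x by exact: l_cvg.
suff L2 : l g (simple_integral K (s n)) @[n --> \oo] --> Rintegral mu K (fun t => l g (F' t)) by exact: cvg_unique L' L2.
apply/cvgrPdist_lt => e e0.
have K0 : 0 < C g + 1 by have := C_ge0 g; lra.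
have d0 : 0 < e / (C g + 1) by rewrite divr_gt0.
have hX : \forall n \near \oo, (\int[mu]_(t in K) (rnorm (F t - s n t))%:E < (e / (C g + 1))%:E)%E.
  have /fine_cvgP[hf hc] := X.
  move/cvgrPdist_lt/(_ _ d0): hc; apply: filterS2 hf => n hf; rewrite sub0r normrN => hn.
  by rewrite -(fineK hf) lte_fin; apply: le_lt_trans (ler_norm _) hn.
apply: filterS hX => n hn.
have [i1 ->] := bounded_simple_integral g (hs n) (fin n).
rewrite -RintegralB //.
have sn : smeas (s n) by exists (fun=> s n); split => // t; exact: cvg_cst.
have hn' : (\int[mu]_(t in K) (rnorm (F' t - s n t))%:E < (e / (C g + 1))%:E)%E.
  apply: le_lt_trans hn; rewrite le_eqVlt; apply/orP; left; apply/eqP; apply: ae_integral_eq.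
  by apply: ae_mono eF _ => t h Kt; rewrite h.
have iN : mu.-integrable K (EFin \o (fun t => rnorm (F' t - s n t))).
  apply/integrableP; split.
    by apply/measurable_EFinP; apply: measurable_funTS; apply: smeas_rnorm; exact: smeasB.
  under eq_integral do rewrite /= ger0_norm ?rnorm_ge0 //.
  by apply: lt_trans hn' _; rewrite ltry.
have i2 : mu.-integrable K (EFin \o (fun t => l g (F' t) - l g (s n t))) by exact: integrable_subR.
apply: le_lt_trans (le_normr_Rintegral mK i2) _.
apply: (@le_lt_trans _ _ (Rintegral mu K (fun t => C g * rnorm (F' t - s n t)))).
  apply: le_Rintegral => //; first exact: integrable_norm.
    exact: integrable_scaleR.
  by move=> t _; rewrite -lB mulrC; exact: l_le.
rewrite RintegralZl //.
have h1 : Rintegral mu K (fun t => rnorm (F' t - s n t)) < e / (C g + 1).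
  by rewrite -lte_fin /Rintegral fineK // (integrable_fin_num _ iN).
have h0 : 0 <= Rintegral mu K (fun t => rnorm (F' t - s n t)) by apply: Rintegral_ge0 => t _; exact: rnorm_ge0.
move: h1; rewrite ltr_pdivlMr // => h1; apply: le_lt_trans h1; rewrite mulrC.
by apply: ler_wpM2l => //; lra.
Qed.

(** Truncated simple functions converge in mean by domination; [l_norming] turns this into the
    Cauchy property of their integrals. *)
Lemma bochner_exists (F : R -> V) : strongly_measurable K F ->
  (\int[mu]_(t in K) (rnorm (F t))%:E < +oo)%E -> exists x, is_bochner_integral K F x.
Proof.
move=> sF iF; have [F' [sF' _ eF]] := strongly_measurable_rep mK sF.
have mF' := smeas_rnorm sF'.
have iF' : mu.-integrable K (EFin \o (fun t => rnorm (F' t))).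
  apply/integrableP; split; first by apply/measurable_EFinP; exact: measurable_funTS.
  apply: le_lt_trans iF; rewrite le_eqVlt; apply/orP; left; apply/eqP; apply: ae_integral_eq.
  by apply: ae_mono eF _ => t h Kt; rewrite h //= ger0_norm ?rnorm_ge0.
have [s0 [hs0 s0F]] := sF'.
have ms0 n : measurable_fun setT (fun t => rnorm (s0 n t)).
  by apply: smeas_rnorm; exists (fun=> s0 n); split => // t; exact: cvg_cst.
(* Keeping [s0 n] only where it is at most twice as long as [F'] gives domination, and keeps
   convergence even where [F'] vanishes. *)
pose A n := [set t | rnorm (s0 n t) <= 2 * rnorm (F' t)].
have mA n : measurable (A n).
  have := measurable_fun_ler (ms0 n) (measurable_funM (measurable_cst (2 : R)) mF') measurableT (Y := [set true]).
  by move=> /(_ I); rewrite setTI.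
pose s n t := if t \in A n then s0 n t else 0.
have hs n : simple_fun (s n) by apply: simple_if => //; exact: simple_cst.
have sA n t : rnorm (s n t) <= 2 * rnorm (F' t).
  by rewrite /s; case: ifPn => [/set_mem //|_]; rewrite rnorm0 mulr_ge0 ?rnorm_ge0.
have sF2 t : s n t @[n --> \oo] --> F' t.
  have [F0|F0] := eqVneq (rnorm (F' t)) 0.
    have s00 n : s n t = F' t.
      rewrite (rnorm_eq0 F0); apply: rnorm_eq0; apply/eqP; rewrite eq_le rnorm_ge0 andbT.
      by have := sA n t; rewrite F0 mulr0.
    by rewrite (_ : (fun n => _) = fun=> F' t); [exact: cvg_cst|apply/funext => n].
  have Fp : 0 < rnorm (F' t) by rewrite lt_neqAle eq_sym F0 rnorm_ge0.
  have /cvg_rnormP h := s0F t; have [N1 hN1] := h _ Fp.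
  apply/cvg_rnormP => e e0; have [N2 hN2] := h _ e0; exists (maxn N1 N2) => n; rewrite geq_max => /andP[/hN1 h1 /hN2 h2].
  rewrite /s mem_set //= /A /=; have := rnormD (s0 n t - F' t) (F' t); rewrite subrK; lra.
have fin n v : v != 0 -> (mu (K `&` s n @^-1` [set v]) < +oo)%E.
  move=> v0; have vp : 0 < rnorm v.
    by rewrite lt_neqAle rnorm_ge0 andbT eq_sym; apply: contra_neq v0 => /rnorm_eq0.
  have mKs : measurable (K `&` s n @^-1` [set v] : set (measurableTypeR R)) := measurableI _ _ mK ((hs n).2 v).
  have h : ((rnorm v)%:E * mu (K `&` s n @^-1` [set v]) < +oo)%E.
    rewrite -integral_cst //.
    have /integrableP[_] := integrable_scaleR 2 mK iF'; apply: le_lt_trans.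
    have mN : measurable_fun K (fun t => `|(2 * rnorm (F' t))%:E|)%E.
      by apply/measurableT_comp => //; exact: measurable_int (integrable_scaleR 2 mK iF').
    apply: (@le_trans _ _ (\int[mu]_(t in K `&` s n @^-1` [set v]) `|(2 * rnorm (F' t))%:E|)%E); last first.
      exact: ge0_subset_integral.
    apply: ge0_le_integral => //.
    - by move=> t _; rewrite /= lee_fin ltW.
    - exact: measurable_funS mK _ mN.
    - move=> t [_ /= <-]; rewrite lee_fin (ger0_norm (mulr_ge0 _ (rnorm_ge0 _))) //; exact: sA.
  rewrite ltey; apply/eqP => e; move: h; rewrite e gt0_muley ?ltxx //.
have sn n : smeas (s n) by exists (fun=> s n); split => // t; exact: cvg_cst.
have mD n : measurable_fun K (fun t => rnorm (F' t - s n t)).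
  by apply: measurable_funTS; apply: smeas_rnorm; exact: smeasB.
have le3 n t : rnorm (F' t - s n t) <= 3 * rnorm (F' t).
  by apply: le_trans (rnormB _ _) _; have := sA n t; lra.
have iD n : mu.-integrable K (EFin \o (fun t => rnorm (F' t - s n t))).
  apply: le_integrable (integrable_scaleR 3 mK iF') => //; first by apply/measurable_EFinP; exact: mD.
  by move=> t _; rewrite /= lee_fin !ger0_norm ?mulr_ge0 ?rnorm_ge0.
pose X n := Rintegral mu K (fun t => rnorm (F' t - s n t)).
have X0 : X n @[n --> \oo] --> (0 : R).
  have -> : (0 : R) = Rintegral mu K (fun=> 0) by rewrite Rintegral_cst // mul0r.
  apply: (@Rintegral_dominated _ K _ _ (fun t => 3 * rnorm (F' t))) => //.
  - by move=> n; apply/measurable_EFinP; exact: mD.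
  - by apply/measurable_EFinP; exact: measurable_cst.
  - move=> t _; have /cvg_rnormP h := sF2 t; apply/cvgrPdist_lt => e e0.
    have [N hN] := h _ e0; exists N => // n /hN hn.
    by rewrite sub0r normrN ger0_norm ?rnorm_ge0 // rnormC.
  - exact: integrable_scaleR.
  - by move=> n t _; rewrite !ger0_norm ?mulr_ge0 ?rnorm_ge0.
have XE n : (\int[mu]_(t in K) (rnorm (F t - s n t))%:E)%E = (X n)%:E.
  rewrite /X /Rintegral fineK ?(integrable_fin_num _ (iD n)) //.
  by apply: ae_integral_eq; apply: ae_mono eF _ => t h Kt; rewrite h.
have dist m n : rnorm (simple_integral K (s m) - simple_integral K (s n)) <= 2 * (X m + X n).
  have Xp k : 0 <= X k by apply: Rintegral_ge0 => t _; exact: rnorm_ge0.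
  apply: l_norming => [|g]; first by rewrite addr_ge0.
  have [i1 e1] := bounded_simple_integral g (hs m) (fin m).
  have [i2 e2] := bounded_simple_integral g (hs n) (fin n).
  rewrite lB e1 e2 -RintegralB //.
  apply: le_trans (le_normr_Rintegral mK (integrable_subR mK i1 i2)) _.
  rewrite mulrC /X -RintegralD // -RintegralZl //; last exact: integrable_addR.
  apply: le_Rintegral => //; first exact: integrable_norm (integrable_subR mK i1 i2).
    by apply: integrable_scaleR => //; exact: integrable_addR.
  move=> t _; rewrite -lB mulrC; apply: le_trans (l_le _ _) _; apply: ler_wpM2r => //.
  rewrite (rnormC (F' t) (s m t)); exact: rnorm_distD.
have [x hx] : exists x, forall e : R, 0 < e -> exists N, forall n, (N <= n)%N -> rnorm (simple_integral K (s n) - x) < e.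
  apply: rnorm_complete => e e0; have d0 : 0 < e / 4 by lra.
  move/cvgrPdist_lt/(_ _ d0): X0 => [N _ hN]; exists N => m n Nm Nn.
  apply: le_lt_trans (dist _ _) _.
  have := hN _ Nm; have := hN _ Nn; rewrite /= !sub0r !normrN => h1 h2.
  by have := ler_norm (X m); have := ler_norm (X n); lra.
exists x; split => //; exists s; split => //; last exact/cvg_rnormP.
rewrite (_ : (fun n => _) = EFin \o X); last by apply/funext => n; exact: XE.
by apply: cvg_EFin => //; exact: nearW.
Qed.

Lemma bochnerP (F : R -> V) g : strongly_measurable K F ->
  (\int[mu]_(t in K) (rnorm (F t))%:E < +oo)%E ->
  l g (bochner K F) = Rintegral mu K (fun t => l g (F t)).
Proof.
move=> sF iF; apply: integral_bochner => //.
by apply: (xgetPex 0); exact: bochner_exists.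
Qed.

End Bochner.

(** * The negative space, the extended operator and the maximal operator *)

Section NegativeSpace.
Context (R : realType) (H : completeNormedModType R[i])
  (ip : {dot H for @Num.conj R[i]}).
Hypothesis H_norm : forall x : H, `|x| ^+ 2 = ip x x.
Hypothesis H_separable : separable H.
Notation mu := (@lebesgue_measure R).
Local Notation rip := (rip ip).
Local Notation rdot := (rdot ip).
Local Notation L2mem := (@L2mem R H).
Variables (D : set H) (A : H -> H).
Hypothesis sA : selfadjoint (graph_of ip D A).
Variable N : neg_space ip D A.
Local Notation emb := (neg_emb N).
Local Notation pn := (pos_norm ip A).

Let B g := 'i%C *: A g.
Let sB : skew_adjoint ip D B := skew_adjoint_of_selfadjoint sA.

Let ii (V : lmodType R[i]) (x : V) : 'i%C *: ('i%C *: x) = - x.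
Proof. by rewrite scalerA -expr2 sqr_i scaleN1r. Qed.

Let embZ z f : emb (z *: f) = z *: emb f. Proof. exact: linearZ. Qed.

Let embB f f' : emb (f - f') = emb f - emb f'. Proof. exact: raddfB. Qed.

Lemma selfadjoint_i g : D g -> D ('i%C *: g) /\ A ('i%C *: g) = 'i%C *: A g.
Proof.
move=> /(sa_i sB)[Di Bi]; split => //; apply: oppr_inj; rewrite -!ii; congr (_ *: _).
exact: Bi.
Qed.

Lemma selfadjoint_sym f g : D f -> D g -> rip (A f) g = rip f (A g).
Proof.
move=> Df Dg; have [Di Ai] := selfadjoint_i Dg.
rewrite -ripii; have := sa_skew sB Df Di; rewrite /B => ->.
by rewrite Ai ii ripNr opprK.
Qed.

Lemma pos_norm_sqr g : pn g ^+ 2 = rip (A g) (A g) + rip g g.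
Proof.
rewrite /pos_norm sqr_sqrtr; first by rewrite /pos_dot raddfD.
by rewrite /pos_dot raddfD /= addr_ge0 // nsq_ge0.
Qed.

Lemma pos_norm_ge0 g : 0 <= pn g. Proof. exact: sqrtr_ge0. Qed.

Lemma pos_norm_i g : D g -> pn ('i%C *: g) = pn g.
Proof.
move=> /selfadjoint_i[_ Ai]; apply/eqP; rewrite -(@eqrXn2 _ 2) ?pos_norm_ge0 //.
by rewrite !pos_norm_sqr Ai !ripii.
Qed.

Lemma rnorm_le_pos g : rnorm g <= pn g /\ rnorm (A g) <= pn g.
Proof.
have h1 := nsq_ge0 H_norm g; have h2 := nsq_ge0 H_norm (A g).
by split; rewrite -(@ler_pXn2r _ 2) ?nnegrE ?rnorm_ge0 ?pos_norm_ge0 //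
  pos_norm_sqr (rnorm_sqr H_norm); lra.
Qed.

Lemma norm_ip_le f g : complex.Re `|ip f g| <= `|rip f g| + `|rip f ('i%C *: g)|.
Proof.
rewrite ip_rip normc_def /= -(@ler_pXn2r _ 2) ?nnegrE ?sqrtr_ge0 ?addr_ge0 ?normr_ge0 //.
rewrite sqr_sqrtr ?addr_ge0 ?sqr_ge0 // sqrrD !real_normK ?num_real //.
by rewrite -addrA lerD2l lerDr mulrn_wge0 // mulr_ge0 ?normr_ge0.
Qed.

Lemma rip_le_norm_ip f g : `|rip f g| <= complex.Re `|ip f g|.
Proof.
rewrite ip_rip normc_def /= -(@ler_pXn2r _ 2) ?nnegrE ?sqrtr_ge0 ?normr_ge0 //.
by rewrite sqr_sqrtr ?addr_ge0 ?sqr_ge0 // real_normK ?num_real // lerDl sqr_ge0.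
Qed.

(** The modulus of [ip f g] is at most the sum of its parts, and the imaginary part is the real
    pairing with ['i *: g], of the same positive norm; hence the factor 2. *)
Lemma neg_norm_le f (c : R) : 0 <= c -> (forall g, D g -> `|rip f g| <= c * pn g) ->
  neg_norm ip D A f <= 2 * c.
Proof.
move=> c0 h; rewrite /neg_norm; set S := [set r | _].
(* The set is empty when [D] has no nonzero vector, and its [sup] is then 0. *)
have [S0|/set0P/negP/negPn/eqP ->] := pselect (S !=set0); last by rewrite sup0 mulr_ge0.
apply: ge_sup => // _ [g [Dg g0 ->]].
have gp : 0 < pn g.
  rewrite lt_neqAle pos_norm_ge0 andbT eq_sym; apply: contra_neq g0 => p0.
  by apply: rnorm_eq0; apply/eqP; rewrite eq_le rnorm_ge0 andbT -p0; have [] := rnorm_le_pos g.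
rewrite ler_pdivrMr //; apply: le_trans (norm_ip_le _ _) _.
have := h _ Dg; have [Di _] := selfadjoint_i Dg; have := h _ Di; rewrite pos_norm_i //; lra.
Qed.

Lemma le_neg_norm f g : D g -> `|rip f g| <= neg_norm ip D A f * pn g.
Proof.
move=> Dg; have [->|g0] := eqVneq g 0.
  by rewrite rip0r normr0 mulr_ge0 ?pos_norm_ge0 // -(neg_embE N) rnorm_ge0.
have gp : 0 < pn g.
  rewrite lt_neqAle pos_norm_ge0 andbT eq_sym; apply: contra_neq g0 => p0.
  by apply: rnorm_eq0; apply/eqP; rewrite eq_le rnorm_ge0 andbT -p0; have [] := rnorm_le_pos g.
apply: le_trans (rip_le_norm_ip _ _) _; rewrite -ler_pdivrMr //.
apply: ub_le_sup; last by exists g.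
exists (2 * rnorm f) => _ [k [Dk k0 ->]].
have kp : 0 < pn k.
  rewrite lt_neqAle pos_norm_ge0 andbT eq_sym; apply: contra_neq k0 => p0.
  by apply: rnorm_eq0; apply/eqP; rewrite eq_le rnorm_ge0 andbT -p0; have [] := rnorm_le_pos k.
rewrite ler_pdivrMr //; apply: le_trans (norm_ip_le _ _) _.
have [Di _] := selfadjoint_i Dk; have q k' : D k' -> `|rip f k'| <= rnorm f * pn k'.
  move=> _; apply: le_trans (rip_rnorm H_norm _ _) _; apply: ler_wpM2l; first exact: rnorm_ge0.
  by have [] := rnorm_le_pos k'.
by have := q _ Dk; have := q _ Di; rewrite pos_norm_i //; lra.
Qed.

Lemma rnorm_emb_le f : rnorm (emb f) <= 2 * rnorm f.
Proof.
rewrite neg_embE; apply: neg_norm_le => [|g Dg]; first exact: rnorm_ge0.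
apply: le_trans (rip_rnorm H_norm _ _) _; apply: ler_wpM2l; first exact: rnorm_ge0.
by have [] := rnorm_le_pos g.
Qed.

Lemma emb_dense (a : N) (e : R) : 0 < e -> exists f, rnorm (a - emb f) < e.
Proof. by move=> e0; have /dense_rnormP/(_ a e e0)[_ [f _ <-] h] := @neg_emb_dense _ _ _ _ _ N; exists f. Qed.

(* The real part of the pairing, as a Lipschitz extension of [rip f g] from the *)
(* range of the embedding.                                                      *)
Definition rpair (a : N) (g : H) : R :=
  inf [set rip f g + rnorm (a - emb f) * pn g | f in [set: H]].

Lemma rpair_spec a g f : D g -> `|rip f g - rpair a g| <= rnorm (a - emb f) * pn g.
Proof.
move=> Dg; have lip f1 f2 : rip f1 g - rnorm (a - emb f1) * pn g <= rip f2 g + rnorm (a - emb f2) * pn g.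
  have := le_neg_norm (f1 - f2) Dg; rewrite -(neg_embE N) raddfB /= ripBl.
  have := rnorm_distD (emb f1) a (emb f2); rewrite (rnormC (emb f1) a) => h1 h2.
  by have := le_trans (ler_norm _) h2; have := ler_wpM2r (pos_norm_ge0 g) h1; rewrite mulrDl; lra.
have lb f0 : rip f0 g - rnorm (a - emb f0) * pn g <= rpair a g.
  by apply: lb_le_inf; [exists (rip 0 g + rnorm (a - emb 0) * pn g), 0|move=> _ [f' _ <-]; exact: lip].
have ub : rpair a g <= rip f g + rnorm (a - emb f) * pn g.
  apply: ge_inf; last by exists f.
  by exists (rip 0 g - rnorm (a - emb 0) * pn g) => _ [f' _ <-]; exact: lip.
by have := lb f; rewrite ler_norml => *; apply/andP; split; lra.
Qed.

(** Density of the embedding leaves room for only one number with such an estimate, whatever [K].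
    Homogeneity and the value on embedded vectors follow from this uniqueness. *)
Lemma rpair_uniq a g (p K : R) : D g -> (forall f, `|rip f g - p| <= rnorm (a - emb f) * K) -> p = rpair a g.
Proof.
move=> Dg h; apply/eqP; rewrite -subr_eq0 -normr_le0; apply/ler_addgt0Pr => e e0; rewrite add0r.
pose C := `|K| + pn g + 1; have C0 : 0 < C by rewrite /C; have := pos_norm_ge0 g; have := normr_ge0 K; lra.
have [f hf] := emb_dense a (divr_gt0 e0 C0).
rewrite ltr_pdivlMr // in hf.
have -> : p - rpair a g = (rip f g - rpair a g) - (rip f g - p) by ring.
apply: le_trans (ler_normB _ _) _; apply: le_trans (lerD (rpair_spec a f Dg) (h f)) _.
have := ler_wpM2l (rnorm_ge0 (a - emb f)) (ler_norm K); have := rnorm_ge0 (a - emb f).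
rewrite /C in hf; lra.
Qed.

Lemma rpair_emb f g : D g -> rpair (emb f) g = rip f g.
Proof.
move=> Dg; apply/esym/(@rpair_uniq _ _ _ (pn g)) => // f'.
by rewrite rnormC -embB neg_embE -ripBl; exact: le_neg_norm.
Qed.

Lemma rpairD a b g : D g -> rpair (a + b) g = rpair a g + rpair b g.
Proof.
move=> Dg; apply/eqP; rewrite -subr_eq0 -normr_le0; apply/ler_addgt0Pr => e e0; rewrite add0r.
pose C := 4 * (pn g + 1); have C0 : 0 < C by rewrite /C; have := pos_norm_ge0 g; lra.
have [f hf] := emb_dense a (divr_gt0 e0 C0); have [f' hf'] := emb_dense b (divr_gt0 e0 C0).
rewrite ltr_pdivlMr // in hf; rewrite ltr_pdivlMr // in hf'.
have h1 := rpair_spec a f Dg; have h2 := rpair_spec b f' Dg; have h3 := rpair_spec (a + b) (f + f') Dg.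
have h4 : rnorm (a + b - emb (f + f')) <= rnorm (a - emb f) + rnorm (b - emb f').
  by rewrite raddfD /= opprD addrACA; exact: rnormD.
have h5 := ler_wpM2r (pos_norm_ge0 g) h4; rewrite ripDl in h3.
have -> : rpair (a + b) g - (rpair a g + rpair b g) =
   (rip f g - rpair a g) + (rip f' g - rpair b g) - (rip f g + rip f' g - rpair (a + b) g) by ring.
apply: le_trans (ler_normB _ _) _; apply: le_trans (lerD (ler_normD _ _) (lexx _)) _.
have := rnorm_ge0 (a - emb f); have := rnorm_ge0 (b - emb f'); rewrite /C in hf hf'; lra.
Qed.

Lemma rpairZ (r : R) a g : D g -> rpair (r%:C *: a) g = r * rpair a g.
Proof.
move=> Dg; have [->|r0] := eqVneq r 0.
  by rewrite mul0r scale0r -(raddf0 emb) rpair_emb // rip0l.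
apply/esym/(@rpair_uniq _ _ _ (pn g)) => // f.
have := rpair_spec a (r^-1%:C *: f) Dg; rewrite ripZl => h.
have -> : rip f g - r * rpair a g = r * (r^-1 * rip f g - rpair a g) by rewrite mulrBr mulVKf.
rewrite normrM; apply: le_trans (ler_wpM2l (normr_ge0 r) h) _.
by rewrite mulrA -rnormZ scalerBr embZ scalerA -rmorphM /= mulfV // scale1r.
Qed.

Lemma rnorm_i (V : normedModType R[i]) (x : V) : rnorm ('i%C *: x) = rnorm x.
Proof.
by rewrite /rnorm normrZ normc_def /= expr0n expr1n add0r sqrtr1 mul1r.
Qed.

Lemma rpair_i a g : D g -> rpair ('i%C *: a) g = - rpair a ('i%C *: g).
Proof.
move=> Dg; have [Di _] := selfadjoint_i Dg; apply/esym/(@rpair_uniq _ _ _ (pn g)) => // f.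
have := rpair_spec a (- ('i%C *: f)) Di; rewrite pos_norm_i // ripNl ripii opprK.
rewrite -normrN opprD !opprK => h; apply: le_trans h _.
rewrite le_eqVlt; apply/orP; left; apply/eqP; congr (_ * _).
by rewrite raddfN /= embZ opprK -(rnorm_i (a + _)) scalerDr ii.
Qed.

Lemma rpair_le a g : D g -> `|rpair a g| <= rnorm a * pn g.
Proof. by move=> Dg; have := rpair_spec a 0 Dg; rewrite rip0l raddf0 subr0 sub0r normrN. Qed.

Lemma rpair_norming a (c : R) : 0 <= c -> (forall g, D g -> `|rpair a g| <= c * pn g) -> rnorm a <= 2 * c.
Proof.
move=> c0 h; apply/ler_addgt0Pr => e e0; have d0 : 0 < e / 3 by lra.
have [f hf] := emb_dense a d0.
have : rnorm (emb f) <= 2 * (c + e / 3).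
  rewrite neg_embE; apply: neg_norm_le => [|g Dg]; first lra.
  have := rpair_spec a f Dg; have := h _ Dg; have := ler_wpM2r (pos_norm_ge0 g) (ltW hf).
  have -> : rip f g = (rip f g - rpair a g) + rpair a g by ring.
  by move=> h1 h2 h3; apply: le_trans (ler_normD _ _) _; rewrite subrK in h3; lra.
have := rnormD (a - emb f) (emb f); rewrite subrK; lra.
Qed.

Lemma rpair_sep a : (forall g, D g -> rpair a g = 0) -> a = 0.
Proof.
move=> h; apply: rnorm_eq0; apply/eqP; rewrite eq_le rnorm_ge0 andbT.
rewrite -(mulr0 2); apply: rpair_norming => // g Dg.
by rewrite h // normr0 mul0r.
Qed.

Lemma rpairB a b g : D g -> rpair (a - b) g = rpair a g - rpair b g.
Proof.
move=> Dg; have -> : a - b = a + (-1)%:C *: b by rewrite raddfN /= scaleN1r.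
by rewrite rpairD // rpairZ // mulN1r.
Qed.

Lemma rpair_eq a b : (forall g, D g -> rpair a g = rpair b g) -> a = b.
Proof.
move=> h; apply/eqP; rewrite -subr_eq0; apply/eqP/rpair_sep => g Dg.
by rewrite rpairB // h // subrr.
Qed.

Lemma Re_norm_le (z : R[i]) : complex.Re `|z| <= `|complex.Re z| + `|complex.Im z|.
Proof.
case: z => x y; rewrite normc_def /= -(@ler_pXn2r _ 2) ?nnegrE ?sqrtr_ge0 ?addr_ge0 ?normr_ge0 //.
rewrite sqr_sqrtr ?addr_ge0 ?sqr_ge0 // sqrrD !real_normK ?num_real //.
by rewrite -addrA lerD2l lerDr mulrn_wge0 // mulr_ge0 ?normr_ge0.
Qed.

(** [pairing] is a choice, so this needs both existence and uniqueness: two admissible values would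
    differ by less than their own distance. *)
Lemma pairingE a g : D g -> pairing a g = rpair a g +i* rpair a ('i%C *: g).
Proof.
move=> Dg; have [Di _] := selfadjoint_i Dg.
have cE (z : R[i]) : `|z| = (complex.Re `|z|)%:C by rewrite normc_def.
have isp : is_pairing a g (rpair a g +i* rpair a ('i%C *: g)).
  move=> e /gt0_realc[r r0 ->]; have C0 : 0 < 2 * pn g + 1 by have := pos_norm_ge0 g; lra.
  apply/near_rnormP; exists (r / (2 * pn g + 1)); first by rewrite divr_gt0.
  move=> b; rewrite ltr_pdivlMr // => hb f fb; rewrite -fb in hb.
  rewrite cE ltcR; apply: le_lt_trans (Re_norm_le _) _; rewrite ip_rip /=.
  have := rpair_spec a f Dg; have := rpair_spec a f Di; rewrite pos_norm_i //.
  by have := rnorm_ge0 (a - emb f); lra.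
have isp' := xgetPex 0 (ex_intro _ _ isp : exists z, is_pairing a g z).
rewrite -/(pairing a g) in isp'.
apply/eqP; rewrite -subr_eq0 -normr_eq0 cE; set d := complex.Re _; apply/eqP; congr (_%:C).
apply/eqP; rewrite eq_le; apply/andP; split; last first.
  by rewrite /d normc_def sqrtr_ge0.
rewrite leNgt; apply/negP => d0; have e0 : 0 < (d / 2)%:C by rewrite ltcR divr_gt0.
have [c c0 hc] := (near_rnormP _ _).1 (filterI (isp _ e0) (isp' _ e0)).
have [f hf] := emb_dense a c0; have [h1 h2] := hc _ hf.
have := h1 f erefl; have := h2 f erefl.
rewrite distrC => k2 k1; have := ltrD k2 k1.
have dd : (d / 2)%:C + (d / 2)%:C = d%:C by rewrite -rmorphD -splitr.
rewrite dd => k; have := le_lt_trans (ler_normD _ _) k.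
by rewrite addrA subrK /d -cE ltxx.
Qed.

(** [ext_op] is a choice, so an element with the property must be produced: take [u n] in [D]
    tending to [f]. By symmetry the images of [A (u n)] pair with [k] as [u n] with [A k], so they
    are Cauchy in the negative norm. *)
Lemma rpair_ext f g : D g -> rpair (ext_op N f) g = rip f (A g).
Proof.
suff [a ha] : exists a : N, forall g, D g -> rpair a g = rip f (A g).
  have h : exists a : N, forall g, D g -> pairing a g = ip f (A g).
    exists a => k Dk; have [Di Ai] := selfadjoint_i Dk.
    by rewrite pairingE // !ha // Ai -ip_rip.
  move=> Dg; have := xgetPex 0 h; rewrite -/(ext_op N f) => /(_ _ Dg).
  by rewrite pairingE // ip_rip => -[].
have /choice[u hu] (n : nat) : exists u, D u /\ rnorm (f - u) < n.+1%:R^-1.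
  have n0 : 0 < n.+1%:R^-1 :> R by rewrite invr_gt0.
  have [u Du] := sa_dense sB f (exprn_gt0 2 n0).
  by rewrite (nsq_lt_rnorm H_norm) // => h; exists u.
have small (e : R) : 0 < e -> exists n0 : nat, forall n, (n0 <= n)%N -> rnorm (f - u n) < e.
  move=> e0; have [n0 _ hn] := near_infty_natSinv_lt (PosNum e0); exists n0 => n /hn /= h.
  exact: lt_trans (hu n).2 h.
have pA n k : D k -> rpair (emb (A (u n))) k = rip (u n) (A k).
  by move=> Dk; rewrite rpair_emb // selfadjoint_sym //; exact: (hu n).1.
have [a ha] : exists a : N, forall e : R, 0 < e -> exists n0, forall n, (n0 <= n)%N -> rnorm (emb (A (u n)) - a) < e.
  apply: rnorm_complete => e e0; have d0 : 0 < e / 5 by lra.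
  have [n0 hn] := small _ d0; exists n0 => m n Nm Nn.
  apply: (@le_lt_trans _ _ (2 * rnorm (u m - u n))).
    apply: rpair_norming => [|k Dk]; first exact: rnorm_ge0.
    rewrite rpairB // !pA // -ripBl; apply: le_trans (rip_rnorm H_norm _ _) _.
    by apply: ler_wpM2l; [exact: rnorm_ge0|have [] := rnorm_le_pos k].
  have := rnorm_distD (u m) f (u n); rewrite (rnormC (u m) f); have := hn _ Nm; have := hn _ Nn; lra.
exists a => k Dk; apply/eqP; rewrite -subr_eq0 -normr_le0; apply/ler_addgt0Pr => e e0; rewrite add0r.
pose C := 2 * (pn k + 1); have C0 : 0 < C by rewrite /C; have := pos_norm_ge0 k; lra.
have d0 := divr_gt0 e0 C0; have [n1 h1] := ha _ d0; have [n2 h2] := small _ d0.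
have := h1 _ (leq_maxl n1 n2); have := h2 _ (leq_maxr n1 n2); set n := maxn _ _.
rewrite !ltr_pdivlMr // => j1 j2.
have -> : rpair a k - rip f (A k) = - (rpair (emb (A (u n)) - a) k) - rip (f - u n) (A k).
  by rewrite rpairB // pA // ripBl; ring.
apply: le_trans (ler_normB _ _) _; rewrite normrN.
have q1 := rpair_le (emb (A (u n)) - a) Dk; have q2 := rip_rnorm H_norm (f - u n) (A k).
have q3 := ler_wpM2l (rnorm_ge0 (f - u n)) (rnorm_le_pos k).2.
have := rnorm_ge0 (f - u n); have := rnorm_ge0 (emb (A (u n)) - a); rewrite /C in j1 j2; lra.
Qed.

Lemma test_fun_derive (J : set R) (phi : R -> R) : test_fun J phi -> test_fun setT (derive1 phi).
Proof.
move=> tphi; have [_ _ _ [x [y [_ h _]]]] := test_fun_facts tphi; case: tphi => dphi _.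
split; first by move=> n t; have := dphi n.+1 t; rewrite derive1Sn.
exists `[x, y]%classic; split => //; first exact: segment_compact.
by move=> t ht; apply: (h t _).2 => h'; apply: ht; rewrite /= in_itv.
Qed.

Lemma integrable_compact_support (f : R -> R) (x y : R) : continuous f ->
  (forall t, ~ (x <= t <= y) -> f t = 0) -> mu.-integrable setT (EFin \o f).
Proof.
move=> cf f0; apply: (@integrable_supp _ `[x, y]) => //.
apply: continuous_compact_integrable; first exact: segment_compact.
exact: continuous_subspaceT.
Qed.

Section Distributions.
Variables (I : set R) (mI : measurable (I : set (measurableTypeR R))).

(* Covers both the embedding of [H] and the extended operator. *)
Lemma rpair_dist (c : H -> N) (c' : H -> H) u phi g (J : set R) :
  (forall f, rpair (c f) g = rip f (c' g)) -> (forall f f', rnorm (c f - c f') <= 2 * rnorm (f - f')) ->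
  (forall (r : R) f, c (r%:C *: f) = r%:C *: c f) ->
  L2mem I u -> test_fun J phi -> D g ->
  rpair (dist_of I (c \o u) phi) g = rdot I u (tens phi (c' g)).
Proof.
move=> cE c_le cZ mu_ /test_fun_facts[_ cphi _ [x [y [_ phi0 _]]]] Dg.
have [u' [[su iu] u0 eu]] := L2mem_rep H_norm mI mu_.
have mphi := continuous_measurable_fun cphi.
pose w t := (phi t)%:C *: u' t.
have sw : smeas w.
  apply: smeas_separable => // z.
  rewrite (_ : (fun t => _) = Num.sqrt \o (fun t => phi t ^+ 2 * rip (u' t) (u' t) - 2 * phi t * rip (u' t) z + rip z z)).
    apply: measurableT_comp.
      by apply: continuous_measurable_fun; exact: sqrt_continuous.
    apply: measurable_funD => //; apply: measurable_funB; apply: measurable_funM => //.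
    - exact: measurable_funX.
    - exact: rip_meas.
    - exact: measurable_funM.
    - by apply: rip_meas => //; exact: smeas_cst.
  apply/funext => t /=; rewrite /w -[LHS](@ger0_norm _ _ (rnorm_ge0 _)) -sqrtr_sqr (rnorm_sqr H_norm).
  by rewrite ripB_nsq // ripZ_nsq // ripZl; congr Num.sqrt; ring.
have c0 : c 0 = 0 by have := cZ 0 0; rewrite !scale0r.
have scw : smeas (c \o w).
  apply: smeas_map sw => a z /cvg_rnormP az; apply/cvg_rnormP => e e0.
  have d0 : 0 < e / 2 by lra.
  have [n0 hn] := az _ d0; exists n0 => n /hn h; apply: le_lt_trans (c_le _ _) _; lra.
have eF : {ae mu, forall t, I t -> (c \o w) t = (phi t)%:C *: (c \o u) t}.
  by apply: ae_mono eu _ => t h It; rewrite /w /= cZ h.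
have iw : mu.-integrable I (EFin \o (fun t => phi t ^+ 2 + rip (u' t) (u' t))).
  apply: integrable_addR => //; apply: (integrableS measurableT mI (@subsetT _ I)).
  apply: (@integrable_compact_support _ x y).
    by move=> t; exact: cvgM (cphi t) (cphi t).
  by move=> t /phi0[-> _]; rewrite expr0n.
have hF : (\int[mu]_(t in I) (rnorm ((c \o w) t))%:E < +oo)%E.
  have /integrableP[_] := iw; apply: le_lt_trans; apply: ge0_le_integral => //.
  - by move=> t _; rewrite lee_fin rnorm_ge0.
  - by apply/measurable_EFinP; apply: measurable_funTS; exact: smeas_rnorm.
  - by apply/measurableT_comp => //; exact: measurable_int iw.
  - move=> t _; rewrite /= lee_fin [leRHS]ger0_norm ?addr_ge0 ?sqr_ge0 ?nsq_ge0 //.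
    have := c_le (w t) 0; rewrite c0 !subr0 /w rnormZ => h; apply: le_trans h _.
    rewrite -(rnorm_sqr H_norm) -(real_normK (num_real (phi t))).
    have := sqr_ge0 (`|phi t| - rnorm (u' t)); rewrite sqrrB; lra.
have hF' : (\int[mu]_(t in I) (rnorm ((phi t)%:C *: (c \o u) t))%:E < +oo)%E.
  apply: le_lt_trans hF; rewrite le_eqVlt; apply/orP; left; apply/eqP; apply: ae_integral_eq.
  by apply: ae_mono eF _ => t h It; rewrite -h.
rewrite /dist_of (@bochnerP _ _ {k : H | D k} (fun k a => rpair a (sval k)) (fun k => pn (sval k))
   _ _ _ _ _ I mI _ (exist _ g Dg) _ hF') /=.
- apply: ae_Rintegral_eq; apply: ae_mono2 eF eu _ => t h1 h2 It.
  by rewrite -h1 //= cE /w /tens ripZl ripZr h2.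
- by move=> k; exact: pos_norm_ge0.
- by move=> [k Dk] a b; exact: rpairD.
- by move=> [k Dk] r a; exact: rpairZ.
- by move=> [k Dk] a; exact: rpair_le.
- move=> a r r0 h; apply: rpair_norming => // k Dk; exact: (h (exist _ k Dk)).
- exact: strongly_measurable_ae eF (strongly_measurable_smeas _ scw).
Qed.

Lemma rpair_dist_emb u phi g (J : set R) : L2mem I u -> test_fun J phi -> D g ->
  rpair (dist_of I (emb \o u) phi) g = rdot I u (tens phi g).
Proof.
move=> mu_ tphi Dg; apply: (@rpair_dist _ id _ _ _ J) => //.
- by move=> f; rewrite rpair_emb.
- by move=> f f'; rewrite -embB rnorm_emb_le.
Qed.

Lemma rpair_dist_ext u phi g (J : set R) : L2mem I u -> test_fun J phi -> D g ->
  rpair (dist_of I (ext_op N \o u) phi) g = rdot I u (tens phi (A g)).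
Proof.
move=> mu_ tphi Dg; apply: (@rpair_dist _ A _ _ _ J) => //.
- by move=> f; rewrite rpair_ext.
- move=> f f'; apply: rpair_norming => [|k Dk]; first exact: rnorm_ge0.
  rewrite rpairB // !rpair_ext // -ripBl; apply: le_trans (rip_rnorm H_norm _ _) _.
  by apply: ler_wpM2l; [exact: rnorm_ge0|have [] := rnorm_le_pos k].
- by move=> r f; apply: rpair_eq => k Dk; rewrite rpairZ // !rpair_ext // ripZl.
Qed.

(** Elements of the negative space are equal when their real pairings with [D] agree, which turns
    the distributional equation into [E1]. Taking [E1] at ['i *: g] yields the weak form of
    [u' = B u - i v] at [g]. *)
Lemma max_opP (u v : R -> H) : @max_op R H ip D A N I (u, v) <-> weak_sol ip I D B u (- 'i%C *: v).
Proof.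
have hL := real_hilbert_L2 H_norm H_separable mI.
have ti (psi : R -> R) (x : H) : tens psi ('i%C *: x) = 'i%C *: tens psi x.
  by apply/esym/funext => t; rewrite /tens /= scalerA mulrC -scalerA.
have tN (psi : R -> R) (x : H) : tens psi (- x) = - tens psi x.
  by apply/funext => t; rewrite /tens /= scalerN.
have mt (psi : R -> R) (x : H) : test_fun I psi -> L2mem I (tens psi x) /\ L2mem I (tens (derive1 psi) x).
  exact: (test_tens_mem H_norm H_separable mI).
pose E1 phi g := rdot I u (tens (derive1 phi) ('i%C *: g)) + rdot I u (tens phi (A g)) = rdot I v (tens phi g).
have e1 phi g : test_fun I phi -> D g -> L2mem I u -> L2mem I v ->
    (E1 phi ('i%C *: g) <-> - rdot I u (tens (derive1 phi) g) =
      rdot I (- 'i%C *: v) (tens phi g) - rdot I u (tens phi (B g))).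
  move=> tphi Dg mu_ mv; have [Di Ai] := selfadjoint_i Dg.
  have [m1 m2] := mt _ g tphi; have mi := rhZ hL 'i%C mv.
  rewrite /E1 Ai ii tN (rh_Nr hL) // scaleNr (rh_Nl hL) // (rdot_i H_norm H_separable mI) // ti.
  by rewrite opprK -!ti /B; split => h; lra.
have e2 phi : test_fun I phi -> L2mem I u -> L2mem I v ->
   ('i%C *: dist_deriv (dist_of I (emb \o u)) phi + dist_of I (ext_op N \o u) phi = dist_of I (emb \o v) phi
    <-> forall g, D g -> E1 phi g).
  move=> tphi mu_ mv.
  have tphi' := test_fun_derive tphi.
  have k g : D g -> (E1 phi g <-> rpair ('i%C *: dist_deriv (dist_of I (emb \o u)) phi + dist_of I (ext_op N \o u) phi) g =
       rpair (dist_of I (emb \o v) phi) g).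
    move=> Dg; have [Di _] := selfadjoint_i Dg.
    rewrite rpairD // rpair_i // /dist_deriv -(sub0r (dist_of _ _ _)) rpairB // -(raddf0 emb) rpair_emb // rip0l sub0r opprK.
    have r1 := rpair_dist_emb mu_ tphi' Di; have r2 := rpair_dist_ext mu_ tphi Dg.
    have r3 := rpair_dist_emb mv tphi Dg.
    have r12 := congr2 +%R r1 r2; split => e; first exact: etrans r12 (etrans e (esym r3)).
    exact: etrans (esym r12) (etrans e r3).
  split => [e g Dg|h]; first by apply/k => //; rewrite e.
  by apply: rpair_eq => g Dg; apply/k => //; exact: h.
split => [[/= mu_ mv h]|[mu_ mh h]].
  split => //; first exact: (rhZ hL).
  move=> phi tphi g Dg; apply/e1 => //; have [Di _] := selfadjoint_i Dg.
  by apply: (e2 _ tphi mu_ mv).1 Di; exact: h.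
have mv : L2mem I v.
  have := rhZ hL 'i%C mh; rewrite scalerA (_ : 'i%C * - 'i%C = 1) ?scale1r //.
  by rewrite mulrN -expr2 sqr_i opprK.
split => //= phi tphi; apply/e2 => // g Dg; have [Di _] := selfadjoint_i Dg.
have [DN _] := sa_N sB Di.
have -> : g = 'i%C *: (- ('i%C *: g)) by rewrite scalerN ii opprK.
by apply/e1 => //; exact: h.
Qed.

End Distributions.
End NegativeSpace.

(** * Solvability on a half line *)

Section Solve.
Context (R : realType) (H : completeNormedModType R[i])
  (ip : {dot H for @Num.conj R[i]}).
Hypothesis H_norm : forall x : H, `|x| ^+ 2 = ip x x.
Hypothesis H_separable : separable H.
Notation mu := (@lebesgue_measure R).
Local Notation rip := (rip ip).
Local Notation rdot := (rdot ip).
Local Notation L2mem := (@L2mem R H).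
Implicit Types (u h k : R -> H).

Lemma rip_adj (c : R[i]) x y : rip (c *: x) y = rip x (c^*%C *: y).
Proof. by rewrite /rip ipZl ipZr conjcK. Qed.

Lemma rip_scale_self (c : R[i]) x : rip (c *: x) x = complex.Re c * rip x x.
Proof.
rewrite /rip ipZl -H_norm normE -rmorphXn /=; case: c => a b /=; ring.
Qed.

Lemma rdot_adj (I : set R) (c : R[i]) u v : rdot I (c *: u) v = rdot I u (c^*%C *: v).
Proof. by apply: eq_Rintegral => t _; rewrite [LHS]rip_adj. Qed.

Variables (I : set R) (a sg : R).
Hypothesis hI : half_line I a sg.
Let mI := half_line_measurable hI.
Let itvI := half_line_interval hI.
Let oI := half_line_open hI.
Let hL := real_hilbert_L2 H_norm H_separable mI.
Variables (D : set H) (B : H -> H).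
Hypothesis sB : skew_adjoint ip D B.
Local Notation weak_sol := (weak_sol ip I D B).
Local Notation trace := (trace ip I a).

Lemma rdot_scale_self (c : R[i]) u : L2mem I u -> rdot I (c *: u) u = complex.Re c * rdot I u u.
Proof.
move=> mu_; rewrite -(rh_Zl hL) //; apply: eq_Rintegral => t _.
by rewrite [LHS]rip_scale_self [RHS]rip_scale_self.
Qed.

Lemma trace0 : trace 0 0.
Proof.
exists setT; first exact: aeW.
by move=> e e0; exists 1 => // t _ _ _; rewrite subr0 rip0l.
Qed.

Lemma test_fun_sub (J K : set R) (phi : R -> R) : J `<=` K -> test_fun J phi -> test_fun K phi.
Proof.
move=> JK [d [L [cL LJ phi0]]]; split => //; exists L; split => //; exact: subset_trans LJ JK.
Qed.

Lemma trace_test_tens phi g : test_fun I phi -> trace (tens phi g) 0.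
Proof.
move=> tphi; have [_ cphi _ [_ [_ [_ _ o]]]] := test_fun_facts tphi.
have := trace_tens H_norm I a g cphi.
by have [-> _] := o _ (half_line_end hI); rewrite scale0r.
Qed.

Lemma weak_sol_mem u h : weak_sol u h -> L2mem I u /\ L2mem I h. Proof. by case. Qed.

(** For [r = h + c^* u], Green's formula reads [sg |z|^2 = 2 (r, u) - 2 Re c |u|^2]. The sign
    condition puts both squares on the same side, and [(r, u)] is absorbed. *)
Lemma weak_sol_energy (c : R[i]) u h z : weak_sol u h -> trace u z -> complex.Re c != 0 ->
  (0 < sg * complex.Re c \/ z = 0) ->
  rip z z + `|complex.Re c| * rdot I u u <= rdot I (h + c^*%C *: u) (h + c^*%C *: u) / `|complex.Re c|.
Proof.
move=> ws tz c0 cz; have [mu_ mh] := weak_sol_mem ws.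
set r := h + _; have mr : L2mem I r by apply: (rhD hL) => //; exact: (rhZ hL).
have G := green_trace H_norm H_separable hI sB ws ws tz tz.
have E : rdot I h u = rdot I r u - complex.Re c * rdot I u u.
  rewrite /r (rh_Dl hL) //; last exact: (rhZ hL).
  by rewrite rdot_scale_self //; case: (c) => x y /=; ring.
have b0 : 0 < `|complex.Re c| by rewrite normr_gt0.
have u0 := rh_ge0 hL mu_; have z0 := nsq_ge0 H_norm z.
have bb := real_normK (num_real (complex.Re c)).
(* The sign [s] is [sg] when a trace is present and the sign of [Re c] when [z = 0]. *)
have key (s : R) : s ^+ 2 = 1 -> s * rdot I r u <= `|complex.Re c| / 2 * rdot I u u + rdot I r r / (2 * `|complex.Re c|).
  move=> s2; have ms := rhZ hL (`|complex.Re c| * s)%:C mu_; have := rh_ge0 hL (rhB hL mr ms).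
  rewrite (rh_nsqB hL) // (rh_nsqZ hL) // (rh_Zr hL) // exprMn s2 mulr1 => h0.
  rewrite -(ler_pM2r b0) mulrDl; set m := `|_| in b0 h0 *.
  have -> : rdot I r r / (2 * m) * m = rdot I r r / 2 by field; rewrite gt_eqF.
  lra.
have -> : rdot I r r / `|complex.Re c| = 2 * (rdot I r r / (2 * `|complex.Re c|)) by field; rewrite gt_eqF.
rewrite (rdotC ip I u h) E in G.
have s2 := half_line_sg hI; have := key sg s2; set X := rdot I r r / _ => k1.
case: cz => [cz|z_0].
  have e1 : `|complex.Re c| = sg * complex.Re c.
    apply/eqP; rewrite -(@eqrXn2 _ 2) ?ltW //; apply/eqP.
    by rewrite bb exprMn s2 mul1r.
  have : rip z z = 2 * (sg * rdot I r u) - 2 * `|complex.Re c| * rdot I u u.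
    have := congr1 (fun q => sg * q) G; rewrite /= mulrA -expr2 s2 mul1r e1 => ->; ring.
  lra.
rewrite z_0 rip0l mulr0 in G; rewrite z_0 rip0l add0r.
have E2 : rdot I r u = complex.Re c * rdot I u u by lra.
have k2 := key (Num.sg (complex.Re c)) ltac:(by rewrite sqr_sg c0).
move: k2; rewrite E2 mulrA -normrEsg -/X; lra.
Qed.

Lemma weak_sol_solve (c : R[i]) k y : L2mem I k -> complex.Re c != 0 ->
  exists2 u, weak_sol u (c *: u + k) & 0 < sg * complex.Re c -> trace u y.
Proof.
move=> mk c0; have b0 : 0 < `|complex.Re c| by rewrite normr_gt0.
pose M : set ((R -> H) * R) := [set p | exists (f h : R -> H) (z : H),
  [/\ weak_sol f h, trace f z, 0 < sg * complex.Re c \/ z = 0 &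
      p = (h + c^*%C *: f, sg * rip y z - rdot I k f)]].
pose b := `|complex.Re c|.
(* With [b = |Re c|], the energy estimate bounds [|z|^2] by [r / b] and [|f|^2] by [r / b^2]; this
   is the resulting constant. *)
have [|||||u [mu_ hu _]] := @riesz_relation _ _ _ _ hL M (2 * (rip y y + rdot I k k / b) / b).
- move=> _ [f [h [z [ws _ _ ->]]]] /=; have [mf mh] := weak_sol_mem ws.
  by apply: (rhD hL) => //; exact: (rhZ hL).
- exists 0, 0, 0; split; [exact: weak_sol0|exact: trace0|by right|].
  have h0 := rh_Zl hL 0 (rh0 hL) mk; rewrite scale0r mul0r in h0.
  by rewrite scaler0 addr0 rip0r mulr0 sub0r (rdotC ip I k) h0 oppr0.
- move=> _ _ [f [h [z [ws tz cz ->]]]] [f' [h' [z' [ws' tz' cz' ->]]]].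
  have [mf mh] := weak_sol_mem ws; have [mf' mh'] := weak_sol_mem ws'.
  exists (f + f'), (h + h'), (z + z'); split.
  + exact: weak_solD.
  + exact: traceD.
  + case: cz => [|->]; first by left.
    by case: cz' => [|->]; [left|right; rewrite addr0].
  + congr pair => /=; first by rewrite scalerDr addrACA.
    rewrite ripDr (rh_Dr hL) //; ring.
- move=> r _ [f [h [z [ws tz cz ->]]]]; have [mf mh] := weak_sol_mem ws.
  exists (r%:C *: f), (r%:C *: h), (r%:C *: z); split.
  + exact: weak_solZ.
  + exact: traceZ.
  + by case: cz => [|->]; [left|right; rewrite scaler0].
  + congr pair => /=; first by rewrite scalerDr !scalerA mulrC.
    rewrite ripZr (rh_Zr hL) //; ring.
- move=> _ [f [h [z [ws tz cz ->]]]] /=; have [mf mh] := weak_sol_mem ws.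
  have en := weak_sol_energy ws tz c0 cz; rewrite -/b in en.
  set r := rdot I (h + _) _ in en *.
  have k0 := rh_ge0 hL mk; have f0 := rh_ge0 hL mf; have z0 := nsq_ge0 H_norm z; have y0 := nsq_ge0 H_norm y.
  have s2 := half_line_sg hI.
  have h1 : (sg * rip y z - rdot I k f) ^+ 2 <= 2 * (rip y z ^+ 2 + rdot I k f ^+ 2).
    have q : (sg * rip y z) ^+ 2 = rip y z ^+ 2 by rewrite exprMn s2 mul1r.
    rewrite -q; move: (sg * _) (rdot I k f) => v w; have := sqr_ge0 (v + w); rewrite sqrrD sqrrB; lra.
  apply: le_trans h1 _.
  have h2 := rip_CS H_norm y z; have h3 := rh_CS hL mk mf.
  have zr : rip z z <= r / b by have := mulr_ge0 (ltW b0) f0; rewrite -/b; lra.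
  have fr : rdot I f f <= r / b / b.
    by rewrite ler_pdivlMr // mulrC; lra.
  have h4 := ler_wpM2l y0 zr; have h5 := ler_wpM2l k0 fr.
  have -> : 2 * (rip y y + rdot I k k / b) / b * r = 2 * (rip y y * (r / b) + rdot I k k * (r / b / b)).
    by field; rewrite gt_eqF.
  lra.
have mh : L2mem I (c *: u + k) by apply: (rhD hL) => //; exact: (rhZ hL).
have test (psi : R -> R) g z : test_fun setT psi -> D g -> trace (tens psi g) z ->
    0 < sg * complex.Re c \/ z = 0 ->
    rdot I (c *: u + k) (tens psi g) + rdot I u (fun t => tens (derive1 psi) g t - tens psi (B g) t) = sg * rip y z.
  move=> tpsi Dg tz cz.
  have ws := weak_sol_tens H_norm H_separable mI sB tpsi Dg; have [mf m0] := weak_sol_mem ws.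
  have /= := hu (_, _) (ex_intro _ _ (ex_intro _ _ (ex_intro _ _ (And4 ws tz cz erefl)))).
  rewrite (rh_Dl hL) //; last exact: (rhZ hL).
  rewrite (rh_Dl hL (rhZ hL c mu_) mk mf).
  rewrite (rdot_adj I c) (rdotC ip I _ u) (rdotC ip I (_ *: _) u); lra.
(* Test functions inside [I] have trace 0, so they are admissible for either sign of [Re c]. *)
have ws : weak_sol u (c *: u + k).
  split => // phi tphi g Dg.
  have [m1 m2] := test_tens_mem H_norm H_separable mI g tphi; have [m3 _] := test_tens_mem H_norm H_separable mI (B g) tphi.
  have := test _ _ _ (test_fun_sub (@subsetT _ I) tphi) Dg (trace_test_tens g tphi) (or_intror erefl).
  rewrite rip0r mulr0 (_ : (fun t => _) = tens (derive1 phi) g - tens phi (B g)) //.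
  rewrite (rh_Br hL) //; lra.
exists u => // cp; have [x tx] := trace_exists H_norm H_separable hI sB ws.
suff -> : y = x by [].
(* A plateau times [g] has trace [g]; comparing the representation with Green's formula shows that
   [y] and the true trace agree against all of [D]. *)
apply/eqP; rewrite -subr_eq0; apply/eqP/(sa_orth0 H_norm sB) => g Dg.
have [_ cpl _ _] := test_fun_facts (plateau_test a).
have tg := trace_tens H_norm I a g cpl; rewrite plateau1 scale1r in tg.
have e1 := test _ _ _ (plateau_test a) Dg tg (or_introl cp).
have wt := weak_sol_tens H_norm H_separable mI sB (plateau_test a) Dg.
have e2 := green_trace H_norm H_separable hI sB ws wt tx tg.
have : sg * (sg * rip y g) = sg * (sg * rip x g) by rewrite -e1 -e2.
rewrite !mulrA -expr2 (half_line_sg hI) !mul1r ripBr (ripC ip g y) (ripC ip g x); lra.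
Qed.

(** The norm of [u] is constant on [E] by Green's formula, and it is arbitrarily small at the far
    points, because its square is integrable. *)
Lemma weak_sol_kernel u h : weak_sol u h -> (forall t, rip (h t) (u t) = 0) ->
  rdot I u u = 0.
Proof.
move=> ws hu0; have [u' [h' [E [[su sh] eu eh [EI aeE] ev]]]] := weak_sol_evolves H_norm H_separable mI itvI oI sB ws.
have gr := green_ae H_norm mI itvI sB EI aeE su sh su sh ev ev.
have cst s t : E s -> E t -> rip (u' t) (u' t) = rip (u' s) (u' s).
  suff lt_case p q : E p -> E q -> p < q -> rip (u' q) (u' q) = rip (u' p) (u' p).
    by move=> Es Et; case: (ltgtP s t) => [|ts|-> //]; [exact: lt_case|rewrite (lt_case t s)].
  move=> Ep Eq pq; apply/eqP; rewrite -subr_eq0 gr //; apply/eqP.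
  transitivity (Rintegral mu `]p, q] (fun=> 0)); last by rewrite Rintegral_cst ?mul0r.
  apply: ae_Rintegral_eq; apply: ae_mono2 eu eh _ => r h1 h2 /(sub_itv itvI (EI _ Ep) (EI _ Eq)) It.
  by rewrite (ripC _ (u' r)) -h1 // -h2 // hu0 addr0.
have zero t : E t -> u' t = 0.
  move=> Et; apply: (nsq_eq0 H_norm); apply/eqP; rewrite eq_le nsq_ge0 // andbT.
  apply/ler_addgt0Pr => e e0; rewrite add0r.
  have [p [q [hpq Gq _ _]]] := approx_interval hI aeE (sq_int_rip H_norm mI su su).
  have [n0 _ hn] := near_infty_natSinv_lt (PosNum e0); have /= n1 := hn n0 (leqnn _).
  have [_ _ _ _ Eq] := hpq n0; rewrite (cst _ _ Eq Et).
  by have := ler_norm (rip (u' (q n0)) (u' (q n0))); have := Gq n0; move: (n0.+1%:R^-1) n1 => w; lra.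
transitivity (Rintegral mu I (fun=> 0)); last by rewrite Rintegral_cst ?mul0r.
by apply: ae_Rintegral_eq; apply: ae_mono2 eu aeE _ => t h1 h2 It; rewrite h1 // zero ?rip0l //; exact: h2.
Qed.

End Solve.

(** * An unsolvable right-hand side *)

Section Hilbert.
Context (R : realType).

Lemma real_hilbert_prod (X Y : lmodType R[i]) (memX : set X) (memY : set Y) dotX dotY :
  real_hilbert memX dotX -> real_hilbert memY dotY ->
  real_hilbert [set p : X * Y | memX p.1 /\ memY p.2] (fun p q => dotX p.1 q.1 + dotY p.2 q.2).
Proof.
move=> hX hY; split.
- by split; [exact: (rh0 hX)|exact: (rh0 hY)].
- by move=> p q [p1 p2] [q1 q2]; split; [exact: (rhD hX)|exact: (rhD hY)].
- by move=> z p [p1 p2]; split; [exact: (rhZ hX)|exact: (rhZ hY)].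
- by move=> p q [p1 p2] [q1 q2]; rewrite (rh_sym hX) // (rh_sym hY).
- move=> p q r [p1 p2] [q1 q2] [r1 r2] /=; rewrite (rh_Dl hX) // (rh_Dl hY) //; ring.
- move=> r p q [p1 p2] [q1 q2] /=; rewrite (rh_Zl hX) // (rh_Zl hY) //; ring.
- by move=> p [p1 p2]; rewrite addr_ge0 ?(rh_ge0 hX) ?(rh_ge0 hY).
move=> u mu_ cu.
have [||lX mX cX] := rh_complete hX (u := fun n => (u n).1); first by move=> n; exact: (mu_ n).1.
  move=> e e0; have [N hN] := cu e e0; exists N => m n Nm Nn; apply: le_lt_trans (hN m n Nm Nn).
  by rewrite lerDl; apply: (rh_ge0 hY); apply: (rhB hY); [exact: (mu_ m).2|exact: (mu_ n).2].
have [||lY mY cY] := rh_complete hY (u := fun n => (u n).2); first by move=> n; exact: (mu_ n).2.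
  move=> e e0; have [N hN] := cu e e0; exists N => m n Nm Nn; apply: le_lt_trans (hN m n Nm Nn).
  by rewrite lerDr; apply: (rh_ge0 hX); apply: (rhB hX); [exact: (mu_ m).1|exact: (mu_ n).1].
exists (lX, lY); first by [].
move=> e e0; have e2 : 0 < e / 2 by lra.
have [N1 h1] := cX _ e2; have [N2 h2] := cY _ e2; exists (maxn N1 N2) => n.
by rewrite geq_max => /andP[/h1 k1 /h2 k2]; rewrite [ltRHS]splitr ltrD.
Qed.

(** Against a [z] whose products with all terms are nonnegative, the sum dominates each single term;
    lower bounds thus survive summation. *)
Lemma positive_series (X : lmodType R[i]) (mem : set X) dot (d : nat -> X) (K : R) :
  real_hilbert mem dot -> (forall n, mem (d n)) -> (forall n, dot (d n) (d n) <= K / 4 ^+ n) ->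
  exists2 g, mem g & forall z, mem z -> (forall m, 0 <= dot (d m) z) ->
    forall n, dot (d n) z <= dot g z.
Proof.
move=> hX md dK; pose S := fix S n := if n is k.+1 then S k + d k else 0.
have mS n : mem (S n) by elim: n => [|n IH] /=; [exact: (rh0 hX)|exact: (rhD hX)].
have K0 : 0 <= K by have := dK 0%N; rewrite divr1; apply: le_trans; exact: (rh_ge0 hX).
(* The factor 4 reproduces itself: [2 * (K / 4 ^+ m + 4 K / 4 ^+ m.+1) = 4 K / 4 ^+ m]. *)
have tail j m : dot (S (m + j)%N - S m) (S (m + j)%N - S m) <= 4 * K / 4 ^+ m.
  have p4 k : 0 < 4 ^+ k :> R by rewrite exprn_gt0.
  elim: j m => [|j IH] m.
    rewrite addn0 subrr; have := rh_Zl hX 0 (rh0 hX) (rh0 hX); rewrite scale0r mul0r => ->.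
    by rewrite divr_ge0 ?mulr_ge0 // ltW.
  have -> : S (m + j.+1)%N - S m = d m + (S (m.+1 + j)%N - S m.+1).
    by rewrite addSnnS [S m.+1]/(S m + d m) opprD addrCA (addrC (- S m)) addNKr.
  have mb := rhB hX (mS (m.+1 + j)%N) (mS m.+1).
  apply: le_trans (rh_nsqD_le hX (md m) mb) _; have := IH m.+1; have := dK m.
  have -> : 4 * K / 4 ^+ m.+1 = K / 4 ^+ m by rewrite exprS; field; rewrite gt_eqF.
  lra.
have [e e0|g mg cg] := rh_complete hX mS.
  have K1 : 0 < 16 * K + 1 by lra.
  have [N _ hN] := near_infty_natSinv_lt (PosNum (divr_gt0 e0 K1)); have /= h := hN N (leqnn _).
  exists N => m n Nm Nn.
  have -> : S m - S n = (S m - S N) - (S n - S N) by rewrite opprB addrA subrK.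
  have mm := rhB hX (mS m) (mS N); have mn := rhB hX (mS n) (mS N).
  have h1 := rh_nsqD_le hX mm (rhN hX mn); rewrite (rh_Nl hX mn (rhN hX mn)) (rh_Nr hX mn mn) opprK in h1.
  apply: le_lt_trans h1 _; have := tail (m - N)%N N; have := tail (n - N)%N N; rewrite !subnKC //.
  have : (4 ^+ N)^-1 <= N.+1%:R^-1 :> R.
    by rewrite lef_pV2 ?posrE ?exprn_gt0 // -natrX ler_nat ltn_expl.
  have : 0 < N.+1%:R^-1 :> R by rewrite invr_gt0.
  move: h; rewrite ltr_pdivlMr //; move: (N.+1%:R^-1 : R) ((4 ^+ N)^-1 : R) => w v h1 w0 h2.
  have := ler_wpM2l K0 h2; lra.
exists g => // z mz pos n.
have low k : (n < k)%N -> dot (d n) z <= dot (S k) z.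
  have ge0 j : 0 <= dot (S j) z.
    elim: j => [|j IH] /=; last by rewrite (rh_Dl hX) // addr_ge0.
    by have := rh_Zl hX 0 (rh0 hX) mz; rewrite scale0r mul0r => ->.
  elim: k => // k IH; rewrite ltnS leq_eqVlt /= (rh_Dl hX) // => /predU1P[->|/IH h].
    by rewrite lerDr.
  by apply: le_trans h _; rewrite lerDl.
apply/ler_addgt0Pr => e e0; have [N hN] := dot_lim hX mS mg mz cg e0.
have := hN _ (leq_maxl N n.+1); have := low _ (leq_maxr N n.+1); rewrite ltr_norml => h1 /andP[_ h2]; lra.
Qed.

End Hilbert.

Section Unsolvable.
Context (R : realType) (H : completeNormedModType R[i])
  (ip : {dot H for @Num.conj R[i]}).
Hypothesis H_norm : forall x : H, `|x| ^+ 2 = ip x x.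
Hypothesis H_separable : separable H.
Local Notation rip := (rip ip).
Local Notation rdot := (rdot ip).
Local Notation L2mem := (@L2mem R H).
Variables (I : set R) (a sg : R).
Hypothesis hI : half_line I a sg.
Let mI := half_line_measurable hI.
Let hL := real_hilbert_L2 H_norm H_separable mI.
Variables (D : set H) (B : H -> H).
Hypothesis sB : skew_adjoint ip D B.
Local Notation weak_sol := (weak_sol ip I D B).
Local Notation trace := (trace ip I a).

(* The solutions [e n] of [e' = B e + c e] with trace [x], for                  *)
(* [Re c = sg * 16 ^- n], have Gram matrix [|x|^2 / (16 ^- m + 16 ^- n)]; the   *)
(* sum of the [8 ^- n *: e n] converges but its scalar products with the [e n]  *)
(* are too large for the equation to have a solution with trace 0.             *)
Lemma weak_sol_unsolvable (ga : R) (x : H) : x != 0 -> exists2 g, L2mem I g &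
  forall u, trace u 0 -> ~ weak_sol u ((ga%:C * 'i%C) *: u + g).
Proof.
move=> x0; have X0 : 0 < rip x x.
  rewrite lt_neqAle nsq_ge0 // andbT eq_sym; apply: contra_neq x0; exact: (nsq_eq0 H_norm).
have s2 := half_line_sg hI.
have s0 : sg != 0 by apply/eqP => z; move: s2; rewrite z expr0n => /eqP; rewrite eq_sym oner_eq0.
pose b (n : nat) : R := (16 ^+ n)^-1; have b0 n : 0 < b n by rewrite invr_gt0 exprn_gt0.
pose c n : R[i] := (sg * b n) +i* ga.
have /choice[e he] n : exists e, weak_sol e (c n *: e) /\ trace e x.
  have [||u wu tu] := @weak_sol_solve _ _ _ H_norm H_separable _ _ _ hI _ _ sB (c n) 0 x.
  - exact: (rh0 hL).
  - by rewrite /= mulf_neq0 // gt_eqF.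
  by rewrite addr0 in wu; exists u; split => //; apply: tu; rewrite /= mulrA -expr2 s2 mul1r.
have me n : L2mem I (e n) by have [[]] := he n.
have cE n : c n = (sg * b n)%:C + ga%:C * 'i%C by apply/eqP; rewrite eq_complex /=; apply/andP; split; apply/eqP; ring.
(* In Green's formula for [e m] and [e n] the imaginary parts [ga] cancel and the real parts add
   up. *)
have gram m n : (b m + b n) * rdot I (e m) (e n) = rip x x.
  have [[wm tm] [wn tn]] := (he m, he n).
  have := green_trace H_norm H_separable hI sB wm wn tm tn.
  rewrite rdot_adj (_ : (c m)^*%C *: e n = (sg * b m)%:C *: e n + (- (ga%:C * 'i%C)) *: e n); last first.
    by rewrite -scalerDl; congr (_ *: _); rewrite /c; apply/eqP; rewrite eq_complex /=; apply/andP; split; apply/eqP; ring.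
  rewrite cE scalerDl scaleNr.
  have m1 := rhZ hL (sg * b m)%:C (me n); have m2 := rhZ hL (ga%:C * 'i%C) (me n); have m3 := rhZ hL (sg * b n)%:C (me n).
  rewrite (rh_Br hL) // (rh_Dr hL) // !(rh_Zr hL) // => G.
  by have := congr1 (fun r => sg * r) G; rewrite /= mulrA -expr2 s2 mul1r => ->; rewrite -[LHS]mul1r -s2; ring.
have pos m n : 0 < rdot I (e m) (e n).
  by rewrite -(pmulr_rgt0 _ (addr_gt0 (b0 m) (b0 n))) gram.
have eE n : rdot I (e n) (e n) = 16 ^+ n * rip x x / 2.
  by rewrite -(gram n n) /b; field; rewrite expf_neq0.
(* The weight [8 ^- n] makes [nsq (d n)] equal to [rip x x / 2 / 4 ^+ n], which is summable as
   required, while [d n] against [e n] still grows like [2 ^+ n]. *)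
pose d n := ((8 ^+ n)^-1)%:C *: e n.
have p8 n : 0 < (8 ^+ n)^-1 :> R by rewrite invr_gt0 exprn_gt0.
have [||g mg hg] := @positive_series _ _ _ _ d (rip x x / 2) hL.
- by move=> n; exact: (rhZ hL).
- move=> n; rewrite /d (rh_nsqZ hL) // eE.
  have T2 : 16 ^+ n * 4 ^+ n = 8 ^+ n * 8 ^+ n :> R by rewrite -!exprMn; congr (_ ^+ n); ring.
  have -> : 16 ^+ n = 8 ^+ n * 8 ^+ n / 4 ^+ n :> R by rewrite -T2 mulfK // expf_neq0.
  rewrite le_eqVlt; apply/orP; left; apply/eqP; field.
  by rewrite !expf_neq0.
exists g => // u tu wu.
have [mu_ mh] := weak_sol_mem wu.
have lower n : 2 ^+ n * rip x x / 2 <= rdot I g (e n).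
  apply: le_trans (hg _ (me n) _ n); last first.
    by move=> m; rewrite (rh_Zl hL) // mulr_ge0 ?ltW.
  rewrite (rh_Zl hL) // eE; have -> : 16 = 8 * 2 :> R by ring.
  rewrite exprMn le_eqVlt; apply/orP; left; apply/eqP; field.
  by rewrite !expf_neq0.
(* With trace 0 Green's formula leaves [(g, e n) = - sg b_n (u, e n)], and [b_n^2] times [|e n|^2]
   stays bounded. *)
have upper n : rdot I g (e n) ^+ 2 <= rdot I u u * rip x x.
  have [wn tn] := he n.
  have := green_trace H_norm H_separable hI sB wu wn tu tn.
  have m1 := rhZ hL (ga%:C * 'i%C) mu_; have m2 := rhZ hL (ga%:C * 'i%C) (me n); have m3 := rhZ hL (sg * b n)%:C (me n).
  rewrite rip0l mulr0 (rh_Dl hL) // rdot_adj cE scalerDl (rh_Dr hL) // (rh_Zr hL) //.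
  have -> : (ga%:C * 'i%C)^*%C *: e n = - ((ga%:C * 'i%C) *: e n).
    by rewrite -scaleNr; congr (_ *: _); apply/eqP; rewrite eq_complex /=; apply/andP; split; apply/eqP; ring.
  rewrite (rh_Nr hL) // => G; have -> : rdot I g (e n) = - (sg * b n * rdot I u (e n)) by lra.
  rewrite sqrrN !exprMn s2 mul1r.
  apply: le_trans (ler_wpM2l (sqr_ge0 _) (rh_CS hL mu_ (me n))) _.
  rewrite eE mulrCA; apply: ler_wpM2l; first exact: (rh_ge0 hL).
  have -> : b n ^+ 2 * (16 ^+ n * rip x x / 2) = b n * (rip x x / 2).
    by rewrite /b; field; rewrite expf_neq0.
  have : b n <= 1 by rewrite /b invf_le1 ?exprn_gt0 // exprn_ege1 // ler1n.
  have X2 : 0 <= rip x x / 2 by lra.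
  by move=> /(ler_wpM2r X2); lra.
have U0 := rh_ge0 hL mu_.
have U1 : 0 < 4 * rdot I u u + 1 by lra.
have [N _ hN] := near_infty_natSinv_lt (PosNum (divr_gt0 X0 U1)); have /= := hN N (leqnn _).
rewrite invf_plt ?posrE ?divr_gt0 // invf_div ltr_pdivrMr // => h1.
have h2 : N.+1%:R <= 4 ^+ N :> R by rewrite -natrX ler_nat ltn_expl.
have h3 := ler_wpM2r (ltW X0) h2.
have L0 : 0 <= 2 ^+ N * rip x x / 2 by rewrite !mulr_ge0 ?exprn_ge0 // ltW.
have := le_trans (lerXn2r 2 L0 (le_trans L0 (lower N)) (lower N)) (upper N).
have -> : (2 ^+ N * rip x x / 2) ^+ 2 = (4 ^+ N * rip x x / 4) * rip x x.
  have -> : 4 ^+ N = 2 ^+ N * 2 ^+ N :> R by rewrite -exprMn; congr (_ ^+ N); ring.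
  by field.
rewrite ler_pM2r //; move: (4 ^+ N * rip x x) h3 h1; move: (N.+1%:R * rip x x) => *; lra.
Qed.

End Unsolvable.

(** * The coupled problem *)

Section Null.
Context (R : realType) (H : completeNormedModType R[i])
  (ip : {dot H for @Num.conj R[i]}).
Hypothesis H_norm : forall x : H, `|x| ^+ 2 = ip x x.
Hypothesis H_separable : separable H.
Local Notation rip := (rip ip).
Local Notation rdot := (rdot ip).
Local Notation L2mem := (@L2mem R H).
Variables (I : set R) (a sg : R).
Hypothesis hI : half_line I a sg.
Let mI := half_line_measurable hI.
Variables (D : set H) (B : H -> H).
Hypothesis sB : skew_adjoint ip D B.
Local Notation weak_sol := (weak_sol ip I D B).
Local Notation trace := (trace ip I a).

Lemma weak_solN u h : weak_sol u h -> weak_sol (- u) (- h).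
Proof. by move=> /(weak_solZ H_norm H_separable mI (-1)); rewrite raddfN /= !scaleN1r. Qed.

Lemma weak_solB u h u' h' : weak_sol u h -> weak_sol u' h' -> weak_sol (u - u') (h - h').
Proof. by move=> ws /weak_solN; exact: weak_solD. Qed.

(** A pair at distance 0 from a solution is a limit of solutions, and the difference has trace 0 by
    [trace_bound]; solutions are thus insensitive to the choice of representatives. *)
Lemma weak_sol_null u h u' h' : weak_sol u h -> L2mem I u' -> L2mem I h' ->
  rdot I (u' - u) (u' - u) = 0 -> rdot I (h' - h) (h' - h) = 0 ->
  weak_sol u' h' /\ forall x, trace u x -> trace u' x.
Proof.
move=> ws mu_ mh u0 h0.
have ws' : weak_sol u' h'.
  apply: (weak_sol_closed H_norm H_separable mI mu_ mh) => e e0.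
  by exists (u, h); rewrite /= u0 h0.
split => // x tx; have wd := weak_solB ws' ws.
have [y ty] := trace_exists H_norm H_separable hI sB wd.
have := trace_bound H_norm H_separable hI sB wd ty; rewrite u0 h0 addr0 => y0.
have yE : y = 0 by apply: (nsq_eq0 H_norm); apply/eqP; rewrite eq_le y0 nsq_ge0.
by have := traceD H_norm ty tx; rewrite yE add0r subrK.
Qed.

Lemma traceB u v x y : trace u x -> trace v y -> trace (u - v) (x - y).
Proof. by move=> tx /(traceZ H_norm (-1)) ty; have := traceD H_norm tx ty; rewrite !scaleN1r. Qed.

Lemma rdot_Ni u v : rdot I (- 'i%C *: u) (- 'i%C *: v) = rdot I u v.
Proof.
apply: eq_Rintegral => t _; rewrite !scaleNr; change (rip (- ('i%C *: u t)) (- ('i%C *: v t)) = rip (u t) (v t)).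
by rewrite ripNl ripNr opprK ripii.
Qed.

End Null.

(** * The minimal operator has trace zero *)

Section MinimalOperator.
Context (R : realType) (H : completeNormedModType R[i])
  (ip : {dot H for @Num.conj R[i]}).
Hypothesis H_norm : forall x : H, `|x| ^+ 2 = ip x x.
Hypothesis H_separable : separable H.
Local Notation rdot := (rdot ip).
Variables (I : set R) (a sg : R).
Hypothesis hI : half_line I a sg.
Let mI := half_line_measurable hI.
Let hL := real_hilbert_L2 H_norm H_separable mI.
Variables (D : set H) (A : H -> H) (sA : selfadjoint (graph_of ip D A)) (N : neg_space ip D A).
Let B g := 'i%C *: A g.
Let sB : skew_adjoint ip D B := skew_adjoint_of_selfadjoint sA.

Lemma trace_test_sums (u : R -> H) : test_sums D I u -> trace ip I a u 0.
Proof.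
move=> [n [phi [h [tphi _ ->]]]].
have -> : (fun t => \sum_(j < n) (phi j t)%:C *: h j) = \sum_(j < n) tens (phi j) (h j).
  by apply/funext => t; rewrite fct_sumE.
elim/big_rec: _ => [|j v _ tv]; first exact: trace0.
by have := traceD H_norm (trace_test_tens H_norm hI (h j) (tphi j)) tv; rewrite addr0.
Qed.

(** Finite sums of test functions have trace 0, and the trace is continuous for the graph norm, so
    the closure keeps it. *)
Lemma min_op_trace (u v : R -> H) : @min_op R H ip D A N I (u, v) ->
  weak_sol ip I D B u (- 'i%C *: v) /\ trace ip I a u 0.
Proof.
move=> [/= mu_ mv app].
have app' (e : R) : 0 < e -> exists p : (R -> H) * (R -> H),
    [/\ weak_sol ip I D B p.1 p.2 /\ trace ip I a p.1 0,
        rdot I (u - p.1) (u - p.1) < e & rdot I (- 'i%C *: v - p.2) (- 'i%C *: v - p.2) < e].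
  move=> e0; have s0 : 0 < Num.sqrt e by rewrite sqrtr_gt0.
  have [[q1 q2] [[mq tq] /= h1 h2]] := app _ s0.
  have wq := (max_opP H_norm H_separable sA N mI q1 q2).1 mq.
  exists (q1, - 'i%C *: q2); split; first by split => //; exact: trace_test_sums.
    by rewrite hnorm_L2 ltr_sqrt // in h1.
  by rewrite hnorm_L2 ltr_sqrt // in h2; rewrite /= -scalerBr rdot_Ni.
have ws : weak_sol ip I D B u (- 'i%C *: v).
  apply: (weak_sol_closed H_norm H_separable mI mu_ (rhZ hL _ mv)) => e /app'[p [[wp _] h1 h2]].
  by exists p.
split => //; have [x tx] := trace_exists H_norm H_separable hI sB ws.
suff x0 : x = 0 by rewrite -x0.
apply: (nsq_eq0 H_norm); apply/eqP; rewrite eq_le nsq_ge0 // andbT.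
apply/ler_addgt0Pr => e e0; rewrite add0r; have e2 : 0 < e / 2 by lra.
have [p [[wp tp] h1 h2]] := app' _ e2.
have := trace_bound H_norm H_separable hI sB (weak_solB H_norm H_separable hI ws wp)
  (traceB H_norm tx tp).
rewrite subr0; lra.
Qed.

End MinimalOperator.

Section Coupled.
Context (R : realType) (H : completeNormedModType R[i])
  (ip : {dot H for @Num.conj R[i]}).
Hypothesis H_norm : forall x : H, `|x| ^+ 2 = ip x x.
Hypothesis H_separable : separable H.
Notation mu := (@lebesgue_measure R).
Local Notation rip := (rip ip).
Local Notation rdot := (rdot ip).
Local Notation L2mem := (@L2mem R H).
Variables (a1 a3 : R).
Let I1 : set R := `]-oo, a1[.
Let I3 : set R := `]a3, +oo[.
Let hI1 : half_line I1 a1 1. Proof. by left. Qed.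
Let hI3 : half_line I3 a3 (-1). Proof. by right. Qed.
Let mI1 := half_line_measurable hI1.
Let mI3 := half_line_measurable hI3.
Variables (D1 D3 : set H) (B1 B3 : H -> H).
Hypotheses (sB1 : skew_adjoint ip D1 B1) (sB3 : skew_adjoint ip D3 B3).
Variables (W : {linear H -> H}) (W_unitary : unitary ip W).

Let WD x y : W (x + y) = W x + W y. Proof. exact: raddfD. Qed.
Let WZ z x : W (z *: x) = z *: W x. Proof. exact: linearZ. Qed.
Let W0 : W 0 = 0. Proof. exact: raddf0. Qed.

Local Notation X := ((R -> H) * (R -> H))%type.

Definition mem2 : set X := [set p | L2mem I1 p.1 /\ L2mem I3 p.2].
Definition rdot2 (p q : X) : R := rdot I1 p.1 q.1 + rdot I3 p.2 q.2.

Let hL1 := real_hilbert_L2 H_norm H_separable mI1.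
Let hL3 := real_hilbert_L2 H_norm H_separable mI3.

Lemma real_hilbert_coupled : real_hilbert mem2 rdot2. Proof. exact: real_hilbert_prod hL1 hL3. Qed.
Let hX := real_hilbert_coupled.

Lemma rdot2_adj (c : R[i]) u v : rdot2 (c *: u) v = rdot2 u (c^*%C *: v).
Proof. by rewrite /rdot2 /= !rdot_adj. Qed.

Definition coupled_sol (u h : X) : Prop :=
  [/\ weak_sol ip I1 D1 B1 u.1 h.1, weak_sol ip I3 D3 B3 u.2 h.2 &
      exists x, trace ip I1 a1 u.1 x /\ trace ip I3 a3 u.2 (W x)].

Lemma rip_unitary x y : rip (W x) (W y) = rip x y.
Proof. by rewrite /rip W_unitary.1. Qed.

Lemma coupled_mem u h : coupled_sol u h -> mem2 u /\ mem2 h.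
Proof. by move=> [[m1 m2 _] [m3 m4 _] _]. Qed.

Lemma coupledD u h u' h' : coupled_sol u h -> coupled_sol u' h' -> coupled_sol (u + u') (h + h').
Proof.
move=> [w1 w3 [x [t1 t3]]] [w1' w3' [x' [t1' t3']]]; split.
- exact: (weak_solD H_norm H_separable mI1).
- exact: (weak_solD H_norm H_separable mI3).
- by exists (x + x'); rewrite WD; split; [exact: (traceD H_norm t1)|exact: (traceD H_norm t3)].
Qed.

Lemma coupledZ (r : R) u h : coupled_sol u h -> coupled_sol (r%:C *: u) (r%:C *: h).
Proof.
move=> [w1 w3 [x [t1 t3]]]; split.
- exact: (weak_solZ H_norm H_separable mI1).
- exact: (weak_solZ H_norm H_separable mI3).
- by exists (r%:C *: x); rewrite WZ; split; [exact: (traceZ H_norm _ t1)|exact: (traceZ H_norm _ t3)].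
Qed.

Lemma coupled_i u h : coupled_sol u h -> coupled_sol ('i%C *: u) ('i%C *: h).
Proof.
move=> [w1 w3 [x [t1 t3]]]; split.
- exact: (weak_soli H_norm H_separable mI1 sB1).
- exact: (weak_soli H_norm H_separable mI3 sB3).
- by exists ('i%C *: x); rewrite WZ; split; [exact: (traceZ H_norm _ t1)|exact: (traceZ H_norm _ t3)].
Qed.

Lemma coupledNi u h : coupled_sol u h -> coupled_sol (- 'i%C *: u) (- 'i%C *: h).
Proof. by move=> /coupled_i/(coupledZ (-1)); rewrite raddfN /= !scalerA !mulN1r. Qed.

Lemma coupled0 : coupled_sol 0 0.
Proof.
split; [exact: (weak_sol0 H_norm H_separable mI1)|exact: (weak_sol0 H_norm H_separable mI3)|].
by exists 0; rewrite W0; split; exact: trace0.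
Qed.

Lemma coupled_green u h u' h' : coupled_sol u h -> coupled_sol u' h' ->
  rdot2 h u' + rdot2 u h' = 0.
Proof.
move=> [w1 w3 [x [t1 t3]]] [w1' w3' [x' [t1' t3']]].
have := green_trace H_norm H_separable hI1 sB1 w1 w1' t1 t1'.
have := green_trace H_norm H_separable hI3 sB3 w3 w3' t3 t3'.
rewrite rip_unitary /rdot2; lra.
Qed.

Lemma rdot2_eq0 p : mem2 p -> rdot2 p p = 0 -> rdot I1 p.1 p.1 = 0 /\ rdot I3 p.2 p.2 = 0.
Proof.
move=> [m1 m3]; rewrite /rdot2; have := rh_ge0 hL1 m1; have := rh_ge0 hL3 m3.
by move=> *; split; lra.
Qed.

Lemma coupled_null u h u' h' : coupled_sol u h -> mem2 u' -> mem2 h' ->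
  rdot2 (u' - u) (u' - u) = 0 -> rdot2 (h' - h) (h' - h) = 0 -> coupled_sol u' h'.
Proof.
move=> c mu_ mh; have [mu0 mh0] := coupled_mem c.
move=> /(rdot2_eq0 (rhB hX mu_ mu0))[u1 u3] /(rdot2_eq0 (rhB hX mh mh0))[h1 h3].
have [w1 w3 [x [t1 t3]]] := c; have [m1 m3] := mu_; have [k1 k3] := mh.
have [w1' t1'] := weak_sol_null H_norm H_separable hI1 sB1 w1 m1 k1 u1 h1.
have [w3' t3'] := weak_sol_null H_norm H_separable hI3 sB3 w3 m3 k3 u3 h3.
by split => //; exists x; split; [exact: t1'|exact: t3'].
Qed.

(** Exactly one half line accepts a prescribed trace, according to the sign of [Re c]. The other one
    is solved first, and its trace is carried over by [W] or by a preimage under [W]. *)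
Lemma coupled_solve (c : R[i]) k : mem2 k -> complex.Re c != 0 ->
  exists u, coupled_sol u (c *: u + k).
Proof.
move=> [k1 k3] c0; have := c0; rewrite neq_lt => /orP[cn|cp].
  have [u1 w1 _] := weak_sol_solve H_norm H_separable hI1 sB1 0 k1 c0.
  have [x t1] := trace_exists H_norm H_separable hI1 sB1 w1.
  have [u3 w3 t3] := weak_sol_solve H_norm H_separable hI3 sB3 (W x) k3 c0.
  exists (u1, u3); split => //; exists x; split => //; apply: t3; lra.
have [u3 w3 _] := weak_sol_solve H_norm H_separable hI3 sB3 0 k3 c0.
have [y t3] := trace_exists H_norm H_separable hI3 sB3 w3.
have [x xy] := W_unitary.2 y.
have [u1 w1 t1] := weak_sol_solve H_norm H_separable hI1 sB1 x k1 c0.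
exists (u1, u3); split => //; exists x; rewrite xy; split => //; apply: t1; lra.
Qed.

(** The classical criterion: a symmetric operator whose two opposite shifts are onto contains its
    adjoint. *)
Lemma coupled_maximal z w : mem2 z -> mem2 w ->
  (forall u h, coupled_sol u h -> rdot2 h z + rdot2 u w = 0) -> coupled_sol z w.
Proof.
move=> mz mw zw.
(* This [u] has [h = u + (w - z)], so [w - h = z - u]. The difference [z - u] is then orthogonal to
   all [h' + u'], and the shift by [-1] shows that it is itself of this form. *)
have [|u cu] := coupled_solve (c := 1) (rhB hX mw mz); first exact: oner_neq0.
have [mu_ mh] := coupled_mem cu; set h := 1 *: u + _ in cu mh.
have dE : w - h = z - u by rewrite /h scale1r opprD opprB addrCA subrKC addrC.
have md := rhB hX mz mu_.
have orth u' h' : coupled_sol u' h' -> rdot2 (h' + u') (z - u) = 0.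
  move=> c'; have [m1 m2] := coupled_mem c'; have := coupled_green c' cu; have := zw _ _ c'.
  rewrite (rh_Dl hX) // -{2}dE !(rh_Br hX) //; lra.
have [|u' c'] := coupled_solve (c := -1) md.
  by rewrite /= oppr_eq0 oner_neq0.
have d0 : rdot2 (z - u) (z - u) = 0.
  by have := orth _ _ c'; rewrite scaleN1r addrAC addNr add0r.
by apply: coupled_null cu mz mw _ _; rewrite ?dE.
Qed.

(** A vector [z] orthogonal to the domain makes [0], [z] a coupled pair by maximality, and
    [weak_sol_zero] then kills [z]. *)
Lemma coupled_dense f (e : R) : mem2 f -> 0 < e ->
  exists u h, coupled_sol u h /\ rdot2 (f - u) (f - u) < e.
Proof.
move=> mf e0; apply: contrapT => hn.
have [|||||z [mz z0 hz]] := @orthogonal_of_not_dense _ _ _ _ hX [set u | exists h, coupled_sol u h] f e mf e0.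
- by move=> u [h /coupled_mem[]].
- by exists 0; exact: coupled0.
- by move=> u v [h ch] [k ck]; exists (h + k); exact: coupledD.
- by move=> r u [h ch]; exists (r%:C *: h); exact: coupledZ.
- by move=> u [h ch]; rewrite leNgt; apply/negP => lt; apply: hn; exists u, h.
have [w1 w3 _] : coupled_sol 0 z.
  apply: coupled_maximal => //; first exact: (rh0 hX).
  move=> u h ch; have [mu_ mh] := coupled_mem ch.
  rewrite hz; last by exists h.
  by have := rh_Zl hX 0 (rh0 hX) mh; rewrite scale0r mul0r addr0 (rh_sym hX mh (rh0 hX)).
have e1 := weak_sol_zero H_norm H_separable mI1 (half_line_open hI1) sB1 w1.
have e3 := weak_sol_zero H_norm H_separable mI3 (half_line_open hI3) sB3 w3.
suff : rdot2 z z = 0 by move=> z1; rewrite z1 ltxx in z0.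
rewrite /rdot2 (rdot_ae ip e1 e1) (rdot_ae ip e3 e3).
have zz K : measurable (K : set (measurableTypeR R)) -> rdot K (fun=> 0 : H) (fun=> 0) = 0.
  move=> mK; rewrite -[RHS](mul0r (fine (mu K))) -(Rintegral_cst mu mK).
  by apply: eq_Rintegral => t _; rewrite rip0l.
by rewrite !zz ?addr0.
Qed.

Lemma coupled_kernel u (ga : R) : coupled_sol u ((ga%:C * 'i%C) *: u) -> rdot2 u u = 0.
Proof.
move=> [w1 w3 _]; have h t : rip ((ga%:C * 'i%C) *: u.1 t) (u.1 t) = 0 by exact: ripZ_skew.
have h' t : rip ((ga%:C * 'i%C) *: u.2 t) (u.2 t) = 0 by exact: ripZ_skew.
rewrite /rdot2 (weak_sol_kernel H_norm H_separable hI1 sB1 w1 h).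
by rewrite (weak_sol_kernel H_norm H_separable hI3 sB3 w3 h') addr0.
Qed.

(** By maximality a vector orthogonal to the range solves the homogeneous equation, whose only
    solutions are null. *)
Lemma coupled_range_dense f (ga e : R) : mem2 f -> 0 < e ->
  exists u h, coupled_sol u h /\
    let w := h - (ga%:C * 'i%C) *: u in rdot2 (f - w) (f - w) < e.
Proof.
move=> mf e0; apply: contrapT => hn; set c := ga%:C * 'i%C in hn.
have cc : c^*%C = - c by apply/eqP; rewrite eq_complex /=; apply/andP; split; apply/eqP; ring.
have [|||||z [mz z0 hz]] := @orthogonal_of_not_dense _ _ _ _ hX
    [set w | exists u h, coupled_sol u h /\ w = h - c *: u] f e mf e0.
- by move=> _ [u [h [/coupled_mem[mu_ mh] ->]]]; apply: (rhB hX) => //; exact: (rhZ hX).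
- by exists 0, 0; split; [exact: coupled0|rewrite scaler0 subr0].
- move=> _ _ [u [h [ch ->]]] [v [k [ck ->]]]; exists (u + v), (h + k); split; first exact: coupledD.
  by rewrite scalerDr opprD addrACA.
- move=> r _ [u [h [ch ->]]]; exists (r%:C *: u), (r%:C *: h); split; first exact: coupledZ.
  by rewrite scalerBr !scalerA mulrC.
- by move=> _ [u [h [ch ->]]]; rewrite leNgt; apply/negP => lt; apply: hn; exists u, h.
suff : coupled_sol z (c *: z) by move=> /coupled_kernel z1; rewrite z1 ltxx in z0.
apply: coupled_maximal => //; first exact: (rhZ hX).
move=> u h ch; have [mu_ mh] := coupled_mem ch; have mc := rhZ hX c mu_.
have -> : rdot2 u (c *: z) = - rdot2 (c *: u) z.
  by rewrite -(rh_Nl hX) // -scaleNr -cc rdot2_adj conjcK.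
by rewrite -(rh_Bl hX) // hz //; exists u, h.
Qed.

(** The source lives on [I3] alone. On [I1] the coefficient is imaginary, so Green's formula gives
    trace 0; [W] sends it to trace 0 on [I3], where the source is unsolvable. *)
Lemma coupled_not_onto (ga : R) : (exists x : H, x != 0) ->
  exists2 g, mem2 g & forall u, ~ coupled_sol u ((ga%:C * 'i%C) *: u + g).
Proof.
move=> [x x0]; have [g mg hg] := weak_sol_unsolvable H_norm H_separable hI3 sB3 ga x0.
exists (0, g); first by split => //; exact: (rh0 hL1).
move=> u [w1 w3 [y [t1 t3]]]; rewrite /= addr0 in w1.
have [m1 _] := weak_sol_mem w1.
have G := green_trace H_norm H_separable hI1 sB1 w1 w1 t1 t1.
have y0 : y = 0.
  apply: (nsq_eq0 H_norm); move: G; rewrite (rdotC ip I1 u.1).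
  rewrite (rdot_scale_self H_norm H_separable hI1) //= mul1r => ->; ring.
by rewrite y0 W0 in t3; exact: hg w3.
Qed.

End Coupled.

(** * The extension and its spectrum *)

Section Extension.
Context (R : realType) (H : completeNormedModType R[i])
  (ip : {dot H for @Num.conj R[i]}).
Hypothesis H_norm : forall x : H, `|x| ^+ 2 = ip x x.
Hypothesis H_separable : separable H.
Variables (a1 a3 : R) (D1 D3 : set H) (A1 A3 : H -> H).
Hypotheses (sA1 : selfadjoint (graph_of ip D1 A1)) (sA3 : selfadjoint (graph_of ip D3 A3)).
Variables (N1 : neg_space ip D1 A1) (N3 : neg_space ip D3 A3).
Variables (W : {linear H -> H}) (W_unitary : unitary ip W).

Let sB1 := skew_adjoint_of_selfadjoint sA1.
Let sB3 := skew_adjoint_of_selfadjoint sA3.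
Let hI1 : half_line (`]-oo, a1[%classic : set R) a1 1. Proof. by left. Qed.
Let hI3 : half_line (`]a3, +oo[%classic : set R) a3 (-1). Proof. by right. Qed.
Local Notation T := (L_ext a1 a3 N1 N3 W).
Local Notation E := (L2_101 ip a1 a3).
Local Notation X := ((R -> H) * (R -> H))%type.
Local Notation mem2 := (@mem2 R H a1 a3).
Local Notation rdot2 := (@rdot2 R H ip a1 a3).
Local Notation csol := (coupled_sol ip a1 a3 D1 D3 (fun g => 'i%C *: A1 g) (fun g => 'i%C *: A3 g) W).
Let hX := real_hilbert_coupled H_norm H_separable a1 a3.

Let ii (u : X) : - 'i%C *: ('i%C *: u) = u.
Proof. by rewrite scalerA mulNr -expr2 sqr_i opprK scale1r. Qed.

Let ii' (u : X) : 'i%C *: (- 'i%C *: u) = u.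
Proof. by rewrite scalerA mulrN -expr2 sqr_i opprK scale1r. Qed.

Lemma hdot_L2_101 (u v : X) : @hdot R E u v = rdot2 u v +i* rdot2 u ('i%C *: v).
Proof. by rewrite [LHS]/(L2dot ip _ u.1 v.1 + L2dot ip _ u.2 v.2) !L2dotE. Qed.

Lemma hnorm_L2_101 (u : X) : @hnorm R E u = Num.sqrt (rdot2 u u).
Proof. by rewrite /hnorm hdot_L2_101. Qed.

Lemma hnorm_lt (u : X) (e : R) : 0 < e -> rdot2 u u < e ^+ 2 -> @hnorm R E u < e.
Proof.
by move=> e0 h; rewrite hnorm_L2_101 -(ger0_norm (ltW e0)) -sqrtr_sqr ltr_sqrt // exprn_gt0.
Qed.

Lemma sqrt_rdot2_eq0 (u : X) : mem2 u -> Num.sqrt (rdot2 u u) = 0 -> rdot2 u u = 0.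
Proof. by move=> mu_ /eqP; rewrite sqrtr_eq0 => h; apply/eqP; rewrite eq_le h; exact: (rh_ge0 hX). Qed.

Lemma rdot2_i (u : X) : rdot2 ('i%C *: u) ('i%C *: u) = rdot2 u u /\ rdot2 (- 'i%C *: u) (- 'i%C *: u) = rdot2 u u.
Proof.
split; rewrite rdot2_adj scalerA (_ : _ * _ = 1) ?scale1r //.
  by apply/eqP; rewrite eq_complex /=; apply/andP; split; apply/eqP; ring.
by apply/eqP; rewrite eq_complex /=; apply/andP; split; apply/eqP; ring.
Qed.

Lemma rdot2N (u : X) : mem2 u -> rdot2 (- u) (- u) = rdot2 u u.
Proof. by move=> mu_; rewrite (rh_Nl hX) ?(rh_Nr hX) ?opprK //; exact: (rhN hX). Qed.

Let shiftE (al : R) : - 'i%C * al%:C = (- al)%:C * 'i%C.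
Proof. by apply/eqP; rewrite eq_complex /=; apply/andP; split; apply/eqP; ring. Qed.

(** Multiplication by [- 'i] is an isometry that takes the operator equation shifted by [al] to the
    first-order equation with coefficient [- 'i * al]. *)
Lemma rdot2_shift (al : R) (u v g : X) :
  let w := ((- al)%:C * 'i%C) *: u + g - - 'i%C *: v in
  let w' := 'i%C *: g - (v - al%:C *: u) in rdot2 w w = rdot2 w' w'.
Proof.
move=> w w'; rewrite -(rdot2_i w').2 (_ : - 'i%C *: w' = w) //.
rewrite /w /w' scalerBr ii scalerBr scalerA shiftE opprB addrA (addrC g).
by [].
Qed.

Lemma rdot2_shift0 (al : R) (u v : X) : mem2 u -> mem2 v ->
  rdot2 (((- al)%:C * 'i%C) *: u - - 'i%C *: v) (((- al)%:C * 'i%C) *: u - - 'i%C *: v) =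
  rdot2 (v - al%:C *: u) (v - al%:C *: u).
Proof.
move=> mu_ mv; have := rdot2_shift al u v 0.
by rewrite /= addr0 scaler0 sub0r (rdot2N (rhB hX mv (rhZ hX _ mu_))).
Qed.

Lemma rdot2_unshift (al : R) (f u h : X) :
  rdot2 (f - ('i%C *: h - al%:C *: u)) (f - ('i%C *: h - al%:C *: u)) =
  rdot2 (- 'i%C *: f - (h - ((- al)%:C * 'i%C) *: u)) (- 'i%C *: f - (h - ((- al)%:C * 'i%C) *: u)).
Proof.
rewrite -(rdot2_i (f - _)).2 (_ : - 'i%C *: (f - _) = - 'i%C *: f - (h - ((- al)%:C * 'i%C) *: u)) //.
by rewrite !scalerBr ii -shiftE scalerA.
Qed.

(** The bridge to the real theory: boundary values of continuous representatives become traces, and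
    [v = L u] becomes [u' = B u - i v]. *)
Lemma L_extP (u v : X) : T (u, v) <-> csol u (- 'i%C *: v).
Proof.
have m1 := half_line_measurable hI1; have m3 := half_line_measurable hI3.
split => [[[/= o1 o3] [x [b1 b3]]]|[w1 w3 [x [t1 t3]]]].
  split; [exact: (max_opP H_norm H_separable sA1 N1 m1 _ _).1 o1|exact: (max_opP H_norm H_separable sA3 N3 m3 _ _).1 o3|].
  by exists x; split; exact: boundary_trace.
split; first by split; [exact: (max_opP H_norm H_separable sA1 N1 m1 _ _).2 w1|exact: (max_opP H_norm H_separable sA3 N3 m3 _ _).2 w3].
exists x; split.
  exact: (trace_boundary H_norm H_separable hI1 sB1 w1).
exact: (trace_boundary H_norm H_separable hI3 sB3 w3).
Qed.

Lemma L_ext_green (u v u' v' : X) : T (u, v) -> T (u', v') -> rdot2 v u' = rdot2 u v'.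
Proof.
move=> /L_extP c0 /L_extP c'; have c := coupled_i H_norm H_separable sB1 sB3 c0; rewrite ii' in c.
have [mu_ _] := coupled_mem c0; have [_ mv'] := coupled_mem c'.
have := coupled_green H_norm H_separable sB1 sB3 W_unitary c c'.
have mv2 : mem2 v' by rewrite -[v']ii'; exact: (rhZ hX).
rewrite rdot2_adj scalerA (_ : 'i%C^*%C * - 'i%C = -1) ?scaleN1r ?(rh_Nr hX) //; first lra.
by apply/eqP; rewrite eq_complex /=; apply/andP; split; apply/eqP; ring.
Qed.

Lemma L_ext_mem (u v : X) : T (u, v) -> mem2 u /\ mem2 v.
Proof.
move=> /L_extP/coupled_mem[mu_ mv]; split => //.
by rewrite -[v]ii'; exact: (rhZ hX).
Qed.

Lemma L_ext_i (u v : X) : T (u, v) -> T ('i%C *: u, 'i%C *: v).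
Proof. by move=> /L_extP c; apply/L_extP; have := coupled_i H_norm H_separable sB1 sB3 c; rewrite ii ii'. Qed.

Lemma L_ext_selfadjoint : selfadjoint T.
Proof.
split.
  move=> f mf e e0; have [u [h [ch fu]]] := coupled_dense H_norm H_separable sB1 sB3 W_unitary mf (exprn_gt0 2 e0).
  have [mu_ _] := coupled_mem ch.
  exists u; split => //; first by exists ('i%C *: h); apply/L_extP; rewrite ii.
  exact: hnorm_lt.
apply/seteqP; split => [[u v] t|[u v] [mu_ mv h]].
  have [mu_ mv] := L_ext_mem t.
  (* The imaginary part is the real identity for the pair multiplied by ['i], which again belongs to
     the operator. *)
  split => // -[u' v'] t'; change (@hdot R E v' u = @hdot R E u' v); rewrite !hdot_L2_101; congr (_ +i* _).
    exact: L_ext_green t' t.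
  exact: L_ext_green t' (L_ext_i t).
apply/L_extP; apply: (coupled_maximal H_norm H_separable sB1 sB3 W_unitary mu_ (rhZ hX _ mv)) => u' h' c'.
have [mu' mh'] := coupled_mem c'.
have t' : T (- 'i%C *: u', h').
  by apply/L_extP; exact: (coupledNi H_norm H_separable sB1 sB3 c').
have : @hdot R E h' u = @hdot R E (- 'i%C *: u') v := h _ t'; rewrite !hdot_L2_101 => -[e1 _]; rewrite e1 rdot2_adj.
have -> : (- 'i%C)^*%C = 'i%C :> R[i] by apply/eqP; rewrite eq_complex /= oppr0 opprK !eqxx.
by rewrite scaleNr (rh_Nr hX) ?addrN //; exact: (rhZ hX).
Qed.

Lemma L0_sub_L_ext : L0_101 a1 a3 N1 N3 `<=` T.
Proof.
move=> [u v] [/= m1 m3]; apply/L_extP.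
have [w1 t1] := min_op_trace H_norm H_separable hI1 sA1 m1.
have [w3 t3] := min_op_trace H_norm H_separable hI3 sA3 m3.
by split => //; exists 0; rewrite raddf0.
Qed.

Lemma L_ext_continuous_spectrum : (exists x : H, x != 0) ->
  continuous_spectrum T = range (real_complex R).
Proof.
move=> Hx; apply/seteqP; split => [l [_ _ [f [mf hf]]]|_ [al _ <-]].
  have [l0|l0] := eqVneq (complex.Im l) 0.
    by exists (complex.Re l) => //; case: (l) l0 => x y /= ->.
  (* The real part of [- 'i * l] is the imaginary part of [l]; so for nonreal [l] every [f] lies in
     the shifted range. *)
  have [|u cu] := coupled_solve H_norm H_separable sB1 sB3 W_unitary (c := - 'i%C * l) (rhZ hX (- 'i%C) mf).
    by case: (l) l0 => x y /=; apply: contra_neq => h; rewrite -[RHS]h; ring.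
  exfalso; have fl : shifted_range T l f.
    exists (u, f + l *: u); split; last by rewrite /= addrK.
    by apply/L_extP; rewrite scalerDr scalerA addrC.
  have := hf _ fl; rewrite subrr hnorm_L2_101.
  have := rh_Zl hX 0 (rh0 hX) (rh0 hX); rewrite scale0r mul0r => ->.
  by rewrite sqrtr0 eqxx.
split.
- move=> [u v] t; rewrite /= !hnorm_L2_101 => s0; have [mu_ mv] := L_ext_mem t.
  have ct := (L_extP u v).1 t.
  have w0 := sqrt_rdot2_eq0 (rhB hX mv (rhZ hX _ mu_)) s0.
  suff : csol u (((- al)%:C * 'i%C) *: u) by move=> /(coupled_kernel H_norm H_separable sB1 sB3) ->; rewrite sqrtr0.
  (* Only the norm of [v - al u] is known to vanish, so the eigenvalue equation is reached by
     changing representatives. *)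
  apply: (coupled_null H_norm H_separable sB1 sB3 ct) => //; first exact: (rhZ hX).
    by have := rh_Zl hX 0 (rh0 hX) (rh0 hX); rewrite subrr scale0r mul0r.
  exact: etrans (rdot2_shift0 al mu_ mv) w0.
- move=> f mf e e0.
  have [u [h [ch fu]]] := coupled_range_dense H_norm H_separable sB1 sB3 W_unitary (- al) (rhZ hX (- 'i%C) mf) (exprn_gt0 2 e0).
  have [mu_ mh] := coupled_mem ch; rewrite /= in fu.
  have t : T (u, 'i%C *: h) by apply/L_extP; rewrite ii.
  exists ('i%C *: h - al%:C *: u); split.
  + by apply: (rhB hX); exact: (rhZ hX).
  + by exists (u, 'i%C *: h).
  + apply: (hnorm_lt e0); exact: (@eq_ind_r _ _ (fun r => r < e ^+ 2) fu _ (rdot2_unshift al f u h)).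
- have [g mg hg] := coupled_not_onto H_norm H_separable a1 a3 sB1 sB3 W (- al) Hx.
  exists ('i%C *: g); split; first exact: (rhZ hX).
  move=> _ [[u v] [t ->]] /=; rewrite hnorm_L2_101; apply/eqP => s0; apply: (hg u).
  have [mu_ mv] := L_ext_mem t.
  have w0 := sqrt_rdot2_eq0 (rhB hX (rhZ hX _ mg) (rhB hX mv (rhZ hX _ mu_))) s0.
  apply: (coupled_null H_norm H_separable sB1 sB3 ((L_extP u v).1 t)) => //.
  + by apply: (rhD hX) => //; exact: (rhZ hX).
  + by have := rh_Zl hX 0 (rh0 hX) (rh0 hX); rewrite subrr scale0r mul0r.
  + exact: etrans (rdot2_shift al u v g) w0.
Qed.

End Extension.

Theorem theorem3p2 (R : realType) (H : completeNormedModType R[i])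
  (ip : {dot H for @Num.conj R[i]})
  (H_norm : forall x : H, `|x| ^+ 2 = ip x x)
  (H_separable : separable H)
  (H_dim_gt0 : exists x : H, x != 0)
  (a1 a3 : R) (lt_a1a3 : a1 < a3)
  (D1 D3 : set H) (A1 A3 : H -> H)
  (A1_selfadjoint : selfadjoint (graph_of ip D1 A1))
  (A3_selfadjoint : selfadjoint (graph_of ip D3 A3))
  (N1 : neg_space ip D1 A1) (N3 : neg_space ip D3 A3)
  (W1 : {linear H -> H}) (W1_unitary : unitary ip W1) :
  [/\ selfadjoint (L_ext a1 a3 N1 N3 W1),
      L0_101 a1 a3 N1 N3 `<=` L_ext a1 a3 N1 N3 W1 &
      continuous_spectrum (L_ext a1 a3 N1 N3 W1) = range (real_complex R)].
Proof.
split.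
- exact: L_ext_selfadjoint.
- exact: L0_sub_L_ext.
- exact: L_ext_continuous_spectrum.
Qed.
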